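(* Let $k\in\mathbb{N}_0$, $\alpha\in\mathbb{C}$, and let $\beta,\gamma>-1$ be real numbers such that if $\beta,\gamma\in(-1,0)$ then $\beta+\gamma+1\neq0$. Let $\rho\in\{z\in\mathbb{C}:|z|<1\}$ and, for $x\in[-1,1]$, put $R:=\sqrt{1+\rho^2-2\rho x}$. Then $$\int_{-1}^1\frac{(1-x)^\gamma(1+x)^\beta}{R\,(1+R-\rho)^\alpha(1+R+\rho)^\beta}\,P_k^{(\gamma,\beta)}(x)\,dx=\frac{2^{1+\gamma-\alpha}\,\Gamma(\gamma+k+1)\Gamma(\beta+k+1)\left(\frac{\alpha+\beta+1}{2}\right)_k\left(\frac{\alpha+\beta+2}{2}\right)_k}{\Gamma(\gamma+\beta+2)\,(\alpha+\beta+1)_k\left(\frac{\gamma+\beta+2}{2}\right)_k\left(\frac{\gamma+\beta+3}{2}\right)_k\,k!}$$ $$\times\,{}_3F_2\!\left(\begin{array}{c}\beta+k+1,\ \alpha+\beta+2k+1,\ \alpha-\gamma\\ \alpha+\beta+k+1,\ \gamma+\beta+2k+2\end{array};\rho\right)\rho^k.$$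
   Context: $\mathbb{N}_0=\{0,1,2,\dots\}$. Square roots and complex powers are principal. $(z)_n:=\prod_{i=1}^n(z+i-1)$ is the Pochhammer symbol. ${}_pF_q(a_1,\dots,a_p;b_1,\dots,b_q;z):=\sum_{n=0}^\infty\frac{(a_1)_n\cdots(a_p)_n}{(b_1)_n\cdots(b_q)_n}\frac{z^n}{n!}$. The Jacobi polynomials are $P_n^{(\alpha,\beta)}(z):=\frac{(\alpha+1)_n}{n!}\,{}_2F_1\left(-n,n+\alpha+\beta+1;\alpha+1;\frac{1-z}{2}\right)$. Interpretation for exceptional $\alpha$: if $\alpha+\beta+1\in\{0,-1,-2,\dots\}$, the product $\frac{\left(\frac{\alpha+\beta+1}{2}\right)_k\left(\frac{\alpha+\beta+2}{2}\right)_k}{(\alpha+\beta+1)_k}\,{}_3F_2(\cdots;\rho)$ is understood as its analytic continuation in $\alpha$, namely $4^{-k}\sum_{n=0}^\infty\frac{(\beta+k+1)_n(\alpha-\gamma)_n(\alpha+\beta+k+n+1)_k}{(\gamma+\beta+2k+2)_n}\frac{\rho^n}{n!}$. *)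

(* Defs.v *)
(* Stdlib's real numbers together with Coquelicot's complex numbers, series
   and (improper) Riemann integrals. *)
From Stdlib Require Import Reals Factorial List.
From Coquelicot Require Import Coquelicot.
Import ListNotations.
Open Scope C_scope.

(** * Principal branches *)

Definition Cexp (z : C) : C :=
  ((exp (Re z) * cos (Im z))%R, (exp (Re z) * sin (Im z))%R).

(* The argument in (-PI, PI]; its value at [z = 0] is irrelevant. *)
Definition Carg (z : C) : R :=
  if Rlt_dec (Im z) 0 then (- acos (Re z / Cmod z))%R
  else acos (Re z / Cmod z).

Definition Clog (z : C) : C := (ln (Cmod z), Carg z).

(* Meaningful for [z <> 0] only. *)
Definition Cpower (z w : C) : C := Cexp (w * Clog z).

(* The square root with nonnegative real part, and with nonnegative imaginary
   part on the cut. *)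
Definition Csqrt (z : C) : C :=
  (sqrt ((Cmod z + Re z) / 2),
   if Rlt_dec (Im z) 0 then (- sqrt ((Cmod z - Re z) / 2))%R
   else sqrt ((Cmod z - Re z) / 2)).

(** * Special functions *)

(* Euler's integral, hence meaningful for [0 < s] only. *)
Definition Gamma (s : R) : R :=
  RInt_gen (fun t : R => (Rpower t (s - 1) * exp (- t))%R)
    (at_right 0) (Rbar_locally p_infty).

Fixpoint poch (z : C) (n : nat) : C :=
  match n with
  | O => 1
  | S m => poch z m * (z + INR m)
  end.

Definition Cprod (l : list C) : C := fold_right Cmult (RtoC 1) l.

(* The sum of a series of complex numbers; meaningful only when it
   converges. *)
Definition CSeries (a : nat -> C) : C :=
  (Series (fun n => Re (a n)), Series (fun n => Im (a n))).

Definition pFq_term (a b : list C) (z : C) (n : nat) : C :=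
  Cprod (map (fun c => poch c n) a) / Cprod (map (fun c => poch c n) b)
    * (z ^ n / INR (fact n)).

Definition pFq (a b : list C) (z : C) : C := CSeries (pFq_term a b z).

Definition jacobiP (n : nat) (a b z : C) : C :=
  poch (a + 1) n / INR (fact n)
    * pFq [- INR n; INR n + a + b + 1] [a + 1] ((1 - z) / 2).

(** * Exceptional values of the parameter *)

Definition nonpos_int (z : C) : Prop := exists m : nat, z = - INR m.

(* The continuation in [alpha] of
     ((alpha+beta+1)/2)_k ((alpha+beta+2)/2)_k / (alpha+beta+1)_k
       * 3F2 (beta+k+1, alpha+beta+2k+1, alpha-gamma;
              alpha+beta+k+1, gamma+beta+2k+2; rho)
   is [/ 4 ^ k] times the sum of the following terms: one uses
   (a/2)_k ((a+1)/2)_k = 4^(-k) (a)_(2k) and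
   (a)_(2k) (a+2k)_n / ((a)_k (a+k)_n) = (a+k+n)_k. *)
Definition continued_term (k : nat) (alpha : C) (beta gamma : R) (rho : C)
    (n : nat) : C :=
  poch (beta + INR k + 1) n * poch (alpha - gamma) n
    * poch (alpha + beta + INR k + INR n + 1) k
    / poch (gamma + beta + 2 * INR k + 2) n
    * (rho ^ n / INR (fact n)).

(* Main.v *)
Require Import Defs.
From Stdlib Require Import Reals Factorial List Wf_nat Lra Lia.
From Coquelicot Require Import Coquelicot.
Import ListNotations.

(** Let H(rho,x) be the reciprocal of R (1+R-rho)^alpha (1+R+rho)^beta.  Up to the
    factor 2^(alpha+beta) it is the generating function in rho of the Jacobi polynomials
    with parameters alpha, beta, so the integral should be a power series in rho.  Its
    coefficients can be found without computing with those polynomials.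

    The case k = 0 comes first.  For fixed x in (-1,1) the logarithmic derivative of
    H(rho,x) in rho is a combination of (x-rho)/R^2, whose coefficients are Chebyshev
    polynomials, and of 1/R, whose coefficients are Legendre polynomials; all of them are
    bounded by 1.  Solving the resulting linear differential equation by power series
    (lemma [ode_solution]) expands H in powers of rho, with the coefficients of
    (1-rho)^(-M) as a majorant that does not depend on x (lemma [kernel_inv_series]).
    Hence the expansion may be integrated term by term against (1-x)^gamma (1+x)^beta, for
    every complex rho in the unit disc (lemma [kernel_integral_moments]).

    The coefficients of the integrated series are determined by its values at real rho.
    There the substitution x = y + rho (1-y^2)/2 of Lagrange, for which R = 1 - rho y,
    maps [-1,1] onto itself and turns the integral into that of
    (1-y)^gamma (1+y)^beta (1 - rho (1+y)/2)^(gamma-alpha), which is Euler's integral for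
    a 2F1 (lemmas [kernel_lagrange], [euler_integral]).  The binomial series and Beta
    integrals give its coefficients, and uniqueness of power series transfers them to
    complex rho (lemmas [jacobi_moment_eq], [kernel_integral]).  Euler's relation between
    Beta and Gamma integrals is obtained from the Bohr-Mollerup characterization of Gamma
    (lemma [beta_integral_Gamma]).

    For general k, expand the Jacobi polynomial in powers of (1-x)/2.  A factor
    ((1-x)/2)^j just replaces gamma by gamma+j, so the coefficient of rho^n becomes a
    finite sum over j, a terminating Saalschutzian 3F2 at 1.  It vanishes for n < k and
    has a closed form for n >= k (lemmas [saalschutz_zero], [saalschutz_value]); this
    yields the factor rho^k and the continued series, from which the 3F2 is recovered
    when alpha+beta+1 is not a nonpositive integer. *)

Open Scope R_scope.

(** * Improper integrals over an open interval *)

(** A pair of filters converging to the two ends of an open interval. The interval (-1,1),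
    which carries the weights, and (0,oo), which carries the Gamma integral, are treated
    together through this interface. *)
Record ends (D : R -> Prop) (Fa Fb : (R -> Prop) -> Prop) : Prop := {
  ends_filter_l : ProperFilter Fa;
  ends_filter_r : ProperFilter Fb;
  ends_convex : forall a b x, D a -> D b -> a <= x <= b -> D x;
  ends_inhabited : exists c, D c;
  ends_below : forall c, D c -> Fa (fun x => D x /\ x <= c);
  ends_above : forall c, D c -> Fb (fun x => D x /\ c <= x) }.

Lemma ends_prod D Fa Fb a0 b0 : ends D Fa Fb -> D a0 -> D b0 -> a0 <= b0 ->
  filter_prod Fa Fb (fun ab => D (fst ab) /\ D (snd ab) /\
    fst ab <= a0 /\ b0 <= snd ab /\ fst ab <= snd ab).
Proof.
  intros H Ha Hb Hab.
  apply (Filter_prod _ _ _ _ _ (ends_below _ _ _ H a0 Ha) (ends_above _ _ _ H b0 Hb)).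
  simpl. intros x y [Dx Hx] [Dy Hy]. repeat split; auto; lra.
Qed.

Lemma ends_dom D Fa Fb (P : R -> Prop) : ends D Fa Fb -> (forall x, D x -> P x) ->
  filter_prod Fa Fb (fun ab => fst ab <= snd ab /\ forall x, fst ab <= x <= snd ab -> P x).
Proof.
  intros H HP. destruct (ends_inhabited _ _ _ H) as [c Hc].
  pose proof (ends_filter_l _ _ _ H) as Fl. pose proof (ends_filter_r _ _ _ H) as Fr.
  generalize (ends_prod _ _ _ _ _ H Hc Hc (Rle_refl c)). apply filter_imp.
  intros [a b] (Da & Db & _ & _ & Hab). simpl in *. split; auto.
  intros x Hx. apply HP. apply (ends_convex _ _ _ H a b); auto.
Qed.

Lemma is_RInt_gen_ends_ext {V : NormedModule R_AbsRing} D Fa Fb (f g : R -> V) l :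
  ends D Fa Fb -> (forall x, D x -> f x = g x) ->
  is_RInt_gen f Fa Fb l -> is_RInt_gen g Fa Fb l.
Proof.
  intros H HE.
  pose proof (ends_filter_l _ _ _ H) as Fl. pose proof (ends_filter_r _ _ _ H) as Fr.
  apply is_RInt_gen_ext.
  generalize (ends_dom _ _ _ _ H HE). apply filter_imp.
  intros [a b] [Hab Hx] x Hx'. simpl in *. apply Hx.
  rewrite Rmin_left, Rmax_right in Hx'; auto. lra.
Qed.

Lemma improper_ext D Fa Fb (f g : R -> R) (l : R) :
  ends D Fa Fb -> (forall x, D x -> f x = g x) ->
  is_RInt_gen f Fa Fb l -> is_RInt_gen g Fa Fb l.
Proof. apply (is_RInt_gen_ends_ext (V := R_NormedModule)). Qed.

Lemma ends_ex_RInt D Fa Fb (f : R -> R) a b : ends D Fa Fb -> (forall x, D x -> continuous f x) ->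
  D a -> D b -> ex_RInt f a b.
Proof.
  intros H Hf Ha Hb. apply (ex_RInt_continuous (V := R_CompleteNormedModule)).
  intros x Hx. apply Hf.
  unfold Rmin, Rmax in Hx. destruct (Rle_dec a b).
  - apply (ends_convex _ _ _ H a b); auto.
  - apply (ends_convex _ _ _ H b a); auto.
Qed.

Lemma ends_RInt_le_larger D Fa Fb (f : R -> R) a b a' b' : ends D Fa Fb ->
  (forall x, D x -> continuous f x) -> (forall x, D x -> 0 <= f x) ->
  D a' -> D b' -> a' <= a -> a <= b -> b <= b' -> RInt f a b <= RInt f a' b'.
Proof.
  intros H Hf Hp Da Db H1 H2 H3.
  assert (D a) by (apply (ends_convex _ _ _ H a' b'); auto; lra).
  assert (D b) by (apply (ends_convex _ _ _ H a' b'); auto; lra).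
  assert (E : forall u v, D u -> D v -> ex_RInt f u v) by (intros; eapply ends_ex_RInt; eauto).
  assert (N : forall u v, D u -> D v -> u <= v -> 0 <= RInt f u v).
  { intros u v Du Dv Huv. apply RInt_ge_0; auto. intros x Hx. apply Hp.
    apply (ends_convex _ _ _ H u v); auto; lra. }
  rewrite <- (RInt_Chasles f a' a b'), <- (RInt_Chasles f a b b') by auto.
  generalize (N a' a Da H0 H1) (N b b' H4 Db H3). unfold plus; simpl. lra.
Qed.

(** For a nonnegative integrand the integrals over compact subintervals increase with the
    interval, so they converge to their supremum. *)
Lemma pos_integrable D Fa Fb (f : R -> R) M : ends D Fa Fb ->
  (forall x, D x -> continuous f x) -> (forall x, D x -> 0 <= f x) ->
  (forall a b, D a -> D b -> a <= b -> RInt f a b <= M) ->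
  exists l, is_RInt_gen f Fa Fb l.
Proof.
  intros H Hf Hp HM.
  destruct (ends_inhabited _ _ _ H) as [c Hc].
  destruct (completeness (fun y => exists a b, D a /\ D b /\ a <= b /\ y = RInt f a b)) as
      [l [Hl1 Hl2]].
  - exists M. intros y (a & b & Ha & Hb & Hab & ->). auto.
  - exists (RInt f c c), c, c. repeat split; auto; lra.
  - exists l.
    pose proof (ends_filter_l _ _ _ H) as Fl. pose proof (ends_filter_r _ _ _ H) as Fr.
    intros P [eps HP].
    change (filter_prod Fa Fb (fun ab => exists y, is_RInt f (fst ab) (snd ab) y /\ P y)).
    (* If no partial integral came within eps of l, then l - eps would be a smaller upper bound. *)
    destruct (Classical_Prop.classic
       (exists a b, D a /\ D b /\ a <= b /\ l - eps < RInt f a b)) as [Hx|Hx].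
    + destruct Hx as (a & b & Ha & Hb & Hab & Hx).
      generalize (ends_prod _ _ _ _ _ H Ha Hb Hab). apply filter_imp.
      intros [a' b'] (Da & Db & H1 & H2 & H3). simpl in *.
      exists (RInt f a' b'). split.
      * apply (RInt_correct (V := R_CompleteNormedModule)), (ends_ex_RInt D Fa Fb); auto.
      * apply HP.
        generalize (ends_RInt_le_larger _ _ _ f a b a' b' H Hf Hp Da Db H1 Hab H2). intros H4.
        assert (RInt f a' b' <= l) by (apply Hl1; exists a', b'; auto).
        change (Rabs (RInt f a' b' - l) < eps). apply Rabs_def1; destruct eps; simpl in *; lra.
    + exfalso. assert (l <= l - eps); [|destruct eps; simpl in *; lra].
      apply Hl2. intros y (a & b & Ha & Hb & Hab & ->).
      destruct (Rle_lt_dec (RInt f a b) (l - eps)); auto. exfalso. apply Hx. exists a, b; auto.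
Qed.

Lemma RInt_le_improper D Fa Fb (f : R -> R) l a b : ends D Fa Fb ->
  (forall x, D x -> continuous f x) -> (forall x, D x -> 0 <= f x) ->
  is_RInt_gen f Fa Fb l -> D a -> D b -> a <= b -> RInt f a b <= l.
Proof.
  intros H Hf Hp Hl Ha Hb Hab.
  pose proof (ends_filter_l _ _ _ H) as Fl. pose proof (ends_filter_r _ _ _ H) as Fr.
  destruct (Rle_lt_dec (RInt f a b) l) as [|Hlt]; auto. exfalso.
  assert (He : 0 < RInt f a b - l) by lra.
  assert (Hn : locally l (fun y => Rabs (y - l) < RInt f a b - l)) by
      (exists (mkposreal _ He); auto).
  pose proof (Hl _ Hn) as Hl'.
  change (filter_prod Fa Fb (fun ab => exists y, is_RInt f (fst ab) (snd ab) y /\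
    Rabs (y - l) < RInt f a b - l)) in Hl'.
  generalize (filter_and _ _ Hl' (ends_prod _ _ _ _ _ H Ha Hb Hab)). intros HF.
  apply filter_ex in HF. destruct HF as [[a' b'] [[y [Hy1 Hy2]] (Da & Db & H1 & H2 & H3)]].
  simpl in *. apply (is_RInt_unique (V := R_CompleteNormedModule)) in Hy1.
  generalize (ends_RInt_le_larger _ _ _ f a b a' b' H Hf Hp Da Db H1 Hab H2). intros H4.
  rewrite Hy1 in H4. apply Rabs_def2 in Hy2. lra.
Qed.

Lemma improper_le D Fa Fb (f g : R -> R) u v : ends D Fa Fb ->
  (forall x, D x -> f x <= g x) ->
  is_RInt_gen f Fa Fb u -> is_RInt_gen g Fa Fb v -> u <= v.
Proof.
  intros H Hfg Hu Hv.
  pose proof (ends_filter_l _ _ _ H) as Fl. pose proof (ends_filter_r _ _ _ H) as Fr.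
  (* The norm comparison between 0 and g - f gives a nonnegative integral of g - f. *)
  assert (Hz : is_RInt_gen (fun _ => 0) Fa Fb 0).
  { generalize (is_RInt_gen_scal _ 0 _ Hu).
    replace (scal 0 u) with 0 by (unfold scal; simpl; unfold mult; simpl; ring).
    apply (is_RInt_gen_ends_ext D); auto. intros; unfold scal; simpl; unfold mult; simpl; ring. }
  generalize (is_RInt_gen_minus _ _ _ _ Hv Hu). intros Hd.
  assert (0 <= minus v u); [|unfold minus, plus, opp in *; simpl in *; lra].
  apply Rle_trans with (Rabs 0); [apply Rabs_pos|].
  generalize (ends_dom _ _ _ _ H Hfg). intros HD.
  refine (RInt_gen_norm (V := R_CompleteNormedModule) _ _ _ _ _ _ Hz Hd).
  - revert HD. apply filter_imp. intros ab [? _]; auto.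
  - revert HD. apply filter_imp. intros ab [_ HH] x Hx. generalize (HH x Hx).
    unfold norm; simpl; unfold abs; simpl. rewrite Rabs_R0. unfold minus, plus, opp; simpl. lra.
Qed.

Lemma improper_unique D Fa Fb (f : R -> R) u v : ends D Fa Fb ->
  is_RInt_gen f Fa Fb u -> is_RInt_gen f Fa Fb v -> u = v.
Proof.
  intros H Hu Hv. apply Rle_antisym; eapply (improper_le D Fa Fb f f); eauto; intros; lra.
Qed.

(** Apply convergence for nonnegative integrands to f + g, which lies between 0 and 2 g. *)
Lemma improper_dominated D Fa Fb (f g : R -> R) G : ends D Fa Fb ->
  (forall x, D x -> continuous f x) -> (forall x, D x -> continuous g x) ->
  (forall x, D x -> Rabs (f x) <= g x) -> is_RInt_gen g Fa Fb G ->
  exists l, is_RInt_gen f Fa Fb l.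
Proof.
  intros H Hf Hg Hfg HG.
  pose proof (ends_filter_l _ _ _ H) as Fl. pose proof (ends_filter_r _ _ _ H) as Fr.
  assert (Hb : forall x, D x -> - g x <= f x <= g x).
  { intros x Hx. specialize (Hfg x Hx). apply Rabs_le_between in Hfg. lra. }
  assert (Hc : forall x, D x -> continuous (fun x => f x + g x) x).
  { intros x Hx. apply (continuous_plus (V := R_NormedModule) f g); auto. }
  destruct (pos_integrable D Fa Fb (fun x => f x + g x) (G + G) H) as [l Hl]; auto.
  - intros x Hx. specialize (Hb x Hx). lra.
  - intros a b Da Db Hab.
    assert (Hs : RInt g a b <= G).
    { apply (RInt_le_improper D Fa Fb); auto. intros x Hx; specialize (Hb x Hx); lra. }
    apply Rle_trans with (RInt (fun x => g x + g x) a b).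
    + apply RInt_le; auto; try (eapply ends_ex_RInt; eauto).
      * intros x Hx. apply (continuous_plus (V := R_NormedModule) g g); auto.
      * intros x Hx. assert (D x) by (apply (ends_convex _ _ _ H a b); auto; lra).
        specialize (Hb x H0). lra.
    + rewrite (RInt_plus g g) by (eapply ends_ex_RInt; eauto). unfold plus; simpl. lra.
  - exists (minus l G).
    apply (is_RInt_gen_ends_ext D Fa Fb (fun y => minus (f y + g y) (g y))); auto.
    + intros. unfold minus, plus, opp; simpl; ring.
    + apply (is_RInt_gen_minus (V := R_NormedModule)); auto.
Qed.

Lemma improper_FTC D Fa Fb (F f : R -> R) la lb : ends D Fa Fb ->
  (forall x, D x -> is_derive F x (f x)) -> (forall x, D x -> continuous f x) ->
  filterlim F Fa (locally la) -> filterlim F Fb (locally lb) ->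
  is_RInt_gen f Fa Fb (lb - la).
Proof.
  intros H HF Hf Ha Hb.
  pose proof (ends_filter_l _ _ _ H) as Fl. pose proof (ends_filter_r _ _ _ H) as Fr.
  intros P HP.
  change (filter_prod Fa Fb (fun ab => exists y, is_RInt f (fst ab) (snd ab) y /\ P y)).
  assert (HL : filterlim (fun ab : R * R => F (snd ab) - F (fst ab)) (filter_prod Fa Fb)
      (locally (lb - la))).
  { apply (filterlim_comp_2 (G := locally lb) (H := locally (- la))
      (fun ab : R * R => F (snd ab)) (fun ab : R * R => - F (fst ab)) Rplus).
    - eapply filterlim_comp; [apply filterlim_snd|exact Hb].
    - eapply filterlim_comp; [eapply filterlim_comp; [apply filterlim_fst|exact Ha]|].
      apply (filterlim_opp (V := R_NormedModule)).
    - apply (filterlim_plus (V := R_NormedModule) lb (- la)). }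
  pose proof (HL P HP) as HL'. unfold filtermap in HL'.
  generalize (filter_and _ _ HL' (ends_dom _ _ _ _ H (fun x Dx => conj (HF x Dx) (Hf x Dx)))).
  apply filter_imp. intros [a b] [HPab [Hab HD]]. simpl in *.
  exists (F b - F a). split; auto.
  apply (is_RInt_derive F f); intros x Hx; rewrite Rmin_left, Rmax_right in Hx by auto;
    destruct (HD x Hx); auto.
Qed.

(** The convergence test used for all model integrands below: a bounded antiderivative
    bounds all partial integrals, so its limits at the ends need not be computed. *)
Lemma improper_bounded_antiderivative D Fa Fb (F f : R -> R) M : ends D Fa Fb ->
  (forall x, D x -> is_derive F x (f x)) -> (forall x, D x -> continuous f x) ->
  (forall x, D x -> 0 <= f x) -> (forall x, D x -> Rabs (F x) <= M) ->
  exists l, is_RInt_gen f Fa Fb l.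
Proof.
  intros H HF Hf Hp HM. apply (pos_integrable D Fa Fb f (M + M)); auto.
  intros a b Da Db Hab.
  assert (HI : is_RInt f a b (F b - F a)).
  { apply (is_RInt_derive F f); intros x Hx; rewrite Rmin_left, Rmax_right in Hx by auto;
    [apply HF|apply Hf]; apply (ends_convex _ _ _ H a b); auto. }
  rewrite (is_RInt_unique _ _ _ _ HI).
  generalize (HM a Da) (HM b Db). intros H1 H2. apply Rabs_le_between in H1, H2. lra.
Qed.

Lemma improper_pos D Fa Fb (f : R -> R) l a b : ends D Fa Fb ->
  (forall x, D x -> continuous f x) -> (forall x, D x -> 0 < f x) -> D a -> D b -> a < b ->
  is_RInt_gen f Fa Fb l -> 0 < l.
Proof.
  intros H Hf Hp Da Db Hab Hl. apply Rlt_le_trans with (RInt f a b).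
  - apply RInt_gt_0; auto.
    + intros x Hx. apply Hp. apply (ends_convex _ _ _ H a b); auto; lra.
    + intros x Hx. apply Hf. apply (ends_convex _ _ _ H a b); auto; lra.
  - apply (RInt_le_improper D Fa Fb); auto; try lra. intros x Hx; left; auto.
Qed.

(** * Euler's Gamma and Beta integrals *)

Lemma ends_unit : ends (fun x => -1 < x < 1) (at_right (-1)) (at_left 1).
Proof.
  constructor; try typeclasses eauto.
  - intros; lra.
  - exists 0; lra.
  - intros c Hc. assert (He : 0 < c - -1) by lra. exists (mkposreal _ He). intros y Hy Hy'.
    change (Rabs (y - -1) < c - -1) in Hy. apply Rabs_def2 in Hy. lra.
  - intros c Hc. assert (He : 0 < 1 - c) by lra. exists (mkposreal _ He). intros y Hy Hy'.
    change (Rabs (y - 1) < 1 - c) in Hy. apply Rabs_def2 in Hy. lra.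
Qed.

Lemma ends_pos : ends (fun x => 0 < x) (at_right 0) (Rbar_locally p_infty).
Proof.
  constructor; try typeclasses eauto.
  - intros; lra.
  - exists 1; lra.
  - intros c Hc. exists (mkposreal _ Hc). intros y Hy Hy'.
    change (Rabs (y - 0) < c) in Hy. apply Rabs_def2 in Hy. lra.
  - intros c Hc. exists c. intros; lra.
Qed.

Lemma Rpower_pos x c : 0 < Rpower x c.
Proof. apply exp_pos. Qed.

Lemma Rpower_succ x c : 0 < x -> Rpower x (c + 1) = Rpower x c * x.
Proof. intros H. rewrite Rpower_plus, Rpower_1; auto. Qed.

Lemma Rpower_pred x c : 0 < x -> Rpower x (c - 1) = Rpower x c / x.
Proof.
  intros H. replace c with ((c - 1) + 1) at 2 by ring. rewrite Rpower_succ by auto. field. lra.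
Qed.

Lemma ln_le_sub1 x : 0 < x -> ln x <= x - 1.
Proof.
  intros H. generalize (exp_ineq1_le (ln x)). rewrite exp_ln by auto. lra.
Qed.

Lemma Rpower_le_1 x c : 0 < x <= 1 -> 0 <= c -> Rpower x c <= 1.
Proof.
  intros [H1 H2] Hc. unfold Rpower. rewrite <- exp_0.
  assert (ln x <= 0) by (generalize (ln_le_sub1 x H1); lra).
  destruct (Rle_lt_or_eq_dec (c * ln x) 0) as [|E]; [nra| |rewrite E; lra].
  left; apply exp_increasing; auto.
Qed.

Lemma Rpower_small c eps : 0 < c -> 0 < eps ->
  exists d, 0 < d /\ forall u, 0 < u < d -> Rpower u c < eps.
Proof.
  intros Hc He. exists (Rpower eps (/ c)). split; [apply Rpower_pos|].
  intros u Hu. replace eps with (Rpower (Rpower eps (/ c)) c).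
  - apply Rlt_Rpower_l; lra.
  - rewrite Rpower_mult, Rinv_l, Rpower_1; auto; lra.
Qed.

(** The concave function t^th lies below its tangent at c. Integrating this inequality
    replaces Hoelder's inequality in the proof of log-convexity. *)
Lemma Rpower_tangent t c th : 0 < t -> 0 < c -> 0 <= th <= 1 ->
  Rpower t th <= Rpower c th * (1 + th * (t / c - 1)).
Proof.
  intros Ht Hc Hth. set (y := t / c). assert (Hy : 0 < y) by (apply Rdiv_lt_0_compat; auto).
  assert (Et : t = c * y) by (unfold y; field; lra).
  rewrite Et, <- (Rpower_mult_distr c y) by auto. clearbody y. clear Et.
  apply Rmult_le_compat_l; [left; apply Rpower_pos|].
  set (z := 1 + th * (y - 1)). assert (Hz : 0 < z) by (unfold z; nra).
  unfold Rpower. rewrite <- (exp_ln z) by auto.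
  assert (th * ln y <= ln z).
  { assert (H1 : ln (y / z) <= y / z - 1) by (apply ln_le_sub1, Rdiv_lt_0_compat; auto).
    assert (H2 : ln (/ z) <= / z - 1) by (apply ln_le_sub1, Rinv_0_lt_compat; auto).
    unfold Rdiv in H1. rewrite ln_mult in H1 by (auto; apply Rinv_0_lt_compat; auto).
    rewrite ln_Rinv in H1, H2 by auto.
    assert (H3 : th * (y * / z - 1) + (1 - th) * (/ z - 1) = 0).
    { replace (th * (y * / z - 1) + (1 - th) * (/ z - 1)) with ((1 + th * (y - 1)) * / z - 1) by
        ring.
      fold z. field. lra. }
    nra. }
  destruct H as [H|H]; [left; apply exp_increasing; auto|rewrite H; lra].
Qed.

(** Log-convexity of moments: integrate the tangent inequality at the point c = I1 / I0,
    where the linear term integrates to zero. *)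
Lemma lyapunov D Fa Fb (f phi : R -> R) I0 I1 It th : ends D Fa Fb ->
  (forall x, D x -> 0 <= f x) -> (forall x, D x -> 0 < phi x) -> 0 <= th <= 1 ->
  0 < I0 -> 0 < I1 ->
  is_RInt_gen f Fa Fb I0 -> is_RInt_gen (fun x => phi x * f x) Fa Fb I1 ->
  is_RInt_gen (fun x => Rpower (phi x) th * f x) Fa Fb It ->
  It <= Rpower (I1 / I0) th * I0.
Proof.
  intros H Hf Hphi Hth H0 H1 Hi0 Hi1 Hit.
  pose proof (ends_filter_l _ _ _ H) as Fl. pose proof (ends_filter_r _ _ _ H) as Fr.
  set (c := I1 / I0). assert (Hc : 0 < c) by (apply Rdiv_lt_0_compat; auto).
  assert (HH : is_RInt_gen (fun x => Rpower c th * ((1 - th) * f x + (th / c) * (phi x * f x))) Fa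
      Fb
    (Rpower c th * ((1 - th) * I0 + (th / c) * I1))).
  { apply (is_RInt_gen_scal (V := R_NormedModule)).
    apply (is_RInt_gen_plus (V := R_NormedModule));
        apply (is_RInt_gen_scal (V := R_NormedModule)); auto. }
  replace (Rpower c th * I0) with (Rpower c th * ((1 - th) * I0 + (th / c) * I1)).
  - apply (improper_le D Fa Fb _ _ _ _ H) with (3 := HH) (2 := Hit).
    intros x Hx. generalize (Rpower_tangent (phi x) c th (Hphi x Hx) Hc Hth). intros HT.
    apply Rle_trans with (Rpower c th * (1 + th * (phi x / c - 1)) * f x).
    + apply Rmult_le_compat_r; auto.
    + right. field. lra.
  - unfold c. field. lra.
Qed.

(** The quotient f / g has period 1, and log-convexity bounds f (x+th) / g (x+th) by (f x /
    g x) (1 + 1/x). Replacing x by x + n and letting n grow removes the error factor. *)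
Lemma bohr_mollerup_le (f g : R -> R) :
  (forall x, 0 < x -> 0 < f x) -> (forall x, 0 < x -> 0 < g x) ->
  (forall x, 0 < x -> f (x + 1) = x * f x) -> (forall x, 0 < x -> g (x + 1) = x * g x) ->
  (forall x th, 0 < x -> 0 <= th <= 1 -> f (x + th) <= Rpower x th * f x) ->
  (forall x th, 0 < x -> 0 <= th <= 1 -> g (x + th) <= Rpower x th * g x) ->
  forall x th, 0 < x -> 0 <= th <= 1 -> f (x + th) / g (x + th) <= f x / g x.
Proof.
  intros Hf Hg Ef Eg Lf Lg x th Hx Hth.
  assert (Hper : forall n y, 0 < y -> f (y + INR n) / g (y + INR n) = f y / g y).
  { induction n as [|n IH]; intros y Hy; [simpl; rewrite Rplus_0_r; auto|].
    rewrite S_INR, <- Rplus_assoc. assert (0 < y + INR n) by (generalize (pos_INR n); lra).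
    rewrite Ef, Eg by auto. rewrite <- (IH y Hy).
    assert (Hq : 0 < g (y + INR n)) by auto. field. split; lra. }
  assert (Hstep : forall y, 0 < y -> f (y + th) / g (y + th) <= (f y / g y) * (1 + / y)).
  { intros y Hy. assert (Hyt : 0 < y + th) by lra.
    assert (Fy := Hf y Hy). assert (Gy := Hg y Hy). assert (Gt := Hg _ Hyt).
    assert (Hl : y * g y <= Rpower (y + th) (1 - th) * g (y + th)).
    { rewrite <- Eg by auto. replace (y + 1) with ((y + th) + (1 - th)) by ring. apply Lg; lra. }
    assert (Hu := Lf y th Hy Hth).
    assert (Hb : Rpower y th * Rpower (y + th) (1 - th) <= y + 1).
    { apply Rle_trans with (Rpower (y + th) th * Rpower (y + th) (1 - th)).
      - apply Rmult_le_compat_r; [left; apply Rpower_pos|]. apply Rle_Rpower_l; lra.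
      - rewrite <- Rpower_plus. replace (th + (1 - th)) with 1 by ring. rewrite Rpower_1; lra. }
    apply (Rmult_le_reg_r (g (y + th) * (g y * y))); [repeat apply Rmult_lt_0_compat; auto|].
    replace (f (y + th) / g (y + th) * (g (y + th) * (g y * y))) with (f (y + th) * (y * g y)) by
        (field; lra).
    replace (f y / g y * (1 + / y) * (g (y + th) * (g y * y))) with
        ((y + 1) * f y * g (y + th)) by (field; lra).
    apply Rle_trans with (Rpower y th * f y * (Rpower (y + th) (1 - th) * g (y + th))).
    - apply Rmult_le_compat; auto; left; auto. apply Rmult_lt_0_compat; auto.
    - replace (Rpower y th * f y * (Rpower (y + th) (1 - th) * g (y + th))) with
        ((Rpower y th * Rpower (y + th) (1 - th)) * (f y * g (y + th))) by ring.
      rewrite (Rmult_assoc (y + 1)). apply Rmult_le_compat_r; auto. left; apply Rmult_lt_0_compat;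
          auto. }
  apply le_epsilon. intros e He.
  assert (Hr : 0 < f x / g x) by (apply Rdiv_lt_0_compat; auto).
  (* A shift by n > (f x / g x) / e makes the error term smaller than e. *)
  destruct (nfloor_ex (f x / g x / e)) as [n [_ Hn]].
  { left. apply Rdiv_lt_0_compat; auto. }
  assert (Hxn : 0 < x + INR (S n)) by (generalize (pos_INR (S n)); lra).
  generalize (Hstep (x + INR (S n)) Hxn). rewrite Hper by auto.
  replace (x + INR (S n) + th) with ((x + th) + INR (S n)) by ring. rewrite Hper by lra.
  intros HH. apply Rle_trans with (1 := HH).
  rewrite Rmult_plus_distr_l, Rmult_1_r. apply Rplus_le_compat_l.
  apply (Rmult_le_reg_r (x + INR (S n))); auto. rewrite Rmult_assoc, Rinv_l by lra.
  rewrite S_INR. apply (Rmult_lt_compat_r e) in Hn; auto. unfold Rdiv at 1 in Hn.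
  rewrite Rmult_assoc, Rinv_l in Hn by lra. nra.
Qed.

(** Uniqueness half of the Bohr-Mollerup theorem, log-convexity being expressed by the
    inequality f (x + th) <= x^th f x. *)
Lemma bohr_mollerup (f g : R -> R) :
  (forall x, 0 < x -> 0 < f x) -> (forall x, 0 < x -> 0 < g x) ->
  (forall x, 0 < x -> f (x + 1) = x * f x) -> (forall x, 0 < x -> g (x + 1) = x * g x) ->
  (forall x th, 0 < x -> 0 <= th <= 1 -> f (x + th) <= Rpower x th * f x) ->
  (forall x th, 0 < x -> 0 <= th <= 1 -> g (x + th) <= Rpower x th * g x) ->
  f 1 = g 1 -> forall x, 0 < x -> f x = g x.
Proof.
  intros Hf Hg Ef Eg Lf Lg E1 x Hx.
  assert (Hr : forall x th, 0 < x -> 0 <= th <= 1 -> f (x + th) / g (x + th) = f x / g x).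
  { clear x Hx. intros x th Hx Hth. apply Rle_antisym; [apply bohr_mollerup_le; auto|].
    generalize (bohr_mollerup_le g f Hg Hf Eg Ef Lg Lf x th Hx Hth). intros HH.
    assert (P1 := Hf x Hx). assert (P2 := Hg x Hx).
    assert (P3 := Hf (x + th) ltac:(lra)). assert (P4 := Hg (x + th) ltac:(lra)).
    apply Rinv_le_contravar in HH; [|apply Rdiv_lt_0_compat; auto].
    replace (f x / g x) with (/ (g x / f x)) by (field; lra).
    replace (f (x + th) / g (x + th)) with (/ (g (x + th) / f (x + th))) by (field; lra). auto. }
  assert (H1 : f 1 / g 1 = 1) by (rewrite E1; generalize (Hg 1 ltac:(lra)); intros; field; lra).
  assert (HN : forall n, f (1 + INR n) / g (1 + INR n) = 1).
  { induction n as [|n IH]; [simpl; rewrite Rplus_0_r; auto|].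
    rewrite S_INR, <- Rplus_assoc, Hr; auto; generalize (pos_INR n); lra. }
  assert (f x / g x = 1).
  { destruct (Rle_lt_dec 1 x) as [H|H].
    - destruct (nfloor_ex (x - 1)) as [n Hn]; [lra|].
      replace x with ((1 + INR n) + (x - 1 - INR n)) by ring. rewrite Hr; auto;
          generalize (pos_INR n); lra.
    - rewrite <- H1. rewrite <- (Hr x (1 - x)) by lra. do 2 f_equal; ring. }
  assert (P2 := Hg x Hx). apply (Rmult_eq_compat_r (g x)) in H. field_simplify in H; lra.
Qed.

Definition gamma_integrand (s t : R) : R := Rpower t (s - 1) * exp (- t).

Lemma gamma_integrand_pos s t : 0 < gamma_integrand s t.
Proof. apply Rmult_lt_0_compat; [apply Rpower_pos|apply exp_pos]. Qed.

Lemma gamma_integrand_continuous s t : 0 < t -> continuous (gamma_integrand s) t.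
Proof.
  intros Ht. apply (ex_derive_continuous (V := R_NormedModule)).
  unfold gamma_integrand, Rpower. auto_derive; auto.
Qed.

(** The maximum of s ln (1+t) - t is attained at 1 + t = s; bound the logarithm by its
    tangent there. *)
Lemma exp_dominates s t : 0 < s -> 0 < t ->
  Rpower (1 + t) s * exp (- t) <= exp (1 - s + s * ln s).
Proof.
  intros Hs Ht. unfold Rpower. rewrite <- exp_plus.
  assert (H : s * ln (1 + t) + - t <= 1 - s + s * ln s).
  { assert (H1 : ln ((1 + t) / s) <= (1 + t) / s - 1) by (apply ln_le_sub1, Rdiv_lt_0_compat; lra).
    unfold Rdiv in H1 at 1. rewrite ln_mult, ln_Rinv in H1 by (try apply Rinv_0_lt_compat; lra).
    apply (Rmult_le_compat_l s) in H1; [|lra].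
    replace (s * ((1 + t) / s - 1)) with (1 + t - s) in H1 by (field; lra). lra. }
  destruct H as [H|H]; [left; apply exp_increasing; auto|rewrite H; lra].
Qed.

(** The integrand is dominated by a multiple of t^(s-1) (1+t)^(-s-1), whose antiderivative
    (t/(1+t))^s / s is bounded on the whole half-line. *)
Lemma gamma_converges s : 0 < s ->
  is_RInt_gen (gamma_integrand s) (at_right 0) (Rbar_locally p_infty) (Gamma s).
Proof.
  intros Hs.
  pose proof (ends_filter_l _ _ _ ends_pos) as Fl. pose proof (ends_filter_r _ _ _ ends_pos) as Fr.
  apply (RInt_gen_correct (V := R_CompleteNormedModule)).
  set (h := fun t => Rpower t (s - 1) * Rpower (1 + t) (- (s + 1))).
  assert (Hh : forall t, 0 < t -> continuous h t).
  { intros t Ht. apply (ex_derive_continuous (V := R_NormedModule)).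
    unfold h, Rpower. auto_derive. lra. }
  destruct (improper_bounded_antiderivative _ _ _ (fun t => Rpower (t / (1 + t)) s / s) h (/ s)
      ends_pos)
    as [G HG]; auto.
  - intros t Ht. unfold h.
    assert (Hq : 0 < t / (1 + t)) by (apply Rdiv_lt_0_compat; lra).
    (* Both factors are expressed through the antiderivative itself. *)
    assert (E : Rpower (t / (1 + t)) s = Rpower t s * Rpower (1 + t) (- s)).
    { rewrite Rpower_Ropp. unfold Rpower, Rdiv.
      rewrite ln_mult, ln_Rinv by (try apply Rinv_0_lt_compat; lra).
      rewrite <- exp_Ropp, <- exp_plus. f_equal; ring. }
    rewrite Rpower_pred by auto. replace (-(s + 1)) with (- s - 1) by ring.
    rewrite Rpower_pred by lra.
    replace (Rpower t s / t * (Rpower (1 + t) (- s) / (1 + t))) with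
      (Rpower (t / (1 + t)) s / (t * (1 + t))) by (rewrite E; field; lra).
    unfold Rpower. auto_derive; [split; [lra|split; auto]|]. unfold Rdiv. field. lra.
  - intros t _. unfold h. left. apply Rmult_lt_0_compat; apply Rpower_pos.
  - intros t Ht. rewrite Rabs_pos_eq.
    + unfold Rdiv. rewrite <- (Rmult_1_l (/ s)) at 2. apply Rmult_le_compat_r.
      * left; apply Rinv_0_lt_compat; auto.
      * apply Rpower_le_1; [|lra]. split; [apply Rdiv_lt_0_compat; lra|].
        apply (Rmult_le_reg_r (1 + t)); [lra|]. unfold Rdiv. rewrite Rmult_assoc, Rinv_l; lra.
    + left. apply Rdiv_lt_0_compat; auto. apply Rpower_pos.
  - set (C := exp (1 - (s + 1) + (s + 1) * ln (s + 1))).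
    destruct (improper_dominated _ _ _ (gamma_integrand s) (fun t => C * h t) (C * G) ends_pos) as
        [l Hl].
    + apply gamma_integrand_continuous.
    + intros t Ht. apply (continuous_scal_r (V := R_NormedModule) C h); auto.
    + intros t Ht. rewrite Rabs_pos_eq by (left; apply gamma_integrand_pos).
      unfold gamma_integrand, h, C.
      replace (exp (- t)) with (Rpower (1 + t) (s + 1) * exp (- t) * Rpower (1 + t) (- (s + 1))).
      * generalize (exp_dominates (s + 1) t ltac:(lra) Ht). intros HE.
        generalize (Rpower_pos t (s - 1)) (Rpower_pos (1 + t) (- (s + 1))). intros P1 P2.
        apply (Rmult_le_compat_r (Rpower t (s - 1) * Rpower (1 + t) (- (s + 1)))) in HE; [|nra].
        nra.
      * rewrite Rpower_Ropp. field. generalize (Rpower_pos (1 + t) (s + 1)); lra.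
    + apply (is_RInt_gen_scal (V := R_NormedModule)); auto.
    + exists l. exact Hl.
Qed.

Lemma Gamma_pos s : 0 < s -> 0 < Gamma s.
Proof.
  intros Hs. apply (improper_pos _ _ _ (gamma_integrand s) _ 1 2 ends_pos).
  - apply gamma_integrand_continuous.
  - intros; apply gamma_integrand_pos.
  - lra.
  - lra.
  - lra.
  - apply gamma_converges; auto.
Qed.

Lemma locally_0_intro {T} (F : (T -> Prop) -> Prop) {FF : Filter F} (f : T -> R) :
  (forall eps, 0 < eps -> F (fun x => Rabs (f x) < eps)) -> filterlim f F (locally 0).
Proof.
  intros H P [eps HP]. unfold filtermap. generalize (H eps (cond_pos eps)). apply filter_imp.
  intros x Hx. apply HP. change (Rabs (f x - 0) < eps). rewrite Rminus_0_r; auto.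
Qed.

Lemma continuous_within (f : R -> R) (A : R -> Prop) x l :
  continuous f x -> f x = l -> filterlim f (within A (locally x)) (locally l).
Proof. intros H <- P HP. destruct (H P HP) as [e He]. exists e. intros y Hy _. apply He; auto. Qed.

Lemma Gamma_succ s : 0 < s -> Gamma (s + 1) = s * Gamma s.
Proof.
  intros Hs.
  pose proof (ends_filter_l _ _ _ ends_pos) as Fl. pose proof (ends_filter_r _ _ _ ends_pos) as Fr.
  assert (Hd : is_RInt_gen (fun t => s * gamma_integrand s t - gamma_integrand (s + 1) t)
    (at_right 0) (Rbar_locally p_infty) (0 - 0)).
  { apply (improper_FTC _ _ _ (fun t => Rpower t s * exp (- t)) _ 0 0 ends_pos).
    - intros t Ht. unfold gamma_integrand. replace (s + 1 - 1) with s by ring.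
      rewrite Rpower_pred by auto.
      unfold Rpower. auto_derive; auto. field. lra.
    - intros t Ht. apply (continuous_minus (V := R_NormedModule)).
      + apply (continuous_scal_r (V := R_NormedModule)), gamma_integrand_continuous; auto.
      + apply gamma_integrand_continuous; auto.
    - apply locally_0_intro; [typeclasses eauto|]. intros eps He.
      destruct (Rpower_small s eps Hs He) as (d & Hd & Hd').
      exists (mkposreal _ Hd). intros y Hy Hy'.
      change (Rabs (y - 0) < d) in Hy. apply Rabs_def2 in Hy.
      rewrite Rabs_pos_eq.
      + apply Rle_lt_trans with (Rpower y s * 1).
        * apply Rmult_le_compat_l; [left; apply Rpower_pos|]. rewrite <- exp_0.
          left. apply exp_increasing. lra.
        * rewrite Rmult_1_r. apply Hd'. lra.
      + left. apply Rmult_lt_0_compat; [apply Rpower_pos|apply exp_pos].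
    - apply locally_0_intro; [typeclasses eauto|]. intros eps He.
      set (C := exp (1 - (s + 1) + (s + 1) * ln (s + 1))). assert (HC : 0 < C) by apply exp_pos.
      exists (C / eps). intros y Hy. assert (0 < C / eps) by (apply Rdiv_lt_0_compat; auto).
      assert (Hy0 : 0 < y) by lra.
      rewrite Rabs_pos_eq by (left; apply Rmult_lt_0_compat; [apply Rpower_pos|apply exp_pos]).
      generalize (exp_dominates (s + 1) y ltac:(lra) Hy0). fold C. rewrite Rpower_succ by lra.
      intros HE.
      assert (HR : Rpower y s <= Rpower (1 + y) s) by (apply Rle_Rpower_l; lra).
      assert (HX := exp_pos (- y)).
      assert (HY : Rpower y s * exp (- y) * (1 + y) <= C).
      { apply Rle_trans with (2 := HE). replace (Rpower (1 + y) s * (1 + y) * exp (- y)) with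
          (Rpower (1 + y) s * exp (- y) * (1 + y)) by ring.
        apply Rmult_le_compat_r; [lra|]. apply Rmult_le_compat_r; lra. }
      assert (HZ : C < eps * y).
      { apply (Rmult_lt_compat_r eps) in Hy; auto. unfold Rdiv in Hy.
        rewrite Rmult_assoc, Rinv_l in Hy; lra. }
      assert (0 < Rpower y s * exp (- y)) by (apply Rmult_lt_0_compat; [apply Rpower_pos|auto]).
      nra. }
  assert (H1 : is_RInt_gen (fun t => s * gamma_integrand s t - gamma_integrand (s + 1) t)
    (at_right 0) (Rbar_locally p_infty) (s * Gamma s - Gamma (s + 1))).
  { apply (is_RInt_gen_minus (V := R_NormedModule)).
    - apply (is_RInt_gen_scal (V := R_NormedModule)), gamma_converges; auto.
    - apply gamma_converges; lra. }
  generalize (improper_unique _ _ _ _ _ _ ends_pos Hd H1). lra.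
Qed.

Lemma Gamma_1 : Gamma 1 = 1.
Proof.
  apply (improper_unique _ _ _ (gamma_integrand 1) _ _ ends_pos); [apply gamma_converges; lra|].
  replace 1 with (0 - -1) at 2 by ring.
  apply (improper_FTC _ _ _ (fun t => - exp (- t)) _ (-1) 0 ends_pos).
  - intros t Ht. unfold gamma_integrand. rewrite Rminus_diag, Rpower_O by auto. auto_derive; auto.
    ring.
  - apply gamma_integrand_continuous.
  - apply continuous_within; [|rewrite Ropp_0, exp_0; ring].
    apply (ex_derive_continuous (V := R_NormedModule) (fun t => - exp (- t))). auto_derive; auto.
  - apply locally_0_intro; [typeclasses eauto|]. intros eps He. exists (Rmax 0 (- ln eps)).
    intros y Hy. rewrite Rabs_Ropp, Rabs_pos_eq by (left; apply exp_pos).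
    rewrite <- (exp_ln eps) by auto. apply exp_increasing.
    generalize (Rmax_r 0 (- ln eps)); lra.
Qed.

Lemma Gamma_lyapunov x th : 0 < x -> 0 <= th <= 1 -> Gamma (x + th) <= Rpower x th * Gamma x.
Proof.
  intros Hx Hth. replace x with (Gamma (x + 1) / Gamma x) at 2.
  - apply (lyapunov _ _ _ (gamma_integrand x) (fun t => t) _ _ _ _ ends_pos); auto.
    + intros; left; apply gamma_integrand_pos.
    + apply Gamma_pos; auto.
    + apply Gamma_pos; lra.
    + apply gamma_converges; auto.
    + generalize (gamma_converges (x + 1) ltac:(lra)). apply (improper_ext _ _ _ _ _ _ ends_pos).
      intros t Ht. unfold gamma_integrand. replace (x + 1 - 1) with (x - 1 + 1) by ring.
      rewrite Rpower_succ by auto. ring.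
    + generalize (gamma_converges (x + th) ltac:(lra)). apply (improper_ext _ _ _ _ _ _ ends_pos).
      intros t Ht. unfold gamma_integrand. replace (x + th - 1) with (th + (x - 1)) by ring.
      rewrite Rpower_plus. ring.
  - rewrite Gamma_succ by auto. field. generalize (Gamma_pos x Hx); lra.
Qed.

(** The bases (1-x)/2 and (1+x)/2 add up to 1, which keeps powers of 2 out of the
    recursions. *)
Definition jacobi_weight (a b x : R) : R := Rpower ((1 - x) / 2) a * Rpower ((1 + x) / 2) b.

Definition beta_integral (a b : R) : R := RInt_gen (jacobi_weight a b) (at_right (-1)) (at_left 1).

Lemma jacobi_weight_pos a b x : 0 < jacobi_weight a b x.
Proof. apply Rmult_lt_0_compat; apply Rpower_pos. Qed.

Lemma jacobi_weight_continuous a b x : -1 < x < 1 -> continuous (jacobi_weight a b) x.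
Proof.
  intros Hx. apply (ex_derive_continuous (V := R_NormedModule)).
  unfold jacobi_weight, Rpower. auto_derive. lra.
Qed.

Lemma jacobi_weight_succ_l a b x : -1 < x < 1 -> jacobi_weight (a + 1) b x = (1 - x) / 2 *
  jacobi_weight a b x.
Proof. intros Hx. unfold jacobi_weight. rewrite Rpower_succ by lra. ring. Qed.

Lemma jacobi_weight_succ_r a b x : -1 < x < 1 -> jacobi_weight a (b + 1) x = (1 + x) / 2 *
  jacobi_weight a b x.
Proof. intros Hx. unfold jacobi_weight. rewrite Rpower_succ by lra. ring. Qed.

(** At least one of (1-x)/2 and (1+x)/2 is at least 1/2, and there its power is harmless
    even for a negative exponent. *)
Lemma Rpower_le_2 v b : / 2 <= v <= 1 -> -1 < b -> Rpower v b <= 2.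
Proof.
  intros Hv Hb. apply Rmult_le_reg_r with v; [lra|]. rewrite <- Rpower_succ by lra.
  apply Rle_trans with 1; [apply Rpower_le_1|]; lra.
Qed.

Lemma beta_integral_converges a b : -1 < a -> -1 < b ->
  is_RInt_gen (jacobi_weight a b) (at_right (-1)) (at_left 1) (beta_integral a b).
Proof.
  intros Ha Hb.
  pose proof (ends_filter_l _ _ _ ends_unit) as Fl.
  pose proof (ends_filter_r _ _ _ ends_unit) as Fr.
  apply (RInt_gen_correct (V := R_CompleteNormedModule)).
  set (g := fun x => 2 * (Rpower ((1 - x) / 2) a + Rpower ((1 + x) / 2) b)).
  assert (Hg : forall x, -1 < x < 1 -> continuous g x).
  { intros x Hx. apply (ex_derive_continuous (V := R_NormedModule)).
    unfold g, Rpower. auto_derive. lra. }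
  destruct (improper_bounded_antiderivative _ _ _
    (fun x => 4 * (- Rpower ((1 - x) / 2) (a + 1) / (a + 1) +
        Rpower ((1 + x) / 2) (b + 1) / (b + 1)))
    g (4 * (/ (a + 1) + / (b + 1))) ends_unit) as [G HG]; auto.
  - intros x Hx. unfold g.
    replace (2 * (Rpower ((1 - x) / 2) a + Rpower ((1 + x) / 2) b)) with
      (4 * (Rpower ((1 - x) / 2) (a + 1) / (1 - x) + Rpower ((1 + x) / 2) (b + 1) / (1 + x)))
      by (rewrite !Rpower_succ by lra; field; lra).
    unfold Rpower. auto_derive; [lra|]. unfold Rdiv, Rminus. field. lra.
  - intros x Hx. unfold g. generalize (Rpower_pos ((1 - x) / 2) a) (Rpower_pos ((1 + x) / 2) b).
    lra.
  - intros x Hx.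
    assert (H1 := Rpower_le_1 ((1 - x) / 2) (a + 1) ltac:(lra) ltac:(lra)).
    assert (H2 := Rpower_le_1 ((1 + x) / 2) (b + 1) ltac:(lra) ltac:(lra)).
    assert (P1 := Rpower_pos ((1 - x) / 2) (a + 1)).
    assert (P2 := Rpower_pos ((1 + x) / 2) (b + 1)).
    assert (I1 : 0 < / (a + 1)) by (apply Rinv_0_lt_compat; lra).
    assert (I2 : 0 < / (b + 1)) by (apply Rinv_0_lt_compat; lra).
    unfold Rdiv. apply Rabs_le. nra.
  - destruct (improper_dominated _ _ _ (jacobi_weight a b) g G ends_unit) as [l Hl]; auto.
    + intros; apply jacobi_weight_continuous; auto.
    + intros x Hx. rewrite Rabs_pos_eq by (left; apply jacobi_weight_pos).
      unfold jacobi_weight, g.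
      assert (P1 := Rpower_pos ((1 - x) / 2) a). assert (P2 := Rpower_pos ((1 + x) / 2) b).
      destruct (Rle_lt_dec 0 x) as [H|H].
      * generalize (Rpower_le_2 ((1 + x) / 2) b ltac:(lra) Hb). nra.
      * generalize (Rpower_le_2 ((1 - x) / 2) a ltac:(lra) Ha). nra.
    + exists l; auto.
Qed.

Lemma beta_integral_pos a b : -1 < a -> -1 < b -> 0 < beta_integral a b.
Proof.
  intros Ha Hb. apply (improper_pos _ _ _ (jacobi_weight a b) _ 0 (1/2) ends_unit); try lra.
  - intros; apply jacobi_weight_continuous; auto.
  - intros; apply jacobi_weight_pos.
  - apply beta_integral_converges; auto.
Qed.

(** The two bases (1-x)/2 and (1+x)/2 add up to 1. *)
Lemma beta_integral_split a b : -1 < a -> -1 < b -> beta_integral (a + 1) b +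
  beta_integral a (b + 1) = beta_integral a b.
Proof.
  intros Ha Hb.
  pose proof (ends_filter_l _ _ _ ends_unit) as Fl.
  pose proof (ends_filter_r _ _ _ ends_unit) as Fr.
  apply (improper_unique _ _ _ (jacobi_weight a b) _ _ ends_unit);
      [|apply beta_integral_converges; auto].
  apply (improper_ext _ _ _ (fun x =>
      plus (jacobi_weight (a + 1) b x) (jacobi_weight a (b + 1) x)) _ _ ends_unit).
  - intros x Hx. unfold plus; simpl. rewrite jacobi_weight_succ_l, jacobi_weight_succ_r by auto.
    field.
  - apply (is_RInt_gen_plus (V := R_NormedModule)); apply beta_integral_converges; lra.
Qed.

(** Integrate the derivative of jacobi_weight (a+1) (b+1), which vanishes at both ends. *)
Lemma beta_integral_parts a b : -1 < a -> -1 < b -> (a + 1) * beta_integral a (b + 1) = (b + 1) *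
  beta_integral (a + 1) b.
Proof.
  intros Ha Hb.
  pose proof (ends_filter_l _ _ _ ends_unit) as Fl.
  pose proof (ends_filter_r _ _ _ ends_unit) as Fr.
  assert (Hd : is_RInt_gen (fun x => (b + 1) * jacobi_weight (a + 1) b x - (a + 1) *
      jacobi_weight a (b + 1) x)
    (at_right (-1)) (at_left 1) (0 - 0)).
  { apply (improper_FTC _ _ _ (fun x => 2 * jacobi_weight (a + 1) (b + 1) x) _ 0 0 ends_unit).
    - intros x Hx.
      replace ((b + 1) * jacobi_weight (a + 1) b x - (a + 1) * jacobi_weight a (b + 1) x) with
        (2 * (((b + 1) / (1 + x) - (a + 1) / (1 - x)) * jacobi_weight (a + 1) (b + 1) x)).
      + unfold jacobi_weight, Rpower. auto_derive; [lra|]. unfold Rdiv, Rminus. field. lra.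
      + rewrite (jacobi_weight_succ_l a (b + 1)), (jacobi_weight_succ_r a b),
          (jacobi_weight_succ_l a b) by auto. field. lra.
    - intros x Hx. apply (continuous_minus (V := R_NormedModule));
        apply (continuous_scal_r (V := R_NormedModule)), jacobi_weight_continuous; auto.
    - apply locally_0_intro; [typeclasses eauto|]. intros eps He.
      destruct (Rpower_small (b + 1) (eps / 2) ltac:(lra) ltac:(lra)) as (d & Hd & Hd').
      assert (Hm : 0 < Rmin d 1) by (apply Rmin_pos; lra).
      exists (mkposreal _ Hm). intros y Hy Hy'.
      change (Rabs (y - -1) < Rmin d 1) in Hy. apply Rabs_def2 in Hy.
      generalize (Rmin_l d 1) (Rmin_r d 1). intros M1 M2.
      rewrite Rabs_pos_eq by (generalize (jacobi_weight_pos (a + 1) (b + 1) y); lra).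
      unfold jacobi_weight. generalize (Hd' ((1 + y) / 2) ltac:(lra)).
      generalize (Rpower_le_1 ((1 - y) / 2) (a + 1) ltac:(lra) ltac:(lra)).
      generalize (Rpower_pos ((1 - y) / 2) (a + 1)) (Rpower_pos ((1 + y) / 2) (b + 1)). nra.
    - apply locally_0_intro; [typeclasses eauto|]. intros eps He.
      destruct (Rpower_small (a + 1) (eps / 2) ltac:(lra) ltac:(lra)) as (d & Hd & Hd').
      assert (Hm : 0 < Rmin d 1) by (apply Rmin_pos; lra).
      exists (mkposreal _ Hm). intros y Hy Hy'.
      change (Rabs (y - 1) < Rmin d 1) in Hy. apply Rabs_def2 in Hy.
      generalize (Rmin_l d 1) (Rmin_r d 1). intros M1 M2.
      rewrite Rabs_pos_eq by (generalize (jacobi_weight_pos (a + 1) (b + 1) y); lra).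
      unfold jacobi_weight. generalize (Hd' ((1 - y) / 2) ltac:(lra)).
      generalize (Rpower_le_1 ((1 + y) / 2) (b + 1) ltac:(lra) ltac:(lra)).
      generalize (Rpower_pos ((1 - y) / 2) (a + 1)) (Rpower_pos ((1 + y) / 2) (b + 1)). nra. }
  assert (H1 : is_RInt_gen (fun x => (b + 1) * jacobi_weight (a + 1) b x - (a + 1) *
      jacobi_weight a (b + 1) x)
    (at_right (-1)) (at_left 1) ((b + 1) * beta_integral (a + 1) b - (a + 1) *
        beta_integral a (b + 1))).
  { apply (is_RInt_gen_minus (V := R_NormedModule)); apply (is_RInt_gen_scal (V := R_NormedModule));
      apply beta_integral_converges; lra. }
  generalize (improper_unique _ _ _ _ _ _ ends_unit Hd H1). lra.
Qed.

Lemma beta_integral_succ_l a b : -1 < a -> -1 < b -> beta_integral (a + 1) b =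
  (a + 1) / (a + b + 2) * beta_integral a b.
Proof.
  intros Ha Hb. generalize (beta_integral_split a b Ha Hb) (beta_integral_parts a b Ha Hb).
  intros H1 H2.
  apply (Rmult_eq_reg_r (a + b + 2)); [|lra]. rewrite <- H1. field_simplify; [|lra]. lra.
Qed.

Lemma beta_integral_succ_r a b : -1 < a -> -1 < b -> beta_integral a (b + 1) =
  (b + 1) / (a + b + 2) * beta_integral a b.
Proof.
  intros Ha Hb. generalize (beta_integral_split a b Ha Hb). rewrite beta_integral_succ_l by auto.
  intros H.
  apply (Rmult_eq_reg_r (a + b + 2)); [|lra]. apply (Rmult_eq_compat_r (a + b + 2)) in H.
  field_simplify in H; [|lra]. field_simplify; [|lra]. lra.
Qed.

Lemma beta_integral_0_l b : -1 < b -> beta_integral 0 b = 2 / (b + 1).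
Proof.
  intros Hb.
  apply (improper_unique _ _ _ (jacobi_weight 0 b) _ _ ends_unit);
      [apply beta_integral_converges; lra|].
  replace (2 / (b + 1)) with (2 / (b + 1) - 0) by ring.
  apply (improper_FTC _ _ _ (fun x => 2 / (b + 1) * Rpower ((1 + x) / 2) (b + 1)) _ 0
      (2 / (b + 1)) ends_unit).
  - intros x Hx. unfold jacobi_weight. rewrite Rpower_O by lra.
    replace (1 * Rpower ((1 + x) / 2) b) with (2 / (1 + x) * Rpower ((1 + x) / 2) (b + 1))
      by (rewrite Rpower_succ by lra; field; lra).
    unfold Rpower. auto_derive; [lra|]. unfold Rdiv. field. lra.
  - intros; apply jacobi_weight_continuous; auto.
  - apply locally_0_intro; [typeclasses eauto|]. intros eps He.
    destruct (Rpower_small (b + 1) (eps * (b + 1) / 2) ltac:(lra)) as (d & Hd & Hd').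
    { apply Rdiv_lt_0_compat; [|lra]. apply Rmult_lt_0_compat; lra. }
    exists (mkposreal _ Hd). intros y Hy Hy'.
    change (Rabs (y - -1) < d) in Hy. apply Rabs_def2 in Hy.
    assert (P := Rpower_pos ((1 + y) / 2) (b + 1)).
    assert (Q : 0 < 2 / (b + 1)) by (apply Rdiv_lt_0_compat; lra).
    rewrite Rabs_pos_eq by (left; apply Rmult_lt_0_compat; auto).
    generalize (Hd' ((1 + y) / 2) ltac:(lra)). intros H.
    apply (Rmult_lt_compat_l (2 / (b + 1))) in H; auto.
    replace (2 / (b + 1) * (eps * (b + 1) / 2)) with eps in H by (field; lra). auto.
  - apply continuous_within.
    + apply (ex_derive_continuous (V := R_NormedModule)). unfold Rpower. auto_derive. lra.
    + replace ((1 + 1) / 2) with 1 by field. unfold Rpower. rewrite ln_1, Rmult_0_r, exp_0. ring.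
Qed.

Lemma beta_integral_lyapunov a b th : -1 < a -> -1 < b -> 0 <= th <= 1 ->
  beta_integral (a + th) b <= Rpower ((a + 1) / (a + b + 2)) th * beta_integral a b.
Proof.
  intros Ha Hb Hth.
  replace ((a + 1) / (a + b + 2)) with (beta_integral (a + 1) b / beta_integral a b).
  - apply (lyapunov _ _ _ (jacobi_weight a b) (fun x => (1 - x) / 2) _ _ _ _ ends_unit); auto.
    + intros; left; apply jacobi_weight_pos.
    + intros; lra.
    + apply beta_integral_pos; auto.
    + apply beta_integral_pos; lra.
    + apply beta_integral_converges; auto.
    + generalize (beta_integral_converges (a + 1) b ltac:(lra) Hb).
      apply (improper_ext _ _ _ _ _ _ ends_unit). intros; apply jacobi_weight_succ_l; auto.
    + generalize (beta_integral_converges (a + th) b ltac:(lra) Hb).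
      apply (improper_ext _ _ _ _ _ _ ends_unit). intros x Hx. unfold jacobi_weight.
      rewrite Rpower_plus. ring.
  - rewrite beta_integral_succ_l by auto. field. generalize (beta_integral_pos a b Ha Hb). lra.
Qed.

(** As a function of x = a + 1, the product of the Beta integral with Gamma (x+b+1) / (2
    Gamma (b+1)) satisfies the functional equation, the log-convexity and the normalization
    of Gamma. *)
Lemma beta_integral_Gamma a b : -1 < a -> -1 < b ->
  beta_integral a b = 2 * Gamma (a + 1) * Gamma (b + 1) / Gamma (a + b + 2).
Proof.
  intros Ha Hb. assert (Gb := Gamma_pos (b + 1) ltac:(lra)).
  assert (Hf : forall x, 0 < x -> beta_integral (x - 1) b *
      Gamma (x + b + 1) / (2 * Gamma (b + 1)) = Gamma x).
  { apply bohr_mollerup.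
    - intros x Hx. apply Rdiv_lt_0_compat; [|lra]. apply Rmult_lt_0_compat;
        [apply beta_integral_pos|apply Gamma_pos]; lra.
    - apply Gamma_pos.
    - intros x Hx. replace (x + 1 - 1) with (x - 1 + 1) by ring.
      rewrite beta_integral_succ_l by lra.
      replace (x + 1 + b + 1) with (x + b + 1 + 1) by ring. rewrite (Gamma_succ (x + b + 1)) by lra.
      field. split; lra.
    - apply Gamma_succ.
    - intros x th Hx Hth.
      assert (H1 := beta_integral_lyapunov (x - 1) b th ltac:(lra) Hb Hth).
      assert (H2 := Gamma_lyapunov (x + b + 1) th ltac:(lra) Hth).
      assert (J0 := beta_integral_pos (x - 1 + th) b ltac:(lra) Hb).
      assert (G0 := Gamma_pos (x + b + 1 + th) ltac:(lra)).
      assert (HH : beta_integral (x - 1 + th) b * Gamma (x + b + 1 + th) <=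
        Rpower ((x - 1 + 1) / (x - 1 + b + 2)) th * beta_integral (x - 1) b *
            (Rpower (x + b + 1) th * Gamma (x + b + 1)))
        by (apply Rmult_le_compat; lra).
      assert (HP : Rpower ((x - 1 + 1) / (x - 1 + b + 2)) th * Rpower (x + b + 1) th = Rpower x th).
      { rewrite Rpower_mult_distr; [|apply Rdiv_lt_0_compat; lra|lra]. f_equal. field. lra. }
      replace (x + th - 1) with (x - 1 + th) by ring.
      replace (x + th + b + 1) with (x + b + 1 + th) by ring.
      unfold Rdiv. rewrite <- !Rmult_assoc. apply Rmult_le_compat_r;
          [left; apply Rinv_0_lt_compat; lra|].
      apply Rle_trans with (1 := HH). rewrite <- HP. right. ring.
    - intros x th Hx Hth. apply Gamma_lyapunov; auto.
    - rewrite Gamma_1. replace (1 - 1) with 0 by ring. rewrite beta_integral_0_l by auto.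
      replace (1 + b + 1) with (b + 1 + 1) by ring. rewrite (Gamma_succ (b + 1)) by lra. field.
      lra. }
  assert (G1 := Gamma_pos (a + b + 2) ltac:(lra)).
  rewrite <- (Hf (a + 1)) by lra. replace (a + 1 - 1) with a by ring.
  replace (a + 1 + b + 1) with (a + b + 2) by ring. field. lra.
Qed.

(** * Complex-valued functions of a real variable *)

Open Scope C_scope.

Definition is_Cderive (f : R -> C) (t : R) (l : C) : Prop :=
  is_derive (fun s => Re (f s)) t (Re l) /\ is_derive (fun s => Im (f s)) t (Im l).

Lemma C_ext (z w : C) : Re z = Re w -> Im z = Im w -> z = w.
Proof. destruct z, w; simpl; intros; subst; auto. Qed.

Lemma is_derive_eq (f : R -> R) (t l l' : R) : is_derive f t l -> l = l' -> is_derive f t l'.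
Proof. intros; subst; auto. Qed.

Lemma is_Cderive_eq f t l l' : is_Cderive f t l -> l = l' -> is_Cderive f t l'.
Proof. intros; subst; auto. Qed.

Lemma is_Cderive_ext f g t l : (forall s, f s = g s) -> is_Cderive f t l -> is_Cderive g t l.
Proof.
  intros H [H1 H2]; split; [revert H1|revert H2]; apply is_derive_ext; intros; rewrite H; auto.
Qed.

Lemma is_Cderive_ext_loc f g t l : locally t (fun s => f s = g s) -> is_Cderive f t l ->
  is_Cderive g t l.
Proof.
  intros H [H1 H2]; split; [revert H1|revert H2]; apply is_derive_ext_loc;
    revert H; apply filter_imp; intros s ->; auto.
Qed.

Lemma is_Cderive_const (c : C) t : is_Cderive (fun _ => c) t 0.
Proof. split; apply (is_derive_const (V := R_NormedModule)). Qed.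

Lemma is_Cderive_RtoC (f : R -> R) (t l : R) : is_derive f t l ->
  is_Cderive (fun s => RtoC (f s)) t (RtoC l).
Proof. intros H. split; simpl; auto. apply (is_derive_const (V := R_NormedModule)). Qed.

Lemma is_Cderive_plus f g t u v : is_Cderive f t u -> is_Cderive g t v ->
  is_Cderive (fun s => f s + g s) t (u + v).
Proof. intros [A B] [A' B']; split; simpl; apply (is_derive_plus (V := R_NormedModule)); auto. Qed.

Lemma is_Cderive_opp f t u : is_Cderive f t u -> is_Cderive (fun s => - f s) t (- u).
Proof. intros [A B]; split; simpl; apply (is_derive_opp (V := R_NormedModule)); auto. Qed.

Lemma is_Cderive_minus f g t u v : is_Cderive f t u -> is_Cderive g t v ->
  is_Cderive (fun s => f s - g s) t (u - v).
Proof. intros A B. apply is_Cderive_plus; auto. apply is_Cderive_opp; auto. Qed.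

Lemma is_derive_Rmult (f g : R -> R) (t u v : R) : is_derive f t u -> is_derive g t v ->
  is_derive (fun s => f s * g s)%R t (u * g t + f t * v)%R.
Proof. intros A B. apply (is_derive_mult f g t u v A B). intros; apply Rmult_comm. Qed.

Lemma is_Cderive_mult f g t u v : is_Cderive f t u -> is_Cderive g t v ->
  is_Cderive (fun s => f s * g s) t (u * g t + f t * v).
Proof.
  intros [A B] [A' B']; split; simpl.
  - eapply is_derive_eq.
    + apply (is_derive_minus (V := R_NormedModule)); apply is_derive_Rmult;
        [exact A|exact A'|exact B|exact B'].
    + unfold minus, plus, opp; simpl. unfold Re, Im; simpl. ring.
  - eapply is_derive_eq.
    + apply (is_derive_plus (V := R_NormedModule)); apply is_derive_Rmult;
        [exact A|exact B'|exact B|exact A'].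
    + unfold minus, plus, opp; simpl. unfold Re, Im; simpl. ring.
Qed.

Lemma is_Cderive_continuous f t l : is_Cderive f t l ->
  continuous (fun s => Re (f s)) t /\ continuous (fun s => Im (f s)) t.
Proof.
  intros [A B]. split; apply (ex_derive_continuous (V := R_NormedModule)); eexists; eauto.
Qed.

Lemma sq_sum_pos (z : C) : z <> 0 -> (0 < Re z * Re z + Im z * Im z)%R.
Proof.
  intros H. destruct z as [a b]; simpl in *.
  destruct (Req_dec a 0) as [->|]; [|nra]. destruct (Req_dec b 0) as [->|]; [|nra].
  exfalso; apply H; reflexivity.
Qed.

Lemma is_Cderive_inv f t u : is_Cderive f t u -> f t <> 0 ->
  is_Cderive (fun s => / f s) t (- u / (f t * f t)).
Proof.
  intros [A B] H. assert (P := sq_sum_pos _ H).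
  assert (HN : is_derive (fun s => Re (f s) * Re (f s) + Im (f s) * Im (f s))%R t
    (Re u * Re (f t) + Re (f t) * Re u + (Im u * Im (f t) + Im (f t) * Im u))%R).
  { apply (is_derive_plus (V := R_NormedModule)); apply is_derive_Rmult; auto. }
  assert (HI := is_derive_inv _ _ _ HN ltac:(lra)).
  apply (is_Cderive_ext (fun s => (Re (f s) * / (Re (f s) * Re (f s) + Im (f s) * Im (f s)),
     (- Im (f s)) * / (Re (f s) * Re (f s) + Im (f s) * Im (f s)))%R)).
  { intros s. unfold Cinv, Re, Im, Rdiv. simpl. rewrite !Rmult_1_r. reflexivity. }
  split; simpl.
  - eapply is_derive_eq; [apply is_derive_Rmult; [exact A|exact HI]|].
    unfold Re, Im in *; simpl in *. field. split; nra.
  - eapply is_derive_eq; [apply is_derive_Rmult;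
      [apply (is_derive_opp (V := R_NormedModule)); exact B|exact HI]|].
    unfold opp; simpl. unfold Re, Im in *; simpl in *. field. split; nra.
Qed.

Lemma Cexp_plus z w : Cexp (z + w) = Cexp z * Cexp w.
Proof.
  unfold Cexp. apply C_ext; simpl; unfold Re, Im; simpl; rewrite exp_plus, ?cos_plus, ?sin_plus;
      ring.
Qed.

Lemma Cexp_0 : Cexp 0 = 1.
Proof. unfold Cexp. apply C_ext; simpl; rewrite exp_0, ?cos_0, ?sin_0; ring. Qed.

Lemma Cexp_opp z : Cexp z * Cexp (- z) = 1.
Proof. rewrite <- Cexp_plus, <- Cexp_0. f_equal. ring. Qed.

Lemma Cexp_neq_0 z : Cexp z <> 0.
Proof.
  intros H. generalize (Cexp_opp z). rewrite H, Cmult_0_l. intros E. apply C1_nz; auto.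
Qed.

Lemma Cexp_RtoC (r : R) : Cexp r = RtoC (exp r).
Proof. unfold Cexp. apply C_ext; simpl; rewrite ?cos_0, ?sin_0; ring. Qed.

Lemma is_Cderive_Cexp g t u : is_Cderive g t u ->
  is_Cderive (fun s => Cexp (g s)) t (u * Cexp (g t)).
Proof.
  intros [A B]. unfold Cexp.
  assert (E := is_derive_comp exp _ _ _ _ (is_derive_exp _) A).
  assert (Cs := is_derive_comp cos _ _ _ _ (is_derive_cos _) B).
  assert (Sn := is_derive_comp sin _ _ _ _ (is_derive_sin _) B).
  split; simpl; (eapply is_derive_eq;
      [apply is_derive_Rmult; [exact E|first [exact Cs|exact Sn]]|]);
  unfold scal; simpl; unfold mult; simpl; unfold Re, Im; simpl; ring.
Qed.

Lemma Cmod_sqrt (z : C) : Cmod z = sqrt (Re z * Re z + Im z * Im z).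
Proof. unfold Cmod, Re, Im. f_equal. ring. Qed.

Lemma Cmod_Re_le z : (Re z <= Cmod z)%R.
Proof. apply Rle_trans with (1 := Rle_abs _). apply re_le_Cmod. Qed.

Lemma Re_pos_neq_0 (z : C) : (0 < Re z)%R -> z <> 0.
Proof. intros H E. rewrite E in H. simpl in H. lra. Qed.

(** On the right half-plane the argument is atan (Im z / Re z), which, unlike the definition
    through acos, is visibly differentiable across the real axis. *)
Lemma Clog_right z : (0 < Re z)%R -> Clog z = (ln (Cmod z), atan (Im z / Re z)).
Proof.
  intros H. unfold Clog. f_equal. unfold Carg.
  assert (Hm : (0 < Cmod z)%R) by (apply Cmod_gt_0, Re_pos_neq_0; auto).
  assert (Hc : (Re z / Cmod z = cos (atan (Im z / Re z)))%R).
  { rewrite cos_atan. rewrite Cmod_sqrt.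
    replace (Re z * Re z + Im z * Im z)%R with (Re z * Re z * (1 + (Im z / Re z)²))%R
      by (unfold Rsqr; field; lra).
    rewrite sqrt_mult by (try apply Rle_0_sqr; unfold Rsqr; nra).
    rewrite sqrt_square by lra. field. split; [|lra].
    apply Rgt_not_eq, sqrt_lt_R0. generalize (Rle_0_sqr (Im z / Re z)); lra. }
  rewrite Hc. destruct (atan_bound (Im z / Re z)) as [B1 B2].
  assert (PI > 0)%R by apply PI_RGT_0.
  destruct (Rlt_dec (Im z) 0) as [Hi|Hi].
  - assert (atan (Im z / Re z) < 0)%R.
    { rewrite <- atan_0. apply atan_increasing. apply Rmult_neg_pos; auto.
      apply Rinv_0_lt_compat; auto. }
    rewrite <- cos_neg, acos_cos by lra. ring.
  - assert (0 <= atan (Im z / Re z))%R.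
    { rewrite <- atan_0. assert (0 <= Im z / Re z)%R.
      { apply Rmult_le_pos; [lra|]. left; apply Rinv_0_lt_compat; auto. }
      destruct H1 as [H1|H1]; [left; apply atan_increasing; auto|rewrite <- H1; lra]. }
    rewrite acos_cos by lra. auto.
Qed.

Lemma continuous_pos_locally (f : R -> R) t : continuous f t -> (0 < f t)%R ->
  locally t (fun s => (0 < f s)%R).
Proof.
  intros Hf Hp. apply (Hf (fun y => (0 < y)%R)). exists (mkposreal _ Hp). intros y Hy.
  change (Rabs (y - f t) < f t)%R in Hy. apply Rabs_def2 in Hy. lra.
Qed.

Lemma is_Cderive_Clog f t u : is_Cderive f t u -> (0 < Re (f t))%R ->
  is_Cderive (fun s => Clog (f s)) t (u / f t).
Proof.
  intros H Hp. destruct (is_Cderive_continuous _ _ _ H) as [Hc _]. destruct H as [A B].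
  apply (is_Cderive_ext_loc (fun s =>
      (ln (sqrt (Re (f s) * Re (f s) + Im (f s) * Im (f s))), atan (Im (f s) / Re (f s))))).
  { generalize (continuous_pos_locally _ _ Hc Hp). apply filter_imp. intros s Hs.
    rewrite Clog_right, Cmod_sqrt by auto. reflexivity. }
  assert (P := sq_sum_pos _ (Re_pos_neq_0 _ Hp)).
  split; simpl.
  - set (N := (Re (f t) * Re (f t) + Im (f t) * Im (f t))%R) in *.
    assert (HN : is_derive (fun s => Re (f s) * Re (f s) + Im (f s) * Im (f s))%R t
      (Re u * Re (f t) + Re (f t) * Re u + (Im u * Im (f t) + Im (f t) * Im u))%R).
    { apply (is_derive_plus (V := R_NormedModule)); apply is_derive_Rmult; auto. }
    assert (HL : is_derive (fun y => ln (sqrt y)) N (/ (2 * N))%R).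
    { auto_derive; [repeat split; auto; apply sqrt_lt_R0; auto|].
      rewrite <- (sqrt_sqrt N) at 3 by lra. assert (0 < sqrt N)%R by (apply sqrt_lt_R0; auto).
      field. lra. }
    eapply is_derive_eq; [exact (is_derive_comp _ _ _ _ _ HL HN)|].
    unfold scal; simpl; unfold mult; simpl. unfold N in *; unfold Re, Im in *; simpl in *. field.
    repeat split; nra.
  - assert (HA : is_derive atan (Im (f t) / Re (f t))%R (/ (1 + (Im (f t) / Re (f t))²))%R) by
      apply is_derive_atan.
    assert (HD := is_derive_div _ _ _ _ _ B A (Rgt_not_eq _ _ Hp)).
    eapply is_derive_eq; [exact (is_derive_comp atan (fun s => Im (f s) / Re (f s))%R t _ _ HA
        HD)|].
    unfold scal; simpl; unfold mult; simpl. unfold Rsqr. unfold Re, Im in *; simpl in *. field.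
    repeat split; try nra.
Qed.

Lemma Csqrt_sqr z : Csqrt z * Csqrt z = z.
Proof.
  assert (H1 : (0 <= (Cmod z + Re z) / 2)%R).
  { generalize (re_le_Cmod z). intros H. apply Rabs_le_between in H. lra. }
  assert (H2 : (0 <= (Cmod z - Re z) / 2)%R) by (generalize (Cmod_Re_le z); lra).
  assert (H3 : (sqrt ((Cmod z + Re z) / 2) * sqrt ((Cmod z - Re z) / 2) = Rabs (Im z) / 2)%R).
  { rewrite <- sqrt_mult by auto.
    replace ((Cmod z + Re z) / 2 * ((Cmod z - Re z) / 2))%R with ((Im z / 2) * (Im z / 2))%R.
    - fold (Rsqr (Im z / 2)). rewrite sqrt_Rsqr_abs. unfold Rdiv. rewrite Rabs_mult,
        (Rabs_pos_eq (/ 2)); lra.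
    - generalize (Cmod2_alt z). intros H. field_simplify. rewrite H. field. }
  assert (S1 := sqrt_sqrt _ H1). assert (S2 := sqrt_sqrt _ H2).
  unfold Csqrt. destruct (Rlt_dec (Im z) 0) as [Hi|Hi]; apply C_ext; simpl.
  - unfold Re, Im in *. nra.
  - rewrite Rabs_left in H3 by auto. unfold Re, Im in *. lra.
  - unfold Re, Im in *. nra.
  - rewrite Rabs_pos_eq in H3 by lra. unfold Re, Im in *. lra.
Qed.

Lemma Csqr_im (w z : C) : w * w = z -> (0 < Re w)%R -> Im w = (Im z / (2 * Re w))%R.
Proof.
  intros <- H. destruct w as [a b]. unfold Re, Im in *; simpl in *. field. lra.
Qed.

Lemma Csqrt_re_pos z : (0 < Cmod z + Re z)%R -> (0 < Re (Csqrt z))%R.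
Proof. intros H. unfold Csqrt; simpl. apply sqrt_lt_R0. lra. Qed.

(** Off the cut, where Cmod z + Re z > 0, the square root p + i q has p = sqrt ((Cmod z + Re
    z) / 2) > 0 and q = Im z / (2 p); the latter formula removes the case distinction on the
    sign of Im z. *)
Lemma is_Cderive_Csqrt f t u : is_Cderive f t u -> (0 < Cmod (f t) + Re (f t))%R ->
  is_Cderive (fun s => Csqrt (f s)) t (u / (2 * Csqrt (f t))).
Proof.
  intros H Hp. destruct (is_Cderive_continuous _ _ _ H) as [HcR HcI]. destruct H as [A B].
  assert (Hnz : f t <> 0).
  { intros E. rewrite E, Cmod_0 in Hp. simpl in Hp. lra. }
  assert (P := sq_sum_pos _ Hnz).
  set (m := fun s => sqrt (Re (f s) * Re (f s) + Im (f s) * Im (f s))).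
  assert (Hm : forall s, Cmod (f s) = m s) by (intros; apply Cmod_sqrt).
  set (p := fun s => sqrt ((m s + Re (f s)) / 2)).
  assert (Hmp : (0 < m t)%R) by (apply sqrt_lt_R0; auto).
  assert (Hm2 : (m t * m t = Re (f t) * Re (f t) + Im (f t) * Im (f t))%R) by
      (apply sqrt_sqrt; lra).
  assert (Hmd : is_derive m t ((Re u * Re (f t) + Im u * Im (f t)) / m t)%R).
  { assert (HN : is_derive (fun s => Re (f s) * Re (f s) + Im (f s) * Im (f s))%R t
      (Re u * Re (f t) + Re (f t) * Re u + (Im u * Im (f t) + Im (f t) * Im u))%R).
    { apply (is_derive_plus (V := R_NormedModule)); apply is_derive_Rmult; auto. }
    eapply is_derive_eq; [exact (is_derive_sqrt _ _ _ HN P)|].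
    unfold scal; simpl; unfold mult; simpl. fold (m t). field. lra. }
  rewrite Hm in Hp.
  assert (Hpp : (0 < p t)%R) by (apply sqrt_lt_R0; lra).
  assert (Hp2 : (p t * p t = (m t + Re (f t)) / 2)%R) by (apply sqrt_sqrt; lra).
  assert (Hpd : is_derive p t (((Re u * Re (f t) + Im u * Im (f t)) / m t + Re u) / (4 * p t))%R).
  { assert (HN : is_derive (fun s => (m s + Re (f s)) / 2)%R t
      (((Re u * Re (f t) + Im u * Im (f t)) / m t + Re u) / 2)%R).
    { apply (is_derive_ext (fun s => (/ 2) * (m s + Re (f s)))%R).
      - intros s. apply Rmult_comm.
      - eapply is_derive_eq; [apply is_derive_scal, (is_derive_plus (V := R_NormedModule)); eauto|].
        unfold plus; simpl. field. lra. }
    assert (HP2 : (0 < (m t + Re (f t)) / 2)%R) by lra.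
    eapply is_derive_eq; [exact (is_derive_sqrt _ _ _ HN HP2)|].
    unfold scal; simpl; unfold mult; simpl. fold (p t). field. lra. }
  assert (Himg : forall z, (0 < Re (Csqrt z))%R -> Im (Csqrt z) = (Im z / (2 * Re (Csqrt z)))%R).
  { intros z Hz. apply Csqr_im; auto. apply Csqrt_sqr. }
  assert (Hre : forall s, Re (Csqrt (f s)) = p s).
  { intros s. unfold Csqrt; simpl. rewrite Hm. reflexivity. }
  assert (HE : Csqrt (f t) = (p t, Im (f t) / (2 * p t))%R).
  { apply C_ext; [apply Hre|]. rewrite Himg, Hre; [reflexivity|rewrite Hre; auto]. }
  apply (is_Cderive_ext_loc (fun s => (p s, Im (f s) / (2 * p s))%R)).
  { assert (Hpc : continuous p t) by
      (apply (ex_derive_continuous (V := R_NormedModule)); eexists; eauto).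
    generalize (continuous_pos_locally _ _ Hpc Hpp). apply filter_imp. intros s Hs.
    apply C_ext; [rewrite Hre; auto|]. rewrite Himg, Hre; [reflexivity|rewrite Hre; auto]. }
  assert (Hsq : Csqrt (f t) * Csqrt (f t) = f t) by apply Csqrt_sqr.
  rewrite HE in Hsq |- *.
  set (p0 := p t) in *. set (q0 := (Im (f t) / (2 * p0))%R) in *.
  assert (Hq : (Im (f t) = 2 * p0 * q0)%R) by (unfold q0; field; lra).
  assert (Hr : (Re (f t) = p0 * p0 - q0 * q0)%R).
  { rewrite <- Hsq at 1. simpl. ring. }
  assert (Hmm : (m t = p0 * p0 + q0 * q0)%R).
  { rewrite Hr in Hp2. lra. }
  split; simpl.
  - eapply is_derive_eq; [exact Hpd|]. rewrite Hmm, Hr, Hq. unfold Re, Im; simpl. field.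
    repeat split; nra.
  - assert (H2p : is_derive (fun s => 2 * p s)%R t
      (2 * (((Re u * Re (f t) + Im u * Im (f t)) / m t + Re u) / (4 * p0)))%R)
      by (apply is_derive_scal; auto).
    eapply is_derive_eq; [apply (is_derive_div _ _ _ _ _ B H2p); fold p0; lra|].
    fold p0. rewrite Hmm, Hr, Hq. unfold Re, Im; simpl. field. repeat split; nra.
Qed.

(** * Power series and linear differential equations along a ray *)

Fixpoint csum (f : nat -> C) (n : nat) : C :=
  match n with O => f O | S m => csum f m + f (S m) end.

Lemma csum_ext f g n : (forall k, (k <= n)%nat -> f k = g k) -> csum f n = csum g n.
Proof. induction n as [|n IH]; intros H; simpl; [apply H; lia|]. rewrite IH, H; auto. Qed.

Lemma csum_mult_l c f n : c * csum f n = csum (fun k => c * f k) n.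
Proof. induction n as [|n IH]; simpl; auto. rewrite <- IH. ring. Qed.

Lemma csum_re f n : Re (csum f n) = sum_f_R0 (fun k => Re (f k)) n.
Proof. induction n as [|n IH]; simpl in *; auto. rewrite <- IH. reflexivity. Qed.

Lemma csum_im f n : Im (csum f n) = sum_f_R0 (fun k => Im (f k)) n.
Proof. induction n as [|n IH]; simpl in *; auto. rewrite <- IH. reflexivity. Qed.

Lemma csum_mod f n : (Cmod (csum f n) <= sum_f_R0 (fun k => Cmod (f k)) n)%R.
Proof.
  induction n as [|n IH]; simpl; [lra|]. apply Rle_trans with (1 := Cmod_triangle _ _). lra.
Qed.

(** The sum of A n t^n for a real variable t. A complex argument rho is handled by putting A
    n = a n * rho^n and letting t run from 0 to 1, so that the real theory of power series
    applies to both components. *)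
Definition Cpseries (A : nat -> C) (t : R) : C :=
  (PSeries (fun n => Re (A n)) t, PSeries (fun n => Im (A n)) t).

(** Coefficients with geometric decay: the radius of convergence exceeds 1, which makes the
    closed unit interval of t available. *)
Definition geo_bounded (A : nat -> C) : Prop :=
  exists K q, (0 < q < 1)%R /\ forall n, (Cmod (A n) <= K * q ^ n)%R.

Lemma Im_le_Cmod (z : C) : (Rabs (Im z) <= Cmod z)%R.
Proof. apply Rle_trans with (2 := Rmax_Cmod z). apply Rmax_r. Qed.

Lemma Cmod_le_sum (z : C) : (Cmod z <= Rabs (Re z) + Rabs (Im z))%R.
Proof.
  rewrite Cmod_sqrt. rewrite <- (sqrt_square (Rabs (Re z) + Rabs (Im z))).
  - apply sqrt_le_1_alt. generalize (Rabs_pos (Re z)) (Rabs_pos (Im z)).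
    generalize (Rsqr_abs (Re z)) (Rsqr_abs (Im z)). unfold Rsqr. nra.
  - generalize (Rabs_pos (Re z)) (Rabs_pos (Im z)). lra.
Qed.

Lemma radius_gt_1 (a : nat -> R) K q t : (0 < q < 1)%R -> (forall n, Rabs (a n) <= K * q ^ n)%R ->
  (Rabs t <= 1)%R -> Rbar_lt (Rabs t) (CV_radius a).
Proof.
  intros Hq Ha Ht. apply Rbar_lt_le_trans with (/ q)%R.
  - simpl. apply Rle_lt_trans with (1 := Ht). rewrite <- Rinv_1. apply Rinv_lt_contravar; lra.
  - apply CV_radius_bounded. exists K. intros n. rewrite Rabs_mult, <- RPow_abs.
    rewrite (Rabs_pos_eq (/ q)) by (left; apply Rinv_0_lt_compat; lra). rewrite pow_inv.
    assert (0 < q ^ n)%R by (apply pow_lt; lra).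
    apply (Rmult_le_reg_r (q ^ n)); auto. rewrite Rmult_assoc, Rinv_l by lra. specialize (Ha n).
    lra.
Qed.

Lemma geo_radius A t : geo_bounded A -> (Rabs t <= 1)%R ->
  Rbar_lt (Rabs t) (CV_radius (fun n => Re (A n))) /\
      Rbar_lt (Rabs t) (CV_radius (fun n => Im (A n))).
Proof.
  intros (K & q & Hq & HA) Ht. split; apply (radius_gt_1 _ K q); auto; intros n;
    eapply Rle_trans; try apply HA; [apply re_le_Cmod|apply Im_le_Cmod].
Qed.

Lemma geo_ex_pseries A t : geo_bounded A -> (Rabs t <= 1)%R ->
  ex_pseries (fun n => Re (A n)) t /\ ex_pseries (fun n => Im (A n)) t.
Proof. intros HA Ht. destruct (geo_radius A t HA Ht). split; apply CV_radius_inside; auto. Qed.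

Lemma geo_plus A B : geo_bounded A -> geo_bounded B -> geo_bounded (fun n => A n + B n).
Proof.
  intros (K & q & Hq & HA) (K' & q' & Hq' & HB).
  exists (Rabs K + Rabs K')%R, (Rmax q q').
  assert (M1 := Rmax_l q q'). assert (M2 := Rmax_r q q').
  split; [split; [lra|apply Rmax_lub_lt; lra]|].
  intros n. apply Rle_trans with (1 := Cmod_triangle _ _). specialize (HA n). specialize (HB n).
  assert (P1 : (0 <= q ^ n)%R) by (apply pow_le; lra).
  assert (P2 : (0 <= q' ^ n)%R) by (apply pow_le; lra).
  assert (Q1 : (q ^ n <= Rmax q q' ^ n)%R) by (apply pow_incr; lra).
  assert (Q2 : (q' ^ n <= Rmax q q' ^ n)%R) by (apply pow_incr; lra).
  assert (R1 := Rle_abs K). assert (R2 := Rle_abs K').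
  assert (R3 := Rabs_pos K). assert (R4 := Rabs_pos K'). nra.
Qed.

Lemma geo_scal c A : geo_bounded A -> geo_bounded (fun n => c * A n).
Proof.
  intros (K & q & Hq & HA). exists (Cmod c * K)%R, q. split; auto. intros n.
  rewrite Cmod_mult, Rmult_assoc. apply Rmult_le_compat_l; [apply Cmod_ge_0|auto].
Qed.

Lemma geo_shift A : geo_bounded A -> geo_bounded (fun n => A (S n)).
Proof.
  intros (K & q & Hq & HA). exists (K * q)%R, q. split; auto. intros n.
  rewrite Rmult_assoc. apply (HA (S n)).
Qed.

Lemma geo_ext A B : (forall n, A n = B n) -> geo_bounded A -> geo_bounded B.
Proof. intros E (K & q & Hq & HA). exists K, q; split; auto. intros n; rewrite <- E; auto. Qed.

Lemma Cpseries_ext A B t : (forall n, A n = B n) -> Cpseries A t = Cpseries B t.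
Proof. intros E. unfold Cpseries. f_equal; apply PSeries_ext; intros n; rewrite E; auto. Qed.

Lemma Cpseries_plus A B t : geo_bounded A -> geo_bounded B -> (Rabs t <= 1)%R ->
  Cpseries (fun n => A n + B n) t = Cpseries A t + Cpseries B t.
Proof.
  intros HA HB Ht. destruct (geo_ex_pseries A t HA Ht). destruct (geo_ex_pseries B t HB Ht).
  unfold Cpseries. apply C_ext; simpl; rewrite <- PSeries_plus by auto; apply PSeries_ext;
      reflexivity.
Qed.

Lemma Cpseries_scal c A t : geo_bounded A -> (Rabs t <= 1)%R -> Cpseries (fun n => c * A n) t =
  c * Cpseries A t.
Proof.
  intros HA Ht. destruct (geo_ex_pseries A t HA Ht) as [E1 E2].
  assert (X : forall (a : nat -> R) (k : R), ex_pseries a t -> ex_pseries (PS_scal k a) t).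
  { intros a k Ha. apply (ex_pseries_scal (V := R_NormedModule)); auto. apply Rmult_comm. }
  unfold Cpseries. apply C_ext; simpl; rewrite <- !PSeries_scal.
  - rewrite <- PSeries_minus by auto. apply PSeries_ext; reflexivity.
  - rewrite <- PSeries_plus by auto. apply PSeries_ext; reflexivity.
Qed.

Lemma Cpseries_decr A t : geo_bounded A -> (Rabs t <= 1)%R -> Cpseries A t = A O + t *
  Cpseries (fun n => A (S n)) t.
Proof.
  intros HA Ht. destruct (geo_ex_pseries A t HA Ht). unfold Cpseries.
  apply C_ext; simpl; rewrite PSeries_decr_1 by auto; unfold Re, Im; unfold PS_decr_1; simpl; ring.
Qed.

Lemma Cpseries_at_0 A : Cpseries A 0 = A O.
Proof. unfold Cpseries. rewrite !PSeries_0. destruct (A O); reflexivity. Qed.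

Definition conv (A c : nat -> C) (n : nat) : C := csum (fun k => A (n - k)%nat * c k) n.

Lemma Cpseries_conv A c t : geo_bounded A -> geo_bounded c -> (Rabs t <= 1)%R ->
  Cpseries (conv A c) t = Cpseries A t * Cpseries c t.
Proof.
  intros HA Hc Ht. destruct (geo_radius A t HA Ht) as [A1 A2].
  destruct (geo_radius c t Hc Ht) as [C1 C2].
  assert (X := fun a b => ex_pseries_mult a b t).
  unfold Cpseries. apply C_ext; simpl; rewrite !(Rmult_comm (PSeries (fun n => Re (A n)) t)),
     !(Rmult_comm (PSeries (fun n => Im (A n)) t)); rewrite <- !PSeries_mult by auto.
  - rewrite <- PSeries_minus by auto. apply PSeries_ext. intros n. unfold conv. rewrite csum_re.
    etransitivity; [|apply minus_sum]. apply sum_eq. intros; simpl. unfold Re, Im; simpl; ring.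
  - rewrite <- PSeries_plus by auto. apply PSeries_ext. intros n. unfold conv. rewrite csum_im.
    unfold PS_plus, PS_mult, plus; simpl. rewrite <- plus_sum. apply sum_eq. intros; simpl.
    unfold Re, Im; simpl; ring.
Qed.

Lemma is_Cderive_Cpseries A t : geo_bounded A -> (Rabs t <= 1)%R ->
  is_Cderive (Cpseries A) t (Cpseries (fun n => INR (S n) * A (S n)) t).
Proof.
  intros HA Ht. destruct (geo_radius A t HA Ht) as [A1 A2].
  split; simpl; (eapply is_derive_eq; [apply is_derive_PSeries; auto|]); apply PSeries_ext;
    intros n; unfold PS_derive; simpl; unfold Re, Im; ring.
Qed.

Lemma zero_derivative_constant (f : R -> R) a b : (a <= b)%R ->
  (forall t, (a <= t <= b)%R -> is_derive f t 0) -> f b = f a.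
Proof.
  intros Hab H. destruct (MVT_gen f a b (fun _ => 0%R)) as (c & _ & E).
  - intros x Hx. rewrite Rmin_left, Rmax_right in Hx by auto. apply H; lra.
  - intros x Hx. rewrite Rmin_left, Rmax_right in Hx by auto. apply continuity_pt_filterlim.
    apply (ex_derive_continuous (V := R_NormedModule)). exists 0%R. apply H; lra.
  - lra.
Qed.

Lemma is_Cderive_zero_constant f a b : (a <= b)%R ->
  (forall t, (a <= t <= b)%R -> is_Cderive f t 0) -> f b = f a.
Proof.
  intros Hab H. apply C_ext;
    [apply (zero_derivative_constant (fun t => Re (f t)))|apply
        (zero_derivative_constant (fun t => Im (f t)))];
    auto; intros t Ht; destruct (H t Ht); auto.
Qed.

(** The path G solves G' = - A G, and the power series with coefficients c solves c' = A c,
    so the product of the two is constant. *)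
Lemma ode_series (A c : nat -> C) (G : R -> C) : geo_bounded A -> geo_bounded c -> c O = 1 ->
  (forall n, INR (S n) * c (S n) = conv A c n) ->
  (forall t, (0 <= t <= 1)%R -> is_Cderive G t (- (Cpseries A t * G t))) ->
  forall t, (0 <= t <= 1)%R -> Cpseries c t * G t = G 0%R.
Proof.
  intros HA Hc H0 Hrec HG t Ht.
  rewrite (is_Cderive_zero_constant (fun t => Cpseries c t * G t) 0 t).
  - rewrite Cpseries_at_0, H0. ring.
  - lra.
  - intros s Hs. assert (Hs1 : (Rabs s <= 1)%R) by (apply Rabs_le; lra).
    eapply is_Cderive_eq; [apply is_Cderive_mult; [apply is_Cderive_Cpseries; auto|apply HG; lra]|].
    rewrite (Cpseries_ext _ (conv A c)) by auto. rewrite Cpseries_conv by auto. ring.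
Qed.

(** Course-of-values recursion: entry n + 1 needs all entries up to n, so the table of the
    first entries is built instead. *)
Fixpoint ode_tab (a : nat -> C) (n : nat) : nat -> C :=
  match n with
  | O => fun _ => 1
  | S m => fun i => if (i <=? m)%nat then ode_tab a m i else conv a (ode_tab a m) m / INR (S m)
  end.

(** The power series solution of c' = a c with c 0 = 1. *)
Definition ode_coef (a : nat -> C) (n : nat) : C := ode_tab a n n.

Lemma ode_tab_coef a n : forall i, (i <= n)%nat -> ode_tab a n i = ode_coef a i.
Proof.
  induction n as [|n IH]; intros i Hi.
  - replace i with O by lia. reflexivity.
  - destruct (Nat.eq_dec i (S n)) as [->|Hne]; [reflexivity|]. simpl.
    rewrite (proj2 (Nat.leb_le i n)) by lia. apply IH; lia.
Qed.

Lemma INR_S_neq_0 n : RtoC (INR (S n)) <> 0.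
Proof. intros E. apply RtoC_inj in E. revert E. apply not_0_INR; lia. Qed.

Lemma ode_coef_succ a n : ode_coef a (S n) = conv a (ode_coef a) n / INR (S n).
Proof.
  unfold ode_coef at 1. cbn [ode_tab]. rewrite (proj2 (Nat.leb_gt (S n) n)) by lia.
  f_equal. apply csum_ext. intros k Hk. rewrite ode_tab_coef by auto. reflexivity.
Qed.

Lemma ode_coef_unique (a c : nat -> C) : c O = 1 -> (forall n, INR (S n) * c (S n) = conv a c n) ->
  forall n, c n = ode_coef a n.
Proof.
  intros H0 H n. induction n as [n IH] using lt_wf_ind.
  destruct n as [|n]; [exact H0|]. rewrite ode_coef_succ.
  assert (E : conv a (ode_coef a) n = conv a c n).
  { apply csum_ext. intros k Hk. rewrite IH by lia. reflexivity. }
  rewrite E, <- H. field. apply INR_S_neq_0.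
Qed.

(** Replacing z by r z in c' = a c. *)
Lemma ode_coef_scale (a : nat -> C) (r : C) n : ode_coef (fun k => a k * r ^ S k) n =
  ode_coef a n * r ^ n.
Proof.
  symmetry. revert n. apply ode_coef_unique.
  - unfold ode_coef; simpl. ring.
  - intros n. rewrite ode_coef_succ. unfold conv.
    transitivity (r ^ S n * csum (fun k => a (n - k)%nat * ode_coef a k) n).
    { field. apply INR_S_neq_0. }
    rewrite csum_mult_l. apply csum_ext. intros k Hk.
    replace (S n) with (S (n - k) + k)%nat by lia. rewrite Cpow_add_r. ring.
Qed.

(** The coefficients (M)_n / n! of (1 - z)^(-M). *)
Fixpoint majorant_coef (M : R) (n : nat) : R :=
  match n with O => 1%R | S m => (majorant_coef M m * (INR m + M) / INR (S m))%R end.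

Lemma majorant_coef_nonneg M n : (0 <= M)%R -> (0 <= majorant_coef M n)%R.
Proof.
  intros HM. induction n as [|n IH]; simpl majorant_coef; [lra|].
  assert (0 < INR (S n))%R by (apply lt_0_INR; lia). assert (0 <= INR n)%R by apply pos_INR.
  apply Rmult_le_pos; [apply Rmult_le_pos; lra|left; apply Rinv_0_lt_compat; auto].
Qed.

(** (1 - z)^(-M) solves the differential equation with constant coefficients a k = M. *)
Lemma majorant_coef_sum M n : (M * sum_f_R0 (majorant_coef M) n = INR (S n) *
  majorant_coef M (S n))%R.
Proof.
  induction n as [|n IH].
  - simpl. field.
  - rewrite tech5, Rmult_plus_distr_l, IH.
    change (majorant_coef M (S (S n))) with
        (majorant_coef M (S n) * (INR (S n) + M) / INR (S (S n)))%R.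
    field. apply not_0_INR; lia.
Qed.

(** The recursion has nonnegative weights, so the solution for the constant coefficients a k
    = M is a majorant. *)
Lemma ode_coef_bound a M n : (forall k, Cmod (a k) <= M)%R ->
  (Cmod (ode_coef a n) <= majorant_coef M n)%R.
Proof.
  intros Ha. assert (HM : (0 <= M)%R) by (apply Rle_trans with (2 := Ha O), Cmod_ge_0).
  induction n as [n IH] using lt_wf_ind.
  destruct n as [|n]; [unfold ode_coef; simpl; rewrite Cmod_1; lra|].
  assert (HS : (0 < INR (S n))%R) by (apply lt_0_INR; lia).
  rewrite ode_coef_succ, Cmod_div by apply INR_S_neq_0. rewrite Cmod_R,
      (Rabs_pos_eq (INR (S n))) by lra.
  apply (Rmult_le_reg_r (INR (S n))); auto. unfold Rdiv. rewrite Rmult_assoc, Rinv_l,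
      Rmult_1_r by lra.
  rewrite (Rmult_comm (majorant_coef _ _)), <- majorant_coef_sum.
  apply Rle_trans with (1 := csum_mod _ _). rewrite scal_sum. apply sum_Rle. intros k Hk.
  rewrite Cmod_mult, Rmult_comm. apply Rmult_le_compat; auto using Cmod_ge_0. apply IH; lia.
Qed.

Lemma majorant_coef_1 n : majorant_coef 1 n = 1%R.
Proof.
  induction n as [|n IH]; [reflexivity|].
  change (majorant_coef 1 n * (INR n + 1) / INR (S n) = 1)%R.
  rewrite IH, S_INR. field. generalize (pos_INR n); lra.
Qed.

(** The ratio of consecutive coefficients tends to 1, so after multiplication by r^n it is
    eventually below q. *)
Lemma majorant_coef_geo M r q : (0 <= M)%R -> (0 <= r < q)%R ->
  exists K, (0 <= K)%R /\ forall n, (majorant_coef M n * r ^ n <= K * q ^ n)%R.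
Proof.
  intros HM Hr.
  destruct (nfloor_ex (r * M / (q - r))) as [N [_ HN]].
  { apply Rmult_le_pos; [nra|left; apply Rinv_0_lt_compat; lra]. }
  (* Beyond N the ratio r (n + M) / (n + 1) is at most q. *)
  assert (HN' : forall n, (N < n)%nat -> (r * (INR n + M) <= q * INR (S n))%R).
  { intros n Hn. rewrite S_INR. assert (INR N + 1 <= INR n)%R by
      (rewrite <- S_INR; apply le_INR; lia).
    apply (Rmult_lt_compat_r (q - r)) in HN; [|lra]. unfold Rdiv in HN.
    rewrite Rmult_assoc, Rinv_l in HN by lra. nra. }
  set (K := sum_f_R0 (fun i => majorant_coef M i * r ^ i / q ^ i)%R (S N)).
  assert (Hterm : forall i, (0 <= majorant_coef M i * r ^ i / q ^ i)%R).
  { intros i. apply Rmult_le_pos.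
    - apply Rmult_le_pos; [apply majorant_coef_nonneg; auto|apply pow_le; lra].
    - left. apply Rinv_0_lt_compat, pow_lt; lra. }
  exists K. split; [apply cond_pos_sum; auto|].
  assert (Hs : forall n, (majorant_coef M n * r ^ n / q ^ n <= K)%R).
  { intros n. destruct (Nat.le_gt_cases n (S N)) as [Hn|Hn].
    - unfold K. clear -Hn Hterm. induction (S N) as [|m IH].
      + replace n with O by lia. simpl. lra.
      + rewrite tech5. destruct (Nat.eq_dec n (S m)) as [->|].
        * generalize (cond_pos_sum (fun i => majorant_coef M i * r ^ i / q ^ i)%R m Hterm). lra.
        * specialize (IH ltac:(lia)). specialize (Hterm (S m)). lra.
    - induction n as [|n IH]; [lia|].
      assert (Hn' : (majorant_coef M n * r ^ n / q ^ n <= K)%R).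
      { destruct (Nat.eq_dec n (S N)) as [->|]; [|apply IH; lia].
        unfold K. rewrite tech5. generalize
            (cond_pos_sum (fun i => majorant_coef M i * r ^ i / q ^ i)%R N Hterm). lra. }
      apply Rle_trans with (2 := Hn').
      assert (HS : (0 < INR (S n))%R) by (apply lt_0_INR; lia).
      assert (Hq : (0 < q ^ n)%R) by (apply pow_lt; lra).
      replace (majorant_coef M (S n) * r ^ S n / q ^ S n)%R with
        ((majorant_coef M n * r ^ n / q ^ n) * (r * (INR n + M) / (q * INR (S n))))%R
        by (change (majorant_coef M (S n)) with (majorant_coef M n * (INR n + M) / INR (S n))%R;
            rewrite <- !tech_pow_Rmult; field; repeat split; try lra; apply not_0_INR; lia).
      rewrite <- (Rmult_1_r (majorant_coef M n * r ^ n / q ^ n)) at 2.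
      apply Rmult_le_compat_l; [apply Hterm|].
      apply (Rmult_le_reg_r (q * INR (S n))); [nra|]. unfold Rdiv. rewrite Rmult_assoc,
          Rinv_l by nra.
      specialize (HN' n ltac:(lia)). lra. }
  intros n. assert (Hq : (0 < q ^ n)%R) by (apply pow_lt; lra).
  specialize (Hs n). apply (Rmult_le_compat_r (q ^ n)) in Hs; [|lra].
  unfold Rdiv in Hs. rewrite Rmult_assoc, Rinv_l in Hs; lra.
Qed.

Lemma bounded_geo a M r : (forall k, Cmod (a k) <= M)%R -> (Cmod r < 1)%R ->
  geo_bounded (fun k => a k * r ^ k).
Proof.
  intros Ha Hr. assert (HM : (0 <= M)%R) by (apply Rle_trans with (2 := Ha O), Cmod_ge_0).
  assert (Hr0 := Cmod_ge_0 r).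
  exists M, ((1 + Cmod r) / 2)%R. split; [lra|]. intros n. rewrite Cmod_mult, Cmod_pow.
  apply Rmult_le_compat; auto using Cmod_ge_0. apply pow_le; auto. apply pow_incr; lra.
Qed.

(** The constants depend on M and r alone. This is what makes expansions uniform in x. *)
Lemma geo_uniform M r : (0 <= M)%R -> (Cmod r < 1)%R -> exists K q, (0 < q < 1)%R /\
  forall c : nat -> C, (forall n, Cmod (c n) <= majorant_coef M n)%R -> forall n,
      (Cmod (c n * r ^ n) <= K * q ^ n)%R.
Proof.
  intros HM Hr. assert (Hr0 := Cmod_ge_0 r).
  destruct (majorant_coef_geo M (Cmod r) ((1 + Cmod r) / 2)%R HM ltac:(lra)) as (K & HK0 & HK).
  exists K, ((1 + Cmod r) / 2)%R. split; [lra|]. intros c Hc n. rewrite Cmod_mult, Cmod_pow.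
  apply Rle_trans with (2 := HK n). apply Rmult_le_compat_r; auto. apply pow_le; auto.
Qed.

Lemma ode_geo a M r : (forall k, Cmod (a k) <= M)%R -> (Cmod r < 1)%R ->
  geo_bounded (fun n => ode_coef a n * r ^ n).
Proof.
  intros Ha Hr. assert (HM : (0 <= M)%R) by (apply Rle_trans with (2 := Ha O), Cmod_ge_0).
  destruct (geo_uniform M r HM Hr) as (K & q & Hq & H). exists K, q. split; auto.
  apply H. intros; apply ode_coef_bound; auto.
Qed.

Lemma geo_pow_succ (a : nat -> C) (r : C) : geo_bounded (fun n => a n * r ^ n) ->
  geo_bounded (fun n => a n * r ^ S n).
Proof.
  intros H. apply (geo_ext (fun n => r * (a n * r ^ n))); [|apply geo_scal; auto].
  intros n. simpl. ring.
Qed.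

(** Along the ray t r the reciprocal of the series solution satisfies G' = - r a(t r) G.
    Stated for the reciprocal, the lemma shows on its own that the series does not vanish
    when G 0 is nonzero. *)
Lemma ode_solution a M r (G : R -> C) : (forall k, Cmod (a k) <= M)%R -> (Cmod r < 1)%R ->
  (forall t, (0 <= t <= 1)%R -> is_Cderive G t (- (Cpseries (fun n => a n * r ^ S n) t * G t))) ->
  forall t, (0 <= t <= 1)%R -> Cpseries (fun n => ode_coef a n * r ^ n) t * G t = G 0%R.
Proof.
  intros Ha Hr HG. apply (ode_series (fun n => a n * r ^ S n)); auto.
  - apply geo_pow_succ. apply bounded_geo with M; auto.
  - apply ode_geo with M; auto.
  - unfold ode_coef; simpl; ring.
  - intros n. rewrite <- ode_coef_scale, ode_coef_succ.
    transitivity (conv (fun n => a n * r ^ S n) (ode_coef (fun n => a n * r ^ S n)) n).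
    + field. apply INR_S_neq_0.
    + apply csum_ext. intros k _. rewrite ode_coef_scale. reflexivity.
Qed.

(** * The kernel as a power series in rho *)

Definition kernel_quadratic (rho : C) (x : R) : C := 1 + rho ^ 2 - 2 * rho * x.

Definition kernel_root (rho : C) (x : R) : C := Csqrt (kernel_quadratic rho x).

Definition kernel (alpha beta rho : C) (x : R) : C :=
  kernel_root rho x * Cpower (1 + kernel_root rho x - rho) alpha *
      Cpower (1 + kernel_root rho x + rho) beta.

(** Linear-combination step: an equation follows from another one with the same difference
    of sides. *)
Lemma Ceq_of_diff (a b c d : C) : a = b -> c - d = a - b -> c = d.
Proof. intros -> H. replace c with (c - d + d) by ring. rewrite H. ring. Qed.

Lemma Cmod_lt_1 z : (Cmod z < 1)%R -> (Re z * Re z + Im z * Im z < 1)%R.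
Proof.
  rewrite Cmod_sqrt. intros H. destruct (Rlt_le_dec (Re z * Re z + Im z * Im z) 1) as [|H1]; auto.
  apply sqrt_le_1_alt in H1. rewrite sqrt_1 in H1. lra.
Qed.

(** If 1 + rho^2 - 2 rho x is real, then rho is real or Re rho = x. For real rho it is a
    positive number, and for Re rho = x it equals 1 - x^2 - (Im rho)^2 > 0. *)
Lemma kernel_quadratic_off_cut rho x : (Cmod rho < 1)%R -> (-1 < x < 1)%R ->
  (0 < Cmod (kernel_quadratic rho x) + Re (kernel_quadratic rho x))%R.
Proof.
  intros Hr Hx. apply Cmod_lt_1 in Hr. destruct rho as [a b]. unfold Re, Im in Hr; simpl in Hr.
  set (D := kernel_quadratic (a, b) x).
  assert (ER : Re D = (1 + a * a - b * b - 2 * a * x)%R) by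
      (unfold D, kernel_quadratic; simpl; ring).
  assert (EI : Im D = (2 * b * (a - x))%R) by (unfold D, kernel_quadratic; simpl; ring).
  assert (HA := re_le_Cmod D). apply Rabs_le_between in HA.
  destruct (Rle_lt_or_eq_dec 0 (Cmod D + Re D) ltac:(lra)) as [|E]; auto. exfalso.
  assert (HC := Cmod2_alt D). replace (Cmod D) with (- Re D)%R in * by lra.
  assert (HI : Im D = 0%R) by nra.
  assert (HR : (Re D <= 0)%R) by lra.
  rewrite EI in HI. rewrite ER in HR.
  apply Rmult_integral in HI. destruct HI as [Hb|Hb].
  - assert (Hb0 : b = 0%R) by lra. rewrite Hb0 in HR.
    assert (0 <= (a - x) * (a - x))%R by apply Rle_0_sqr.
    assert (0 < (1 - x) * (1 + x))%R by (apply Rmult_lt_0_compat; lra). lra.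
  - assert (Ha : a = x) by lra. rewrite Ha in HR, Hr. lra.
Qed.

Lemma kernel_root_sqr rho x : kernel_root rho x * kernel_root rho x = kernel_quadratic rho x.
Proof. apply Csqrt_sqr. Qed.

Lemma kernel_root_pos rho x : (Cmod rho < 1)%R -> (-1 < x < 1)%R -> (0 < Re (kernel_root rho x))%R.
Proof. intros Hr Hx. apply Csqrt_re_pos, kernel_quadratic_off_cut; auto. Qed.

Lemma base_minus_pos rho x : (Cmod rho < 1)%R -> (-1 < x < 1)%R ->
  (0 < Re (1 + kernel_root rho x - rho))%R.
Proof.
  intros Hr Hx. generalize (kernel_root_pos _ _ Hr Hx) (re_le_Cmod rho). intros H1 H2.
  apply Rabs_le_between in H2.
  destruct (kernel_root rho x) as [p q], rho as [a b]. unfold Re in *; simpl in *. lra.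
Qed.

Lemma base_plus_pos rho x : (Cmod rho < 1)%R -> (-1 < x < 1)%R ->
  (0 < Re (1 + kernel_root rho x + rho))%R.
Proof.
  intros Hr Hx. generalize (kernel_root_pos _ _ Hr Hx) (re_le_Cmod rho). intros H1 H2.
  apply Rabs_le_between in H2.
  destruct (kernel_root rho x) as [p q], rho as [a b]. unfold Re in *; simpl in *. lra.
Qed.

Lemma kernel_neq_0 alpha beta rho x : (Cmod rho < 1)%R -> (-1 < x < 1)%R ->
  kernel alpha beta rho x <> 0.
Proof.
  intros Hr Hx. unfold kernel, Cpower. repeat apply Cmult_neq_0; try apply Cexp_neq_0.
  apply Re_pos_neq_0, kernel_root_pos; auto.
Qed.

Fixpoint chebyshev (x : R) (n : nat) : R :=
  match n with
  | O => 1%R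
  | S m => match m with O => x | S p => (2 * x * chebyshev x m - chebyshev x p)%R end
  end.

Lemma chebyshev_SS x n : chebyshev x (S (S n)) = (2 * x * chebyshev x (S n) - chebyshev x n)%R.
Proof. reflexivity. Qed.

Lemma chebyshev_cos th n : chebyshev (cos th) n = cos (INR n * th) /\ chebyshev (cos th) (S n) =
  cos (INR (S n) * th).
Proof.
  induction n as [|n [IH1 IH2]].
  - simpl. rewrite Rmult_0_l, cos_0, Rmult_1_l. auto.
  - split; auto. rewrite chebyshev_SS, IH1, IH2.
    rewrite !S_INR. replace ((INR n + 1 + 1) * th)%R with ((INR n + 1) * th + th)%R by ring.
    replace (INR n * th)%R with ((INR n + 1) * th - th)%R by ring. rewrite cos_plus, cos_minus.
    ring.
Qed.

Lemma chebyshev_bound x n : (-1 <= x <= 1)%R -> (Rabs (chebyshev x n) <= 1)%R.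
Proof.
  intros Hx. rewrite <- (cos_acos x) by auto. rewrite (proj1 (chebyshev_cos _ _)).
  apply Rabs_le. generalize (COS_bound (INR n * acos x)). lra.
Qed.

Definition chebyshev_shift (x : R) (n : nat) : C := RtoC (chebyshev x (S n)).

Lemma chebyshev_shift_bound x : (-1 < x < 1)%R -> forall n, (Cmod (chebyshev_shift x n) <= 1)%R.
Proof. intros Hx n. unfold chebyshev_shift. rewrite Cmod_R. apply chebyshev_bound; lra. Qed.

(** The three-term recurrence of the Chebyshev polynomials; the sum is rho (x - t rho) /
    R^2, minus the logarithmic derivative of R along the ray. *)
Lemma chebyshev_generating (rho : C) (x t : R) : (Cmod rho < 1)%R -> (-1 < x < 1)%R ->
  (Rabs t <= 1)%R ->
  kernel_quadratic (t * rho) x * Cpseries (fun n => chebyshev_shift x n * rho ^ S n) t = rho *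
      (x - t * rho).
Proof.
  intros Hr Hx Ht.
  set (B := fun n => chebyshev_shift x n * rho ^ S n).
  assert (HB : geo_bounded B) by
      (apply geo_pow_succ, bounded_geo with 1%R; auto using chebyshev_shift_bound).
  assert (HB1 := geo_shift _ HB). assert (HB2 := geo_shift _ HB1).
  assert (E0 := Cpseries_decr B t HB Ht). assert (E1 := Cpseries_decr _ t HB1 Ht). cbv beta in E1.
  assert (E2 : Cpseries (fun n => B (S (S n))) t = 2 * x * rho * Cpseries (fun n => B (S n)) t +
      (- rho ^ 2) * Cpseries B t).
  { rewrite <- !Cpseries_scal by auto. rewrite <- Cpseries_plus by (auto using geo_scal).
    apply Cpseries_ext.
    intros n. unfold B, chebyshev_shift. rewrite (chebyshev_SS x (S n)). rewrite RtoC_minus,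
        !RtoC_mult. simpl. ring. }
  set (u0 := Cpseries B t) in *. set (u1 := Cpseries (fun n => B (S n)) t) in *.
  set (u2 := Cpseries (fun n => B (S (S n))) t) in *.
  assert (B0 : B O = x * rho) by (unfold B, chebyshev_shift; simpl; ring).
  assert (B1 : B 1%nat = (2 * x * x - 1) * rho ^ 2).
  { unfold B, chebyshev_shift. simpl. rewrite RtoC_minus, !RtoC_mult. ring. }
  rewrite B0 in E0. rewrite B1, E2 in E1.
  assert (F1 : t * u1 = u0 - x * rho) by (rewrite E0; ring).
  assert (F2 : t * u1 = t * ((2 * x * x - 1) * rho ^ 2) + 2 * x * rho * t * (t * u1) - t * t *
      rho ^ 2 * u0)
    by (rewrite E1 at 1; ring).
  rewrite !F1 in F2. unfold kernel_quadratic. apply (Ceq_of_diff _ _ _ _ F2). ring.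
Qed.

(** The Legendre polynomials, produced as the coefficients of 1/R. *)
Definition legendre (x : R) (n : nat) : C := ode_coef (chebyshev_shift x) n.

(** The Chebyshev polynomials are bounded by 1, and the majorant for M = 1 is the geometric
    series. *)
Lemma legendre_bound x n : (-1 < x < 1)%R -> (Cmod (legendre x n) <= 1)%R.
Proof.
  intros Hx. rewrite <- (majorant_coef_1 n). apply ode_coef_bound, chebyshev_shift_bound; auto.
Qed.

Lemma is_Cderive_id t : is_Cderive RtoC t 1.
Proof. apply (is_Cderive_RtoC (fun s => s)), (is_derive_id (K := R_AbsRing)). Qed.

Lemma is_Cderive_scaled_root (rho : C) (x t : R) : (Cmod (t * rho) < 1)%R -> (-1 < x < 1)%R ->
  is_Cderive (fun s => kernel_root (s * rho) x) t (rho * (t * rho - x) / kernel_root (t * rho) x).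
Proof.
  intros Hr Hx. unfold kernel_root. eapply is_Cderive_eq.
  - apply (is_Cderive_Csqrt (fun s => kernel_quadratic (s * rho) x) t (2 * rho * (t * rho - x))).
    + unfold kernel_quadratic. apply
        (is_Cderive_ext (fun s => (1 + s * (-2 * rho * x)) + s * s * rho ^ 2)); [intros; ring|].
      assert (Hid := is_Cderive_id t).
      eapply is_Cderive_eq.
      * apply is_Cderive_plus; [apply is_Cderive_plus;
          [apply is_Cderive_const|apply is_Cderive_mult; [exact Hid|apply is_Cderive_const]]|].
        apply is_Cderive_mult; [apply is_Cderive_mult; exact Hid|apply is_Cderive_const].
      * cbv beta. ring.
    + apply kernel_quadratic_off_cut; auto.
  - assert (N := Re_pos_neq_0 _ (kernel_root_pos _ _ Hr Hx)). unfold kernel_root in N. field. auto.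
Qed.

Lemma scaled_lt_1 (rho : C) (t : R) : (Cmod rho < 1)%R -> (0 <= t <= 1)%R -> (Cmod (t * rho) < 1)%R.
Proof.
  intros Hr Ht. rewrite Cmod_mult, Cmod_R, Rabs_pos_eq by lra. generalize (Cmod_ge_0 rho). nra.
Qed.

Lemma kernel_root_0 x : kernel_root 0 x = 1.
Proof.
  unfold kernel_root. replace (kernel_quadratic 0 x) with (RtoC 1) by
      (unfold kernel_quadratic; apply C_ext; simpl; ring).
  unfold Csqrt. rewrite Cmod_1. apply C_ext; simpl.
  - replace ((1 + 1) / 2)%R with 1%R by field. apply sqrt_1.
  - destruct (Rlt_dec 0 0); [lra|]. rewrite <- sqrt_0. f_equal. field.
Qed.

Lemma legendre_generating (rho : C) (x t : R) : (Cmod rho < 1)%R -> (-1 < x < 1)%R ->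
  (0 <= t <= 1)%R ->
  Cpseries (fun n => legendre x n * rho ^ n) t * kernel_root (t * rho) x = 1.
Proof.
  intros Hr Hx Ht.
  rewrite (ode_solution (chebyshev_shift x) 1%R rho (fun t => kernel_root (t * rho) x));
      auto using chebyshev_shift_bound.
  - rewrite <- (kernel_root_0 x). f_equal. ring.
  - intros s Hs. assert (Hsr := scaled_lt_1 _ _ Hr Hs).
    eapply is_Cderive_eq; [apply is_Cderive_scaled_root; auto|].
    assert (N := Re_pos_neq_0 _ (kernel_root_pos _ _ Hsr Hx)).
    assert (E := chebyshev_generating rho x s Hr Hx ltac:(apply Rabs_le; lra)).
    rewrite <- kernel_root_sqr in E. set (w := kernel_root (s * rho) x) in *.
    set (u := Cpseries _ s) in *.
    transitivity (- (w * w * u) / w); [rewrite E|]; field; auto.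
Qed.

(** The coefficients of the logarithmic derivative of the reciprocal kernel: that of 1/R,
    plus (alpha/2) ((1+z)/R - 1)/z and (beta/2) ((1-z)/R - 1)/z. *)
Definition kernel_log (alpha beta : C) (x : R) (n : nat) : C :=
  chebyshev_shift x n + (alpha / 2 * (legendre x (S n) + legendre x n)
    + beta / 2 * (legendre x (S n) - legendre x n)).

Definition kernel_bound (alpha beta : C) : R := (1 + (Cmod alpha + Cmod beta))%R.

Lemma kernel_bound_nonneg alpha beta : (0 <= kernel_bound alpha beta)%R.
Proof. unfold kernel_bound. generalize (Cmod_ge_0 alpha) (Cmod_ge_0 beta). lra. Qed.

Lemma half_mod (a u v : C) : (Cmod u <= 1)%R -> (Cmod v <= 1)%R ->
  (Cmod (a / 2 * (u + v)) <= Cmod a)%R.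
Proof.
  intros Hu Hv. rewrite Cmod_mult, Cmod_div by (intros E; apply RtoC_inj in E; lra).
  rewrite Cmod_R, Rabs_pos_eq by lra.
  generalize (Cmod_triangle u v) (Cmod_ge_0 a). nra.
Qed.

Lemma kernel_log_bound alpha beta x n : (-1 < x < 1)%R ->
  (Cmod (kernel_log alpha beta x n) <= kernel_bound alpha beta)%R.
Proof.
  intros Hx. unfold kernel_log, kernel_bound.
  apply Rle_trans with (1 := Cmod_triangle _ _). apply Rplus_le_compat;
      [apply chebyshev_shift_bound; auto|].
  apply Rle_trans with (1 := Cmod_triangle _ _).
  apply Rplus_le_compat; apply half_mod; rewrite ?Cmod_opp; apply legendre_bound; auto.
Qed.

(** By their generating function, these are the Jacobi polynomials P_n^(alpha,beta). *)
Definition kernel_coef (alpha beta : C) (x : R) (n : nat) : C :=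
  ode_coef (kernel_log alpha beta x) n.

Lemma kernel_log_series (alpha beta rho : C) (x t : R) : (Cmod rho < 1)%R -> (-1 < x < 1)%R ->
  (Rabs t <= 1)%R ->
  Cpseries (fun n => kernel_log alpha beta x n * rho ^ S n) t =
  Cpseries (fun n => chebyshev_shift x n * rho ^ S n) t
  + (alpha / 2 * (Cpseries (fun n => legendre x (S n) * rho ^ S n) t + rho *
      Cpseries (fun n => legendre x n * rho ^ n) t)
   + beta / 2 * (Cpseries (fun n => legendre x (S n) * rho ^ S n) t + - rho *
       Cpseries (fun n => legendre x n * rho ^ n) t)).
Proof.
  intros Hr Hx Ht.
  assert (G1 : geo_bounded (fun n => chebyshev_shift x n * rho ^ S n))
    by (apply geo_pow_succ, bounded_geo with 1%R; auto using chebyshev_shift_bound).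
  assert (G2 : geo_bounded (fun n => legendre x n * rho ^ n))
    by (apply bounded_geo with 1%R; auto using legendre_bound).
  assert (G3 := geo_shift _ G2). cbv beta in G3.
  repeat (first [rewrite <- Cpseries_scal by auto 10 using geo_plus,
      geo_scal | rewrite <- Cpseries_plus by auto 10 using geo_plus, geo_scal]).
  apply Cpseries_ext. intros n. unfold kernel_log. rewrite Cpow_S. ring.
Qed.

(** The derivative of Clog (1 + R - t rho), with w = R, z = t rho and Y = 1/R = 1 + t Y1.
    The point is that R enters only through 1/R, hence through a power series. At t = 0 the
    quotient Y1 = (Y - 1)/t must be supplied separately. *)
Lemma log_derivative (w z x rho t Y Y1 : C) : w <> 0 -> 1 + w - z <> 0 ->
  w * w = 1 + z ^ 2 - 2 * z * x -> z = t * rho -> Y = / w -> Y = 1 + t * Y1 ->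
  (t = 0 -> Y1 = rho * x) ->
  (rho * (z - x) / w - rho) / (1 + w - z) = - / 2 * (Y1 + rho * Y).
Proof.
  intros Nw N Sq Ez Ew EY E0.
  assert (N2 : RtoC 2 <> 0) by (intros E; apply RtoC_inj in E; lra).
  destruct (Ceq_dec t 0) as [E|Nt].
  - rewrite E0 by auto. assert (EY' : Y = 1) by (rewrite EY, E; ring).
    assert (Ew' : w = 1) by (transitivity (/ Y); [rewrite Ew; field; auto|rewrite EY'; field];
        apply C1_nz).
    assert (Ez' : z = 0) by (rewrite Ez, E; ring).
    rewrite EY', Ew', Ez'. field.
  - assert (ER : rho = z / t) by (rewrite Ez; field; auto).
    assert (EY1 : Y1 = (/ w - 1) / t) by (rewrite <- Ew, EY; field; auto).
    rewrite EY1, ER, Ew.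
    transitivity ((2 * z * (z - x) - 2 * z * w) / (2 * w * (1 + w - z) * t)); [field; auto|].
    replace (2 * z * (z - x) - 2 * z * w) with (w * w - 1 - 2 * w * z + z * z) by
        (rewrite Sq; ring).
    field; auto.
Qed.

Lemma is_Cderive_kernel (alpha beta rho : C) (x t : R) : (Cmod rho < 1)%R -> (-1 < x < 1)%R ->
  (0 <= t <= 1)%R ->
  is_Cderive (fun s => kernel alpha beta (s * rho) x) t
    (- (Cpseries (fun n => kernel_log alpha beta x n * rho ^ S n) t *
        kernel alpha beta (t * rho) x)).
Proof.
  intros Hr Hx Ht. assert (Htr := scaled_lt_1 _ _ Hr Ht).
  assert (HR := is_Cderive_scaled_root rho x t Htr Hx).
  assert (Hid : is_Cderive (fun s => s * rho) t rho).
  { eapply is_Cderive_eq; [apply is_Cderive_mult; [apply is_Cderive_id|apply is_Cderive_const]|].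
    cbv beta. ring. }
  set (w := kernel_root (t * rho) x) in *. set (z := t * rho) in *.
  assert (Nw : w <> 0) by (apply Re_pos_neq_0, kernel_root_pos; auto).
  assert (P1 := base_minus_pos _ _ Htr Hx). assert (P2 := base_plus_pos _ _ Htr Hx). fold w in P1,
      P2.
  assert (N1 := Re_pos_neq_0 _ P1). assert (N2 := Re_pos_neq_0 _ P2).
  assert (H1 : is_Cderive (fun s => Clog (1 + kernel_root (s * rho) x - s * rho)) t
      ((rho * (z - x) / w - rho) / (1 + w - z))).
  { apply (is_Cderive_Clog (fun s => 1 + kernel_root (s * rho) x - s * rho)); auto.
    apply is_Cderive_minus; auto. eapply is_Cderive_eq;
        [apply is_Cderive_plus; [apply is_Cderive_const|exact HR]|]. ring. }
  assert (H2 : is_Cderive (fun s => Clog (1 + kernel_root (s * rho) x + s * rho)) t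
      ((rho * (z - x) / w + rho) / (1 + w + z))).
  { apply (is_Cderive_Clog (fun s => 1 + kernel_root (s * rho) x + s * rho)); auto.
    apply is_Cderive_plus; auto. eapply is_Cderive_eq;
        [apply is_Cderive_plus; [apply is_Cderive_const|exact HR]|]. ring. }
  assert (Ht' : (Rabs t <= 1)%R) by (apply Rabs_le; lra).
  assert (EY := legendre_generating rho x t Hr Hx Ht). fold z w in EY.
  assert (EC := chebyshev_generating rho x t Hr Hx Ht'). fold z in EC.
  rewrite <- kernel_root_sqr in EC. fold w in EC.
  assert (HG : geo_bounded (fun n => legendre x n * rho ^ n)) by
      (apply bounded_geo with 1%R; auto using legendre_bound).
  assert (ED := Cpseries_decr _ t HG Ht'). cbv beta in ED.
  rewrite kernel_log_series by auto.
  set (Y := Cpseries (fun n => legendre x n * rho ^ n) t) in *.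
  set (Y1 := Cpseries (fun n => legendre x (S n) * rho ^ S n) t) in *.
  set (U := Cpseries (fun n => chebyshev_shift x n * rho ^ S n) t) in *.
  replace (legendre x 0 * rho ^ 0) with (RtoC 1) in ED by (unfold legendre, ode_coef; simpl; ring).
  assert (Sq : w * w = 1 + z ^ 2 - 2 * z * x) by apply kernel_root_sqr.
  assert (EU : U = rho * (x - z) / (w * w)) by (rewrite <- EC; field; auto).
  assert (EYw : Y = / w) by (transitivity (Y * w / w); [|rewrite EY]; field; auto).
  assert (E0 : RtoC t = 0 -> Y1 = rho * x).
  { intros E. apply RtoC_inj in E. unfold Y1. rewrite E, Cpseries_at_0.
    unfold legendre. rewrite ode_coef_succ. unfold conv, ode_coef, chebyshev_shift. simpl. field. }
  (* The second identity is the first one at -rho, -x. *)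
  assert (EL1 : (rho * (z - x) / w - rho) / (1 + w - z) = - / 2 * (Y1 + rho * Y)) by
      (apply log_derivative with (RtoC t); auto).
  assert (EL2 : (rho * (z - x) / w + rho) / (1 + w + z) = - / 2 * (Y1 + - rho * Y)).
  { rewrite <- (log_derivative w (- z) (- x) (- rho) (RtoC t) Y Y1); auto.
    - replace (1 + w - - z) with (1 + w + z) by ring. field; auto.
    - replace (1 + w - - z) with (1 + w + z) by ring. auto.
    - rewrite Sq. ring.
    - unfold z. ring.
    - intros E. rewrite E0 by auto. ring. }
  rewrite EL1 in H1. rewrite EL2 in H2.
  unfold kernel, Cpower. eapply is_Cderive_eq.
  - apply is_Cderive_mult; [apply is_Cderive_mult; [exact HR|]|]; apply is_Cderive_Cexp,
      is_Cderive_mult;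
      [apply is_Cderive_const|exact H1|apply is_Cderive_const|exact H2].
  - cbv beta. fold z. fold w. rewrite EU. field. auto.
Qed.

Lemma kernel_at_0 alpha beta x : kernel alpha beta 0 x = Cexp ((alpha + beta) * Clog 2).
Proof.
  unfold kernel, Cpower. rewrite kernel_root_0. replace (1 + 1 - 0) with (RtoC 2) by ring.
  replace (1 + 1 + 0) with (RtoC 2) by ring. rewrite Cmult_1_l, <- Cexp_plus. f_equal. ring.
Qed.

(** The kernel solves the differential equation whose power series solution is formed by the
    coefficients [kernel_coef]; evaluate at the end t = 1 of the ray. *)
Lemma kernel_inv_series alpha beta rho x : (Cmod rho < 1)%R -> (-1 < x < 1)%R ->
  / kernel alpha beta rho x =
  Cexp (- ((alpha + beta) * Clog 2)) * Cpseries (fun n => kernel_coef alpha beta x n * rho ^ n) 1.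
Proof.
  intros Hr Hx. assert (N := kernel_neq_0 alpha beta _ _ Hr Hx).
  assert (E := ode_solution (kernel_log alpha beta x) (kernel_bound alpha beta) rho
    (fun t => kernel alpha beta (t * rho) x) (fun n => kernel_log_bound alpha beta x n Hx) Hr
    (fun t Ht => is_Cderive_kernel alpha beta rho x t Hr Hx Ht) 1%R ltac:(lra)).
  cbv beta in E. replace (1 * rho) with rho in E by ring.
  replace (0 * rho) with (RtoC 0) in E by ring.
  rewrite kernel_at_0 in E. fold (kernel_coef alpha beta x) in E.
  apply (f_equal (fun y => Cexp (- ((alpha + beta) * Clog 2)) * y / kernel alpha beta rho x)) in E.
  rewrite (Cmult_comm _ (Cexp ((alpha + beta) * Clog 2))), Cexp_opp in E.
  rewrite <- (Cmult_1_l (/ kernel alpha beta rho x)). unfold Cdiv in E. rewrite <- E.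
  unfold kernel_coef. field. auto.
Qed.

(** * Complex improper integrals and termwise integration *)

Definition is_Cint (f : R -> C) (v : C) : Prop :=
  is_RInt_gen (fun x => Re (f x)) (at_right (-1)) (at_left 1) (Re v) /\
  is_RInt_gen (fun x => Im (f x)) (at_right (-1)) (at_left 1) (Im v).

Lemma is_Cint_is_RInt_gen f v : is_Cint f v ->
  is_RInt_gen (V := C_R_NormedModule) f (at_right (-1)) (at_left 1) v.
Proof.
  intros [H1 H2].
  pose proof (ends_filter_l _ _ _ ends_unit) as Fl.
  pose proof (ends_filter_r _ _ _ ends_unit) as Fr.
  intros P [eps HP].
  change (filter_prod (at_right (-1)) (at_left 1)
    (fun ab => exists y, is_RInt (V := C_R_NormedModule) f (fst ab) (snd ab) y /\ P y)).
  assert (N1 : locally (Re v) (ball (Re v) eps)) by (exists eps; auto).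
  assert (N2 : locally (Im v) (ball (Im v) eps)) by (exists eps; auto).
  apply H1 in N1. apply H2 in N2. unfold filtermapi in N1, N2.
  generalize (filter_and _ _ N1 N2). apply filter_imp.
  intros [a b] [(y1 & I1 & B1) (y2 & I2 & B2)]. simpl in *. exists (y1, y2). split.
  - apply (is_RInt_fct_extend_pair (U := R_NormedModule) (V := R_NormedModule)); auto.
  - apply HP. split; auto.
Qed.

Lemma is_Cint_ext f g v : (forall x, (-1 < x < 1)%R -> f x = g x) -> is_Cint f v -> is_Cint g v.
Proof.
  intros E [H1 H2]. split; [revert H1|revert H2]; apply (improper_ext _ _ _ _ _ _ ends_unit);
    intros x Hx; rewrite E; auto.
Qed.

Lemma is_Cint_plus f g u v : is_Cint f u -> is_Cint g v -> is_Cint (fun x => f x + g x) (u + v).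
Proof.
  pose proof (ends_filter_l _ _ _ ends_unit) as Fl.
  pose proof (ends_filter_r _ _ _ ends_unit) as Fr.
  intros [A B] [A' B']. split; simpl; apply (is_RInt_gen_plus (V := R_NormedModule)); auto.
Qed.

Lemma is_Cint_scal c f v : is_Cint f v -> is_Cint (fun x => c * f x) (c * v).
Proof.
  pose proof (ends_filter_l _ _ _ ends_unit) as Fl.
  pose proof (ends_filter_r _ _ _ ends_unit) as Fr.
  intros [A B]. split; simpl.
  - apply (is_RInt_gen_minus (V := R_NormedModule));
      apply (is_RInt_gen_scal (V := R_NormedModule)); auto.
  - apply (is_RInt_gen_plus (V := R_NormedModule));
      apply (is_RInt_gen_scal (V := R_NormedModule)); auto.
Qed.

Lemma is_Cint_RtoC f l : is_RInt_gen f (at_right (-1)) (at_left 1) l ->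
  is_Cint (fun x => RtoC (f x)) (RtoC l).
Proof.
  pose proof (ends_filter_l _ _ _ ends_unit) as Fl.
  pose proof (ends_filter_r _ _ _ ends_unit) as Fr.
  intros H. split; simpl; auto.
  generalize (is_RInt_gen_scal (V := R_NormedModule) _ 0%R _ H).
  replace (scal 0%R l) with 0%R by (symmetry; apply Rmult_0_l).
  apply (improper_ext _ _ _ _ _ _ ends_unit). intros x _. apply Rmult_0_l.
Qed.

Lemma is_Cint_csum (f : nat -> R -> C) v n : (forall k, (k <= n)%nat -> is_Cint (f k) (v k)) ->
  is_Cint (fun x => csum (fun k => f k x) n) (csum v n).
Proof.
  induction n as [|n IH]; intros H; simpl; [apply H; lia|].
  apply is_Cint_plus; [apply IH; intros; apply H; lia|apply H; lia].
Qed.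

Lemma is_Cint_unique f u v : is_Cint f u -> is_Cint f v -> u = v.
Proof. intros [A B] [A' B']. apply C_ext; eapply (improper_unique _ _ _ _ _ _ ends_unit); eauto.
Qed.

Lemma improper_abs_le (f g : R -> R) l G : (forall x, (-1 < x < 1)%R -> (Rabs (f x) <= g x)%R) ->
  is_RInt_gen f (at_right (-1)) (at_left 1) l -> is_RInt_gen g (at_right (-1)) (at_left 1) G ->
  (Rabs l <= G)%R.
Proof.
  pose proof (ends_filter_l _ _ _ ends_unit) as Fl.
  pose proof (ends_filter_r _ _ _ ends_unit) as Fr.
  intros H Hl HG. apply Rabs_le. split.
  - apply (improper_le _ _ _ (fun x => (- g x)%R) f _ _ ends_unit); auto.
    + intros x Hx. specialize (H x Hx). apply Rabs_le_between in H. lra.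
    + apply (is_RInt_gen_opp (V := R_NormedModule)); auto.
  - apply (improper_le _ _ _ f g _ _ ends_unit); auto.
    intros x Hx. specialize (H x Hx). apply Rabs_le_between in H. lra.
Qed.

Lemma is_Cint_bound f g v G : (forall x, (-1 < x < 1)%R -> (Cmod (f x) <= g x)%R) ->
  is_Cint f v -> is_RInt_gen g (at_right (-1)) (at_left 1) G -> (Cmod v <= 2 * G)%R.
Proof.
  intros H [A B] HG. apply Rle_trans with (1 := Cmod_le_sum v).
  assert (Rabs (Re v) <= G)%R.
  { apply (improper_abs_le (fun x => Re (f x)) g); auto. intros x Hx.
    apply Rle_trans with (1 := re_le_Cmod _); auto. }
  assert (Rabs (Im v) <= G)%R.
  { apply (improper_abs_le (fun x => Im (f x)) g); auto. intros x Hx.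
    apply Rle_trans with (1 := Im_le_Cmod _); auto. }
  lra.
Qed.

Definition Ccontinuous (f : R -> C) (x : R) : Prop :=
  continuous (fun s => Re (f s)) x /\ continuous (fun s => Im (f s)) x.

Lemma Ccontinuous_const c x : Ccontinuous (fun _ => c) x.
Proof. split; apply continuous_const. Qed.

Lemma Ccontinuous_RtoC f x : continuous f x -> Ccontinuous (fun s => RtoC (f s)) x.
Proof. split; simpl; auto. apply continuous_const. Qed.

Lemma Ccontinuous_plus f g x : Ccontinuous f x -> Ccontinuous g x ->
  Ccontinuous (fun s => f s + g s) x.
Proof. intros [A B] [A' B']. split; simpl; apply (continuous_plus (V := R_NormedModule)); auto. Qed.

Lemma Ccontinuous_mult f g x : Ccontinuous f x -> Ccontinuous g x ->
  Ccontinuous (fun s => f s * g s) x.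
Proof.
  intros [A B] [A' B']. split; simpl.
  - apply (continuous_minus (V := R_NormedModule)); apply (continuous_mult (K := R_AbsRing)); auto.
  - apply (continuous_plus (V := R_NormedModule)); apply (continuous_mult (K := R_AbsRing)); auto.
Qed.

Lemma Ccontinuous_csum (f : nat -> R -> C) n x : (forall k, (k <= n)%nat -> Ccontinuous (f k) x) ->
  Ccontinuous (fun s => csum (fun k => f k s) n) x.
Proof.
  induction n as [|n IH]; intros H; simpl; [apply H; lia|].
  apply Ccontinuous_plus; [apply IH; intros; apply H; lia|apply H; lia].
Qed.

Lemma is_Cint_dominated f g G : (forall x, (-1 < x < 1)%R -> Ccontinuous f x) ->
  (forall x, (-1 < x < 1)%R -> continuous g x) ->
  (forall x, (-1 < x < 1)%R -> (Cmod (f x) <= g x)%R) ->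
  is_RInt_gen g (at_right (-1)) (at_left 1) G -> exists v, is_Cint f v.
Proof.
  intros Hf Hg H HG.
  destruct (improper_dominated _ _ _ (fun x => Re (f x)) g G ends_unit) as [u Hu]; auto.
  { intros x Hx; exact (proj1 (Hf x Hx)). }
  { intros; apply Rle_trans with (1 := re_le_Cmod _); auto. }
  destruct (improper_dominated _ _ _ (fun x => Im (f x)) g G ends_unit) as [v Hv]; auto.
  { intros x Hx; exact (proj2 (Hf x Hx)). }
  { intros; apply Rle_trans with (1 := Im_le_Cmod _); auto. }
  exists (u, v). split; auto.
Qed.

Lemma Cpseries_split A n : geo_bounded A -> Cpseries A 1 = csum A n +
  Cpseries (fun k => A (S n + k)%nat) 1.
Proof.
  intros HA. induction n as [|n IH].
  - rewrite Cpseries_decr by (auto; rewrite Rabs_R1; lra). simpl. ring.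
  - rewrite IH. rewrite (Cpseries_decr (fun k => A (S n + k)%nat)).
    + simpl csum. rewrite Nat.add_0_r.
      rewrite (Cpseries_ext (fun k => A (S n + S k)%nat) (fun k => A (S (S n) + k)%nat)); [ring|].
      intros k. f_equal. lia.
    + clear -HA. revert A HA. induction (S n) as [|m IH]; intros A HA; auto.
      apply (IH (fun k => A (S k))). apply geo_shift; auto.
    + rewrite Rabs_R1; lra.
Qed.

Lemma geo_Series_bound (a : nat -> R) K q : (0 < q < 1)%R ->
  (forall n, (Rabs (a n) <= K * q ^ n)%R) ->
  (Rabs (PSeries a 1) <= K / (1 - q))%R.
Proof.
  intros Hq Ha. unfold PSeries. rewrite (Series_ext _ a) by (intros; rewrite pow1; ring).
  assert (Hg : ex_series (fun n => (K * q ^ n)%R)).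
  { apply (ex_series_scal (V := R_NormedModule) K). apply ex_series_geom.
    rewrite Rabs_pos_eq; lra. }
  apply Rle_trans with (Series (fun n => Rabs (a n))).
  - apply Series_Rabs. apply (ex_series_le (V := R_CompleteNormedModule) _
      (fun n => (K * q ^ n)%R)); auto.
    intros n. unfold norm; simpl. unfold abs; simpl. rewrite Rabs_Rabsolu; auto.
  - apply Rle_trans with (Series (fun n => (K * q ^ n)%R)).
    + apply Series_le; auto. intros n; split; auto using Rabs_pos.
    + right. rewrite Series_scal_l, Series_geom; [reflexivity|rewrite Rabs_pos_eq; lra].
Qed.

Lemma geo_Cpseries_bound A K q : (0 < q < 1)%R -> (forall n, (Cmod (A n) <= K * q ^ n)%R) ->
  (Cmod (Cpseries A 1) <= 2 * (K / (1 - q)))%R.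
Proof.
  intros Hq HA. apply Rle_trans with (1 := Cmod_le_sum _). unfold Cpseries; simpl.
  assert (H1 := geo_Series_bound (fun n => Re (A n)) K q Hq
      (fun n => Rle_trans _ _ _ (re_le_Cmod _) (HA n))).
  assert (H2 := geo_Series_bound (fun n => Im (A n)) K q Hq
      (fun n => Rle_trans _ _ _ (Im_le_Cmod _) (HA n))).
  lra.
Qed.

Lemma geo_tail A K q n : (0 < q < 1)%R -> (forall n, (Cmod (A n) <= K * q ^ n)%R) ->
  (Cmod (Cpseries A 1 - csum A n) <= 2 * (K / (1 - q)) * q ^ S n)%R.
Proof.
  intros Hq HA. rewrite (Cpseries_split A n) by (exists K, q; auto).
  replace (csum A n + Cpseries (fun k => A (S n + k)%nat) 1 - csum A n) with
      (Cpseries (fun k => A (S n + k)%nat) 1) by ring.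
  apply Rle_trans with (2 * ((K * q ^ S n) / (1 - q)))%R.
  - apply geo_Cpseries_bound; auto. intros k. rewrite Rmult_assoc, <- pow_add. apply HA.
  - right. field. lra.
Qed.

Lemma eq_of_geometric_bound (u v : C) C0 q : (0 < q < 1)%R ->
  (forall n, (Cmod (u - v) <= C0 * q ^ n)%R) -> u = v.
Proof.
  intros Hq H. assert (E : Cmod (u - v) = 0%R).
  { apply Rle_antisym; [|apply Cmod_ge_0].
    assert (L : is_lim_seq (fun n => (C0 * q ^ n)%R) (C0 * 0)%R).
    { apply (is_lim_seq_scal_l (fun n => (q ^ n)%R) C0 0%R). apply is_lim_seq_geom.
      rewrite Rabs_pos_eq; lra. }
    rewrite Rmult_0_r in L.
    apply (is_lim_seq_le (fun _ => Cmod (u - v)) _ (Cmod (u - v)) 0%R H (is_lim_seq_const _) L). }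
  apply Cmod_eq_0 in E. replace u with (u - v + v) by ring. rewrite E. ring.
Qed.

(** Termwise integration: the partial sums converge uniformly relative to the weight W, so
    the integrals of the remainders tend to 0. *)
Lemma is_Cint_power_series (W : R -> R) G (h : R -> nat -> C) (A : nat -> C) K q : (0 < q < 1)%R ->
  (forall x, (-1 < x < 1)%R -> (0 <= W x)%R) -> (forall x, (-1 < x < 1)%R -> continuous W x) ->
  is_RInt_gen W (at_right (-1)) (at_left 1) G ->
  (forall x n, (-1 < x < 1)%R -> (Cmod (h x n) <= K * q ^ n)%R) ->
  (forall x, (-1 < x < 1)%R -> Ccontinuous (fun s => Cpseries (h s) 1) x) ->
  (forall n, is_Cint (fun x => W x * h x n) (A n)) ->
  geo_bounded A /\ is_Cint (fun x => W x * Cpseries (h x) 1) (Cpseries A 1).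
Proof.
  intros Hq HW0 HWc HG Hh Hc HA.
  pose proof (ends_filter_l _ _ _ ends_unit) as Fl.
  pose proof (ends_filter_r _ _ _ ends_unit) as Fr.
  assert (HGs : forall c : R, is_RInt_gen (fun x => (c * W x)%R) (at_right (-1)) (at_left 1)
      (c * G)%R)
    by (intros c; apply (is_RInt_gen_scal (V := R_NormedModule)); auto).
  assert (HWs : forall (c : R) x, (-1 < x < 1)%R -> continuous (fun x => (c * W x)%R) x).
  { intros c x Hx. apply (continuous_scal_r (V := R_NormedModule) c W); auto. }
  assert (HM : forall (c : R) (z : C) x, (-1 < x < 1)%R -> (Cmod z <= c)%R ->
      (Cmod (W x * z) <= c * W x)%R).
  { intros c z x Hx Hz. rewrite Cmod_mult, Cmod_R, Rabs_pos_eq by auto. rewrite Rmult_comm.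
    apply Rmult_le_compat_r; auto. }
  assert (HAb : forall n, (Cmod (A n) <= (2 * (K * G)) * q ^ n)%R).
  { intros n. apply Rle_trans with (2 * ((K * q ^ n) * G))%R; [|right; ring].
    apply (is_Cint_bound (fun x => W x * h x n) (fun x => ((K * q ^ n) * W x)%R)); auto. }
  assert (HgA : geo_bounded A) by (eexists; eexists; split; [exact Hq|exact HAb]).
  split; auto.
  destruct (is_Cint_dominated (fun x => W x * Cpseries (h x) 1)
      (fun x => (2 * (K / (1 - q)) * W x)%R)
    (2 * (K / (1 - q)) * G)%R) as [v Hv]; auto.
  { intros x Hx. apply Ccontinuous_mult; [apply Ccontinuous_RtoC|]; auto. }
  { intros x Hx. apply HM; auto. apply geo_Cpseries_bound; auto. }
  replace (Cpseries A 1) with v; auto.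
  assert (Hd : forall n, (Cmod (v - csum A n) <= 2 * ((2 * (K / (1 - q)) * q ^ S n) * G))%R).
  { intros n.
    assert (Hcs : is_Cint (fun x => csum (fun k => W x * h x k) n) (csum A n)) by
        (apply is_Cint_csum; auto).
    assert (Hdiff := is_Cint_plus _ _ _ _ Hv (is_Cint_scal (-1) _ _ Hcs)).
    replace (v - csum A n) with (v + -1 * csum A n) by ring.
    refine (is_Cint_bound _ _ _ _ _ Hdiff (HGs (2 * (K / (1 - q)) * q ^ S n)%R)).
    intros x Hx. rewrite <- csum_mult_l.
    replace (W x * Cpseries (h x) 1 + -1 * (W x * csum (h x) n)) with
        (W x * (Cpseries (h x) 1 - csum (h x) n)) by ring.
    apply HM; auto. apply geo_tail; auto. }
  (* Both the integral v and the sum of A are approximated by the partial sums of A, up to a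
     multiple of q^n. *)
  apply eq_of_geometric_bound with
      (2 * ((2 * (K / (1 - q)) * q) * G) + 2 * (2 * (K * G) / (1 - q)) * q)%R q; auto.
  intros n. replace (v - Cpseries A 1) with ((v - csum A n) + - (Cpseries A 1 - csum A n)) by ring.
  apply Rle_trans with (1 := Cmod_triangle _ _). rewrite Cmod_opp.
  assert (H1 := Hd n). assert (H2 := geo_tail A _ q n Hq HAb).
  apply Rle_trans with (1 := Rplus_le_compat _ _ _ _ H1 H2). right. simpl. field. lra.
Qed.

(** * The weighted integral of the kernel, up to its coefficients *)

Lemma Ccontinuous_ode_coef (a : R -> nat -> C) x : (forall k, Ccontinuous (fun s => a s k) x) ->
  forall n, Ccontinuous (fun s => ode_coef (a s) n) x.
Proof.
  intros Ha n. induction n as [n IH] using lt_wf_ind. destruct n as [|n];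
      [apply Ccontinuous_const|].
  assert (H : Ccontinuous (fun s => conv (a s) (ode_coef (a s)) n * / INR (S n)) x).
  { apply Ccontinuous_mult; [|apply Ccontinuous_const].
    apply (Ccontinuous_csum (fun k s => a s (n - k)%nat * ode_coef (a s) k)). intros k Hk.
    apply Ccontinuous_mult; auto. apply IH; lia. }
  destruct H as [H1 H2]. split; [revert H1|revert H2]; apply continuous_ext; intros s;
    rewrite ode_coef_succ; reflexivity.
Qed.

Lemma continuous_chebyshev n x : continuous (fun s => chebyshev s n) x /\
  continuous (fun s => chebyshev s (S n)) x.
Proof.
  induction n as [|n [IH1 IH2]].
  - split; [apply continuous_const|apply continuous_id].
  - split; auto. apply (continuous_ext
      (fun s => minus (mult (mult 2%R s) (chebyshev s (S n))) (chebyshev s n))).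
    + reflexivity.
    + apply (continuous_minus (V := R_NormedModule)); auto.
      apply (continuous_mult (K := R_AbsRing)); auto.
      apply (continuous_mult (K := R_AbsRing)); [apply continuous_const|apply continuous_id].
Qed.

Lemma Ccontinuous_cheb_shift k x : Ccontinuous (fun s => chebyshev_shift s k) x.
Proof. apply Ccontinuous_RtoC. apply (proj2 (continuous_chebyshev k x)). Qed.

Lemma Ccontinuous_legendre n x : Ccontinuous (fun s => legendre s n) x.
Proof. apply (Ccontinuous_ode_coef chebyshev_shift). intros; apply Ccontinuous_cheb_shift. Qed.

Lemma Ccontinuous_opp f x : Ccontinuous f x -> Ccontinuous (fun s => - f s) x.
Proof. intros [A B]. split; simpl; apply (continuous_opp (V := R_NormedModule)); auto. Qed.

Lemma Ccontinuous_kernel_coef alpha beta n x : Ccontinuous (fun s => kernel_coef alpha beta s n) x.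
Proof.
  apply (Ccontinuous_ode_coef (kernel_log alpha beta)). intros k. unfold kernel_log.
  assert (H1 := Ccontinuous_legendre k x). assert (H2 := Ccontinuous_legendre (S k) x).
  apply Ccontinuous_plus; [apply Ccontinuous_cheb_shift|].
  apply Ccontinuous_plus; (apply Ccontinuous_mult; [apply Ccontinuous_const|]);
      apply Ccontinuous_plus; auto.
  apply Ccontinuous_opp; auto.
Qed.

Lemma is_Cderive_Ccontinuous f x l : is_Cderive f x l -> Ccontinuous f x.
Proof. intros H. apply is_Cderive_continuous with l; auto. Qed.

(** The rules that differentiate the kernel in t also differentiate it in x. *)
Lemma kernel_inv_Ccontinuous alpha beta rho x : (Cmod rho < 1)%R -> (-1 < x < 1)%R ->
  Ccontinuous (fun s => / kernel alpha beta rho s) x.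
Proof.
  intros Hr Hx.
  assert (HR : exists l, is_Cderive (kernel_root rho) x l).
  { eexists. apply (is_Cderive_Csqrt (kernel_quadratic rho));
      [|apply kernel_quadratic_off_cut; auto].
    unfold kernel_quadratic. apply is_Cderive_minus; [apply is_Cderive_const|].
    apply is_Cderive_mult; [apply is_Cderive_const|apply is_Cderive_id]. }
  destruct HR as [l HR].
  assert (H1 := base_minus_pos _ _ Hr Hx). assert (H2 := base_plus_pos _ _ Hr Hx).
  assert (HB : forall c, is_Cderive (fun s => 1 + kernel_root rho s + c) x (0 + l + 0)).
  { intros c. repeat apply is_Cderive_plus; auto using is_Cderive_const. }
  eapply is_Cderive_Ccontinuous. apply is_Cderive_inv; [|apply kernel_neq_0; auto].
  unfold kernel, Cpower. apply is_Cderive_mult; [apply is_Cderive_mult; [exact HR|]|];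
    (apply is_Cderive_Cexp, is_Cderive_mult; [apply is_Cderive_const|]).
  - apply (is_Cderive_Clog (fun s => 1 + kernel_root rho s - rho)); [apply (HB (- rho))|auto].
  - apply (is_Cderive_Clog (fun s => 1 + kernel_root rho s + rho)); [apply (HB rho)|auto].
Qed.

Definition Cint (f : R -> C) : C :=
  (RInt_gen (fun x => Re (f x)) (at_right (-1)) (at_left 1),
   RInt_gen (fun x => Im (f x)) (at_right (-1)) (at_left 1)).

Lemma Cint_correct f v : is_Cint f v -> is_Cint f (Cint f).
Proof.
  pose proof (ends_filter_l _ _ _ ends_unit) as Fl.
  pose proof (ends_filter_r _ _ _ ends_unit) as Fr.
  intros [A B]. split; simpl; apply (RInt_gen_correct (V := R_CompleteNormedModule)); eexists;
      eauto.
Qed.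

(** The coefficients of the integrated series. They are the same for all rho, so that real
    values of rho determine them. *)
Definition jacobi_moment (alpha beta : C) (g b : R) (n : nat) : C :=
  Cint (fun x => jacobi_weight g b x * kernel_coef alpha beta x n).

Lemma kernel_coef_bound alpha beta x n : (-1 < x < 1)%R ->
  (Cmod (kernel_coef alpha beta x n) <= majorant_coef (kernel_bound alpha beta) n)%R.
Proof. intros Hx. apply ode_coef_bound. intros k. apply kernel_log_bound; auto. Qed.

Lemma jacobi_moment_correct alpha beta g b n : (-1 < g)%R -> (-1 < b)%R ->
  is_Cint (fun x => jacobi_weight g b x * kernel_coef alpha beta x n)
      (jacobi_moment alpha beta g b n).
Proof.
  intros Hg Hb.
  pose proof (ends_filter_l _ _ _ ends_unit) as Fl.
  pose proof (ends_filter_r _ _ _ ends_unit) as Fr.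
  set (c := majorant_coef (kernel_bound alpha beta) n).
  destruct (is_Cint_dominated (fun x => jacobi_weight g b x * kernel_coef alpha beta x n)
    (fun x => c * jacobi_weight g b x)%R (c * beta_integral g b)%R) as [v Hv].
  - intros x Hx. apply Ccontinuous_mult;
      [apply Ccontinuous_RtoC, jacobi_weight_continuous; auto|apply Ccontinuous_kernel_coef].
  - intros x Hx. apply (continuous_scal_r (V := R_NormedModule) c (jacobi_weight g b)),
      jacobi_weight_continuous; auto.
  - intros x Hx. rewrite Cmod_mult, Cmod_R, Rabs_pos_eq by (left; apply jacobi_weight_pos).
    rewrite Rmult_comm. apply Rmult_le_compat_r;
        [left; apply jacobi_weight_pos|apply kernel_coef_bound; auto].
  - apply (is_RInt_gen_scal (V := R_NormedModule)), beta_integral_converges; auto.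
  - apply Cint_correct with v; auto.
Qed.

(** The expansions of the kernel have a common majorant for all x, so they may be integrated
    termwise; this holds for complex rho, unlike the substitution below. *)
Lemma kernel_integral_moments (alpha beta rho : C) (g b : R) : (Cmod rho < 1)%R -> (-1 < g)%R ->
  (-1 < b)%R ->
  geo_bounded (fun n => jacobi_moment alpha beta g b n * rho ^ n) /\
  is_Cint (fun x => jacobi_weight g b x / kernel alpha beta rho x)
    (Cexp (- ((alpha + beta) * Clog 2)) *
        Cpseries (fun n => jacobi_moment alpha beta g b n * rho ^ n) 1).
Proof.
  intros Hr Hg Hb.
  destruct (geo_uniform (kernel_bound alpha beta) rho (kernel_bound_nonneg _ _) Hr) as
      (K & q & Hq & HK).
  destruct (is_Cint_power_series (jacobi_weight g b) (beta_integral g b)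
    (fun x n => kernel_coef alpha beta x n * rho ^ n)
    (fun n => jacobi_moment alpha beta g b n * rho ^ n) K q Hq) as [H1 H2].
  - intros; left; apply jacobi_weight_pos.
  - intros; apply jacobi_weight_continuous; auto.
  - apply beta_integral_converges; auto.
  - intros x n Hx. apply HK. intros; apply kernel_coef_bound; auto.
  - intros x Hx.
    assert (H : Ccontinuous (fun s => Cexp ((alpha + beta) * Clog 2) * / kernel alpha beta rho s) x)
      by (apply Ccontinuous_mult; [apply Ccontinuous_const|apply kernel_inv_Ccontinuous; auto]).
    (* Near x the series equals the reciprocal kernel up to a constant, which gives its
       continuity. *)
    assert (HE : locally x (fun s => Cexp ((alpha + beta) * Clog 2) * / kernel alpha beta rho s =
       Cpseries (fun n => kernel_coef alpha beta s n * rho ^ n) 1)).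
    { assert (Hm : (0 < Rmin (x - -1) (1 - x))%R) by (apply Rmin_pos; lra).
      exists (mkposreal _ Hm). intros s Hs. change (Rabs (s - x) < Rmin (x - -1) (1 - x))%R in Hs.
      apply Rabs_def2 in Hs. generalize (Rmin_l (x - -1) (1 - x)) (Rmin_r (x - -1) (1 - x)).
      intros M1 M2.
      rewrite kernel_inv_series by (auto; lra). rewrite Cmult_assoc, Cexp_opp. ring. }
    destruct H as [A B]. split; [revert A|revert B]; apply continuous_ext_loc;
      revert HE; apply filter_imp; intros s ->; reflexivity.
  - intros n. generalize (is_Cint_scal (rho ^ n) _ _
      (jacobi_moment_correct alpha beta g b n Hg Hb)).
    rewrite (Cmult_comm (rho ^ n)). apply is_Cint_ext. intros; ring.
  - split; auto. generalize (is_Cint_scal (Cexp (- ((alpha + beta) * Clog 2))) _ _ H2).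
    apply is_Cint_ext. intros x Hx. unfold Cdiv. rewrite kernel_inv_series by auto. ring.
Qed.

Definition lagrange_map (r y : R) : R := (y + r * (1 - y * y) / 2)%R.

Lemma lagrange_map_minus r y : (1 - lagrange_map r y = (1 - y) * (1 - r * ((1 + y) / 2)))%R.
Proof. unfold lagrange_map. field. Qed.

Lemma lagrange_map_plus r y : (1 + lagrange_map r y = (1 + y) * (1 + r * ((1 - y) / 2)))%R.
Proof. unfold lagrange_map. field. Qed.

Lemma lagrange_map_range r y : (-1 < r < 1)%R -> (-1 < y < 1)%R -> (-1 < lagrange_map r y < 1)%R.
Proof.
  intros Hr Hy. generalize (lagrange_map_minus r y) (lagrange_map_plus r y). intros H1 H2.
  assert (0 < (1 - y) * (1 - r * ((1 + y) / 2)))%R by (apply Rmult_lt_0_compat; nra).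
  assert (0 < (1 + y) * (1 + r * ((1 - y) / 2)))%R by (apply Rmult_lt_0_compat; nra). lra.
Qed.

(** The substitution maps each end of (-1,1) to itself, so the filters are preserved. *)
Lemma improper_change_variable (r : R) (f : R -> R) l : (-1 < r < 1)%R ->
  (forall x, (-1 < x < 1)%R -> continuous f x) ->
  is_RInt_gen f (at_right (-1)) (at_left 1) l ->
  is_RInt_gen (fun y => ((1 - r * y) * f (lagrange_map r y))%R) (at_right (-1)) (at_left 1) l.
Proof.
  intros Hr Hf Hl P HP.
  pose proof (ends_filter_l _ _ _ ends_unit) as Fl.
  pose proof (ends_filter_r _ _ _ ends_unit) as Fr.
  assert (LA : filterlim (lagrange_map r) (at_right (-1)) (at_right (-1))).
  { intros Q [e HQ]. assert (Hm : (0 < Rmin (e / 2) 2)%R) by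
      (apply Rmin_pos; [destruct e; simpl|]; lra).
    exists (mkposreal _ Hm). intros y Hy Hy'. change (Rabs (y - -1) < Rmin (e / 2) 2)%R in Hy.
    apply Rabs_def2 in Hy. generalize (Rmin_l (e / 2) 2) (Rmin_r (e / 2) 2). intros M1 M2.
    assert (HR := lagrange_map_range r y Hr ltac:(lra)). assert (HE := lagrange_map_plus r y).
    apply HQ; [|lra]. change (Rabs (lagrange_map r y - -1) < e)%R. rewrite Rabs_pos_eq by lra.
    assert (0 < 1 + y)%R by lra. assert (1 + r * ((1 - y) / 2) < 2)%R by nra. nra. }
  assert (LB : filterlim (lagrange_map r) (at_left 1) (at_left 1)).
  { intros Q [e HQ]. assert (Hm : (0 < Rmin (e / 2) 2)%R) by
      (apply Rmin_pos; [destruct e; simpl|]; lra).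
    exists (mkposreal _ Hm). intros y Hy Hy'. change (Rabs (y - 1) < Rmin (e / 2) 2)%R in Hy.
    apply Rabs_def2 in Hy. generalize (Rmin_l (e / 2) 2) (Rmin_r (e / 2) 2). intros M1 M2.
    assert (HR := lagrange_map_range r y Hr ltac:(lra)). assert (HE := lagrange_map_minus r y).
    apply HQ; [|lra]. change (Rabs (lagrange_map r y - 1) < e)%R. rewrite Rabs_left by lra.
    assert (0 < 1 - y)%R by lra. assert (1 - r * ((1 + y) / 2) < 2)%R by nra. nra. }
  change (filter_prod (at_right (-1)) (at_left 1) (fun ab => exists z,
    is_RInt (fun y => ((1 - r * y) * f (lagrange_map r y))%R) (fst ab) (snd ab) z /\ P z)).
  destruct (Hl P HP) as [Q1 Q2 HQ1 HQ2 HQ].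
  assert (HF := ends_prod _ _ _ 0 0 ends_unit ltac:(lra) ltac:(lra) ltac:(lra)).
  assert (HG : filter_prod (at_right (-1)) (at_left 1) (fun ab => exists z,
    is_RInt f (lagrange_map r (fst ab)) (lagrange_map r (snd ab)) z /\ P z)).
  { apply (Filter_prod _ _ _ (fun a => Q1 (lagrange_map r a)) (fun b => Q2 (lagrange_map r b))
      (LA Q1 HQ1) (LB Q2 HQ2)). intros a b Ha Hb. apply (HQ _ _ Ha Hb). }
  generalize (filter_and _ _ HG HF).
  apply filter_imp. intros [a b] [(z & Hz1 & Hz2) (Da & Db & _ & _ & Hab)]. simpl in *.
  exists z. split; auto.
  assert (Hin : forall x, (a <= x <= b)%R -> (-1 < x < 1)%R) by (intros; lra).
  rewrite <- (is_RInt_unique (V := R_CompleteNormedModule) _ _ _ _ Hz1).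
  apply (is_RInt_comp (V := R_CompleteNormedModule) f (lagrange_map r) (fun y => 1 - r * y)%R);
    intros x Hx; rewrite Rmin_left, Rmax_right in Hx by auto.
  - apply Hf, lagrange_map_range; auto.
  - split.
    + unfold lagrange_map. auto_derive; auto. field.
    + apply (ex_derive_continuous (V := R_NormedModule)). auto_derive; auto.
Qed.

Lemma is_Cint_change_variable (r : R) f v : (-1 < r < 1)%R ->
  (forall x, (-1 < x < 1)%R -> Ccontinuous f x) ->
  is_Cint f v -> is_Cint (fun y => RtoC (1 - r * y)%R * f (lagrange_map r y)) v.
Proof.
  intros Hr Hf [A B].
  assert (A' := improper_change_variable r _ _ Hr (fun x Hx => proj1 (Hf x Hx)) A).
  assert (B' := improper_change_variable r _ _ Hr (fun x Hx => proj2 (Hf x Hx)) B).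
  split; [revert A'|revert B']; apply (improper_ext _ _ _ _ _ _ ends_unit); intros x _; simpl;
    unfold Re, Im; ring.
Qed.

Lemma Clog_RtoC s : (0 < s)%R -> Clog s = RtoC (ln s).
Proof.
  intros H. rewrite Clog_right by auto. simpl. rewrite Cmod_R, Rabs_pos_eq by lra.
  replace (0 / s)%R with 0%R by (field; lra). rewrite atan_0. reflexivity.
Qed.

Lemma Csqrt_RtoC_sqr s : (0 < s)%R -> Csqrt (s * s) = RtoC s.
Proof.
  intros H. rewrite <- RtoC_mult. unfold Csqrt. rewrite Cmod_R, Rabs_pos_eq by nra. simpl.
  destruct (Rlt_dec 0 0); [lra|]. apply C_ext; simpl.
  - replace ((s * s + s * s) / 2)%R with (s * s)%R by field. apply sqrt_square; lra.
  - replace ((s * s - s * s) / 2)%R with 0%R by field. apply sqrt_0.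
Qed.

(** 1 + r^2 - 2 r x becomes the perfect square (1 - r y)^2. *)
Lemma kernel_root_lagrange r y : (-1 < r < 1)%R -> (-1 < y < 1)%R ->
  kernel_root r (lagrange_map r y) = RtoC (1 - r * y)%R.
Proof.
  intros Hr Hy. unfold kernel_root. rewrite <- (Csqrt_RtoC_sqr (1 - r * y)) by nra. f_equal.
  unfold kernel_quadratic. rewrite <- RtoC_mult. apply C_ext; simpl; unfold lagrange_map; field.
Qed.

Lemma Cpower_RtoC s w : (0 < s)%R -> Cpower s w = Cexp (w * ln s).
Proof. intros H. unfold Cpower. rewrite Clog_RtoC; auto. Qed.

Lemma Rpower_RtoC s c : RtoC (Rpower s c) = Cexp (c * ln s).
Proof. rewrite <- RtoC_mult, Cexp_RtoC. reflexivity. Qed.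

(** With q1 = 1 - r (1+y)/2 and q2 = 1 + r (1-y)/2, one has 1 - x = (1-y) q1, 1 + x = (1+y)
    q2, and the two bases of the kernel are 2 q1 and 2 q2. Hence q2 cancels and q1 survives
    with the exponent g - alpha. *)
Lemma kernel_lagrange (alpha : C) (b g r y : R) : (-1 < r < 1)%R -> (-1 < y < 1)%R ->
  RtoC (1 - r * y)%R * (jacobi_weight g b (lagrange_map r y) / kernel alpha b r
      (lagrange_map r y)) =
  Cexp (- ((alpha + b) * Clog 2)) *
      (jacobi_weight g b y * Cexp (- ((alpha - g) * ln (1 - r * ((1 + y) / 2))%R))).
Proof.
  intros Hr Hy. unfold kernel. rewrite kernel_root_lagrange by auto.
  assert (H1 : (0 < 1 - r * ((1 + y) / 2))%R) by nra.
  assert (H2 : (0 < 1 + r * ((1 - y) / 2))%R) by nra.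
  assert (H0 : (0 < 1 - r * y)%R) by nra.
  set (q1 := (1 - r * ((1 + y) / 2))%R) in *. set (q2 := (1 + r * ((1 - y) / 2))%R) in *.
  replace (1 + RtoC (1 - r * y)%R - r) with (RtoC (2 * q1)%R) by
      (unfold q1; apply C_ext; simpl; field).
  replace (1 + RtoC (1 - r * y)%R + r) with (RtoC (2 * q2)%R) by
      (unfold q2; apply C_ext; simpl; field).
  rewrite !Cpower_RtoC by lra. rewrite Clog_RtoC by lra. rewrite !ln_mult by lra.
  unfold jacobi_weight. rewrite lagrange_map_minus, lagrange_map_plus. fold q1 q2.
  replace ((1 - y) * q1 / 2)%R with ((1 - y) / 2 * q1)%R by field.
  replace ((1 + y) * q2 / 2)%R with ((1 + y) / 2 * q2)%R by field.
  rewrite <- !Rpower_mult_distr by lra. rewrite !RtoC_mult, !(Rpower_RtoC q1), !(Rpower_RtoC q2).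
  rewrite !RtoC_plus.
  assert (E : forall z, / Cexp z = Cexp (- z)).
  { intros z. transitivity (Cexp z * Cexp (- z) / Cexp z); [rewrite Cexp_opp|]; field;
      apply Cexp_neq_0. }
  set (A := RtoC (Rpower ((1 - y) / 2) g)). set (B := RtoC (Rpower ((1 + y) / 2) b)).
  assert (N : RtoC (1 - r * y)%R <> 0) by (intros X; apply RtoC_inj in X; lra).
  transitivity (A * B * (Cexp (g * ln q1) * Cexp (b * ln q2) * / Cexp (alpha * (ln 2 + ln q1)) *
     / Cexp (b * (ln 2 + ln q2)))); [field; auto using Cexp_neq_0|].
  rewrite !E.
  transitivity (A * B * (Cexp (- ((alpha + b) * ln 2)) * Cexp (- ((alpha - g) * ln q1)))); [|ring].
  rewrite <- !Cexp_plus. do 2 f_equal. ring.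
Qed.

(** * The coefficients, from the Euler integral at real rho *)

Definition binom_coef (s : C) (n : nat) : C := poch s n / INR (fact n).

Lemma INR_fact_C n : RtoC (INR (fact n)) <> 0.
Proof. intros E. apply RtoC_inj in E. revert E. apply INR_fact_neq_0. Qed.

Lemma fact_S_C n : RtoC (INR (fact (S n))) = INR (S n) * INR (fact n).
Proof. rewrite <- RtoC_mult, <- mult_INR. reflexivity. Qed.

Lemma INR_S_C n : RtoC (INR (S n)) = INR n + 1.
Proof. rewrite S_INR, RtoC_plus. reflexivity. Qed.

(** The differential equation of (1 - z)^(-s) in terms of coefficients. *)
Lemma binom_coef_sum s n : csum (fun k => s * binom_coef s k) n = poch s (S n) / INR (fact n).
Proof.
  induction n as [|n IH].
  - unfold binom_coef. simpl. field.
  - cbn [csum]. rewrite IH. unfold binom_coef.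
    change (poch s (S (S n))) with (poch s (S n) * (s + INR (S n))).
    rewrite fact_S_C. field. split; [apply INR_fact_C|apply INR_S_neq_0].
Qed.

Lemma binom_coef_ode s n : ode_coef (fun _ => s) n = binom_coef s n.
Proof.
  symmetry. revert n. apply ode_coef_unique.
  - unfold binom_coef. simpl. field.
  - intros n. unfold conv. rewrite binom_coef_sum. unfold binom_coef. rewrite fact_S_C.
    field. split; [apply INR_fact_C|apply INR_S_neq_0].
Qed.

(** (1 - t u)^s solves G' = - s u / (1 - t u) G, and the factor is a geometric series. *)
Lemma binomial_series (s : C) (u : R) : (-1 < u < 1)%R ->
  Cpseries (fun n => binom_coef s n * u ^ n) 1 = Cexp (- (s * ln (1 - u)%R)).
Proof.
  intros Hu. assert (Hr : (Cmod u < 1)%R) by (rewrite Cmod_R; apply Rabs_def1; lra).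
  assert (HB : geo_bounded (fun n => s * u ^ n)) by
      (apply (bounded_geo (fun _ => s) (Cmod s)); auto; intros; lra).
  assert (HS := geo_pow_succ (fun _ => s) u HB).
  assert (H := ode_solution (fun _ => s) (Cmod s) u (fun t => Cexp (s * ln (1 - t * u)%R))
     (fun _ => Rle_refl _) Hr).
  rewrite (Cpseries_ext _ (fun n => ode_coef (fun _ => s) n * u ^ n)) by
      (intros; rewrite binom_coef_ode; auto).
  assert (HX : Cpseries (fun n => ode_coef (fun _ => s) n * u ^ n) 1 *
      Cexp (s * ln (1 - 1 * u)%R) =
    Cexp (s * ln (1 - 0 * u)%R)).
  { apply H; [|lra]. clear H. intros t Ht.
    assert (Ht1 : (Rabs t <= 1)%R) by (apply Rabs_le; lra).
    assert (Hp : (0 < 1 - t * u)%R) by nra.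
    assert (Np : RtoC (1 - t * u)%R <> 0) by (intros X; apply RtoC_inj in X; lra).
    assert (E := Cpseries_decr _ t HS Ht1). cbv beta in E.
    rewrite (Cpseries_ext (fun n => s * u ^ S (S n)) (fun n => u * (s * u ^ S n))) in E by
        (intros; simpl; ring).
    rewrite (Cpseries_scal u (fun n => s * u ^ S n)) in E by auto.
    set (X := Cpseries (fun n => s * u ^ S n) t) in *.
    assert (EX : X = s * u / RtoC (1 - t * u)%R).
    { transitivity ((X - t * (u * X)) / RtoC (1 - t * u)%R).
      - rewrite RtoC_minus, RtoC_mult in *. field. auto.
      - rewrite E at 1. rewrite RtoC_minus, RtoC_mult in *. simpl. field. auto. }
    rewrite EX. eapply is_Cderive_eq.
    - apply is_Cderive_Cexp, is_Cderive_mult; [apply is_Cderive_const|].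
      apply (is_Cderive_RtoC (fun t => ln (1 - t * u)) t (- u / (1 - t * u))%R).
      auto_derive; [auto|]. field. lra.
    - rewrite RtoC_div by lra. rewrite RtoC_opp. field. auto. }
  rewrite Rmult_1_l, Rmult_0_l, Rminus_0_r, ln_1, Cmult_0_r, Cexp_0 in HX.
  transitivity (Cpseries (fun n => ode_coef (fun _ => s) n * u ^ n) 1 *
     (Cexp (s * ln (1 - u)%R) * Cexp (- (s * ln (1 - u)%R)))).
  - rewrite Cexp_opp. ring.
  - rewrite Cmult_assoc, HX. ring.
Qed.

Lemma Rpower_add_nat v b n : (0 < v)%R -> Rpower v (b + INR n) = (Rpower v b * v ^ n)%R.
Proof. intros H. rewrite Rpower_plus, Rpower_pow; auto. Qed.

Lemma binom_coef_bound s n : (Cmod (binom_coef s n) <= majorant_coef (Cmod s) n)%R.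
Proof. rewrite <- binom_coef_ode. apply ode_coef_bound. intros; lra. Qed.

Definition euler_moment (alpha : C) (g b : R) (n : nat) : C :=
  binom_coef (alpha - g) n * beta_integral g (b + INR n).

(** Expand (1 - r (1+y)/2)^(-s) by the binomial series; the factor ((1+y)/2)^n shifts the
    second exponent of the weight. *)
Lemma euler_integral (s : C) (g b r : R) : (-1 < r < 1)%R -> (-1 < g)%R -> (-1 < b)%R ->
  geo_bounded (fun n => binom_coef s n * beta_integral g (b + INR n) * r ^ n) /\
  is_Cint (fun y => jacobi_weight g b y * Cexp (- (s * ln (1 - r * ((1 + y) / 2))%R)))
    (Cpseries (fun n => binom_coef s n * beta_integral g (b + INR n) * r ^ n) 1).
Proof.
  intros Hr Hg Hb. assert (Hrm : (Cmod r < 1)%R) by (rewrite Cmod_R; apply Rabs_def1; lra).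
  destruct (geo_uniform (Cmod s) r (Cmod_ge_0 _) Hrm) as (K & q & Hq & HK).
  set (h := fun (y : R) n => binom_coef s n * RtoC (r * ((1 + y) / 2))%R ^ n).
  assert (Hu : forall y, (-1 < y < 1)%R -> (-1 < r * ((1 + y) / 2) < 1)%R) by (intros; nra).
  assert (Hser : forall y, (-1 < y < 1)%R -> Cpseries (h y) 1 =
      Cexp (- (s * ln (1 - r * ((1 + y) / 2))%R))).
  { intros y Hy. apply binomial_series; auto. }
  assert (Hpow : forall y n, RtoC (r * ((1 + y) / 2))%R ^ n = r ^ n * RtoC (((1 + y) / 2) ^ n)%R).
  { intros y n. rewrite RtoC_mult, Cpow_mult_l, (RtoC_pow ((1 + y) / 2)). reflexivity. }
  destruct (is_Cint_power_series (jacobi_weight g b) (beta_integral g b) h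
    (fun n => binom_coef s n * beta_integral g (b + INR n) * r ^ n) K q Hq) as [H1 H2].
  - intros; left; apply jacobi_weight_pos.
  - intros; apply jacobi_weight_continuous; auto.
  - apply beta_integral_converges; auto.
  - intros x n Hx. unfold h. rewrite Hpow, Cmult_assoc, Cmod_mult.
    apply Rle_trans with (2 := HK (binom_coef s) (binom_coef_bound s) n).
    rewrite <- (Rmult_1_r (Cmod (binom_coef s n * r ^ n))) at 2.
    apply Rmult_le_compat_l; [apply Cmod_ge_0|]. rewrite Cmod_R, <- RPow_abs.
    apply Rle_trans with (1 ^ n)%R; [apply pow_incr|rewrite pow1; lra].
    split; [apply Rabs_pos|]. apply Rabs_le. lra.
  - intros x Hx.
    assert (Hp : (0 < 1 - r * ((1 + x) / 2))%R) by (specialize (Hu x Hx); lra).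
    assert (H : Ccontinuous (fun y => Cexp (- (s * ln (1 - r * ((1 + y) / 2))%R))) x).
    { eapply is_Cderive_Ccontinuous.
      apply is_Cderive_Cexp, is_Cderive_opp, is_Cderive_mult; [apply is_Cderive_const|].
      apply is_Cderive_RtoC. auto_derive; [exact Hp|reflexivity]. }
    (* Continuity of the sum is read off from its closed form. *)
    assert (HE : locally x (fun y => Cexp (- (s * ln (1 - r * ((1 + y) / 2))%R)) =
        Cpseries (h y) 1)).
    { assert (Hm : (0 < Rmin (x - -1) (1 - x))%R) by (apply Rmin_pos; lra).
      exists (mkposreal _ Hm). intros y Hy. change (Rabs (y - x) < Rmin (x - -1) (1 - x))%R in Hy.
      apply Rabs_def2 in Hy. generalize (Rmin_l (x - -1) (1 - x)) (Rmin_r (x - -1) (1 - x)).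
      intros M1 M2.
      symmetry. apply Hser. lra. }
    destruct H as [A B]. split; [revert A|revert B]; apply continuous_ext_loc;
      revert HE; apply filter_imp; intros y ->; reflexivity.
  - intros n.
    assert (HJ := is_Cint_RtoC _ _
        (beta_integral_converges g (b + INR n) Hg ltac:(generalize (pos_INR n); lra))).
    generalize (is_Cint_scal (binom_coef s n * r ^ n) _ _ HJ).
    replace (binom_coef s n * beta_integral g (b + INR n) * r ^ n) with
        (binom_coef s n * r ^ n * beta_integral g (b + INR n)) by ring.
    apply is_Cint_ext. intros x Hx. unfold h. rewrite Hpow. unfold jacobi_weight.
    rewrite Rpower_add_nat by lra.
    rewrite !RtoC_mult. ring.
  - split; auto. revert H2. apply is_Cint_ext. intros x Hx. rewrite Hser; auto.
Qed.

Lemma Cpseries_real (A : nat -> C) (r : R) : Cpseries (fun n => A n * r ^ n) 1 = Cpseries A r.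
Proof.
  assert (E : forall n, A n * r ^ n = (Re (A n) * r ^ n, Im (A n) * r ^ n)%R).
  { intros n. rewrite <- RtoC_pow. apply C_ext; simpl; unfold Re, Im; ring. }
  unfold Cpseries, PSeries. f_equal; apply Series_ext; intros n; rewrite E; simpl; rewrite pow1;
      ring.
Qed.

Lemma radius_pos (a : nat -> R) K q : (forall n, Rabs (a n * (/ 2) ^ n) <= K * q ^ n)%R ->
  (0 < q < 1)%R ->
  Rbar_lt 0 (CV_radius a).
Proof.
  intros H Hq. apply Rbar_lt_le_trans with (/ 2)%R; [simpl; lra|].
  apply CV_radius_bounded. exists (Rabs K). intros n. apply Rle_trans with (1 := H n).
  assert (0 <= q ^ n <= 1)%R.
  { split; [apply pow_le; lra|].
    apply Rle_trans with (1 ^ n)%R; [apply pow_incr; lra|rewrite pow1; lra]. }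
  generalize (Rle_abs K) (Rabs_pos K). nra.
Qed.

Lemma Cpseries_coef_unique (A B : nat -> C) :
  geo_bounded (fun n => A n * RtoC (/ 2)%R ^ n) -> geo_bounded (fun n => B n * RtoC (/ 2)%R ^ n) ->
  (forall r, (-1 < r < 1)%R -> Cpseries (fun n => A n * RtoC r ^ n) 1 =
      Cpseries (fun n => B n * RtoC r ^ n) 1) ->
  forall n, A n = B n.
Proof.
  intros (K & q & Hq & HA) (K' & q' & Hq' & HB) H n.
  assert (R1 : forall (A : nat -> C) K q,
      (forall n, (Cmod (A n * RtoC (/ 2)%R ^ n) <= K * q ^ n)%R) -> (0 < q < 1)%R ->
    Rbar_lt 0 (CV_radius (fun n => Re (A n))) /\ Rbar_lt 0 (CV_radius (fun n => Im (A n)))).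
  { clear. intros A K q HA Hq. split; apply (radius_pos _ K q); auto; intros n;
      apply Rle_trans with (2 := HA n);
      rewrite <- RtoC_pow, Cmod_mult, Cmod_R, Rabs_mult; apply Rmult_le_compat_r;
          auto using Rabs_pos;
      [apply re_le_Cmod|apply Im_le_Cmod]. }
  (* Decay at the single point 1/2 makes the radii of convergence positive. *)
  destruct (R1 A K q HA Hq) as [A1 A2]. destruct (R1 B K' q' HB Hq') as [B1 B2].
  assert (H1 : (0 < 1)%R) by lra.
  apply C_ext; [apply (PSeries_ext_recip (fun n => Re (A n)) (fun n => Re (B n)))|
    apply (PSeries_ext_recip (fun n => Im (A n)) (fun n => Im (B n)))]; auto;
    exists (mkposreal _ H1); intros r Hr; change (Rabs (r - 0) < 1)%R in Hr; apply Rabs_def2 in Hr;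
    specialize (H r ltac:(lra)); rewrite !Cpseries_real in H; injection H; auto.
Qed.

(** Both sides are the coefficients of one function of real r, computed before and after
    Lagrange's substitution. *)
Lemma jacobi_moment_eq alpha (b g : R) n : (-1 < g)%R -> (-1 < b)%R ->
  jacobi_moment alpha b g b n = euler_moment alpha g b n.
Proof.
  intros Hg Hb. revert n. unfold euler_moment.
  assert (Hh : (Cmod (RtoC (/ 2)) < 1)%R) by (rewrite Cmod_R, Rabs_pos_eq; lra).
  apply Cpseries_coef_unique.
  - apply (kernel_integral_moments alpha b _ g b Hh); auto.
  - apply (euler_integral (alpha - g) g b (/ 2)); auto. lra.
  - intros r Hr. assert (Hrm : (Cmod r < 1)%R) by (rewrite Cmod_R; apply Rabs_def1; lra).
    destruct (kernel_integral_moments alpha b r g b Hrm Hg Hb) as [_ H1].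
    destruct (euler_integral (alpha - g) g b r Hr Hg Hb) as [_ H2].
    apply (is_Cint_scal (Cexp (- ((alpha + b) * Clog 2)))) in H2.
    apply (is_Cint_change_variable r) in H1; auto.
    + assert (E := is_Cint_unique _ _ _
        (is_Cint_ext _ _ _ (fun y Hy => kernel_lagrange alpha b g r y Hr Hy) H1) H2).
      set (X := Cexp _) in E. assert (N : X <> 0) by apply Cexp_neq_0.
      apply (f_equal (fun z => z / X)) in E.
      transitivity (X * Cpseries (fun n => jacobi_moment alpha b g b n * RtoC r ^ n) 1 / X);
          [field; auto|].
      rewrite E. field; auto.
    + intros x Hx. apply Ccontinuous_mult;
        [apply Ccontinuous_RtoC, jacobi_weight_continuous; auto|apply kernel_inv_Ccontinuous; auto].
Qed.

(** The case k = 0, for complex rho: the coefficients found at real rho are inserted in the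
    expansion valid in the whole disc. *)
Lemma kernel_integral (alpha rho : C) (g b : R) : (Cmod rho < 1)%R -> (-1 < g)%R -> (-1 < b)%R ->
  geo_bounded (fun n => euler_moment alpha g b n * rho ^ n) /\
  is_Cint (fun x => jacobi_weight g b x / kernel alpha b rho x)
    (Cexp (- ((alpha + b) * Clog 2)) * Cpseries (fun n => euler_moment alpha g b n * rho ^ n) 1).
Proof.
  intros Hr Hg Hb. destruct (kernel_integral_moments alpha b rho g b Hr Hg Hb) as [H1 H2].
  assert (E : forall n, jacobi_moment alpha b g b n * rho ^ n = euler_moment alpha g b n * rho ^ n)
    by (intros; rewrite jacobi_moment_eq; auto).
  split; [apply (geo_ext _ _ E H1)|]. rewrite <- (Cpseries_ext _ _ 1 E). auto.
Qed.

(** * Terminating Saalschutz summation *)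

Lemma poch_S_l z n : poch z (S n) = z * poch (z + 1) n.
Proof.
  induction n as [|n IH]; [simpl; ring|].
  change (poch z (S (S n))) with (poch z (S n) * (z + INR (S n))). rewrite IH.
  change (poch (z + 1) (S n)) with (poch (z + 1) n * (z + 1 + INR n)). rewrite INR_S_C. ring.
Qed.

Lemma poch_add z m n : poch z (m + n) = poch z m * poch (z + INR m) n.
Proof.
  induction n as [|n IH]; [rewrite Nat.add_0_r; simpl; ring|].
  rewrite Nat.add_succ_r. change (poch z (S (m + n))) with (poch z (m + n) * (z + INR (m + n))).
  rewrite IH. change (poch (z + INR m) (S n)) with (poch (z + INR m) n * (z + INR m + INR n)).
  rewrite plus_INR, RtoC_plus. ring.
Qed.

Lemma poch_neq_0 z n : (forall m, z + INR m <> 0) -> poch z n <> 0.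
Proof.
  intros H. induction n as [|n IH]; [exact C1_nz|]. apply Cmult_neq_0; auto.
Qed.

Lemma poch_opp_nat_0 k n : (k < n)%nat -> poch (- INR k) n = 0.
Proof.
  intros H. replace n with (S k + (n - S k))%nat by lia. rewrite poch_add.
  change (poch (- INR k) (S k)) with (poch (- INR k) k * (- INR k + INR k)). ring.
Qed.

Lemma poch_double z n : poch z (2 * n) = 4 ^ n * (poch (z / 2) n * poch ((z + 1) / 2) n).
Proof.
  induction n as [|n IH]; [simpl; ring|].
  replace (2 * S n)%nat with (S (S (2 * n))) by lia.
  change (poch z (S (S (2 * n)))) with (poch z (2 * n) * (z + INR (2 * n)) * (z + INR (S (2 * n)))).
  rewrite IH. change (poch (z / 2) (S n)) with (poch (z / 2) n * (z / 2 + INR n)).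
  change (poch ((z + 1) / 2) (S n)) with (poch ((z + 1) / 2) n * ((z + 1) / 2 + INR n)).
  rewrite INR_S_C, mult_INR, RtoC_mult, Cpow_S. simpl (INR 2). rewrite RtoC_plus.
  field.
Qed.

Definition regular (s : C) : Prop := forall m : nat, s + INR m <> 0.

Lemma regular_shift s n : regular s -> regular (s + INR n).
Proof. intros H m. rewrite <- Cplus_assoc, <- RtoC_plus, <- plus_INR. apply H. Qed.

Lemma regular_RtoC (r : R) : (0 < r)%R -> regular r.
Proof. intros H m. rewrite <- RtoC_plus. intros E. apply RtoC_inj in E. generalize (pos_INR m).
lra. Qed.

Definition saalschutz_term (k n : nat) (a s : C) (j : nat) : C :=
  poch (- INR k) j * poch (INR k + s - 1) j / INR (fact j) * (poch (a - INR j) n / poch s (n + j)).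

(** (a)_n / (s)_n times the Saalschutzian 3F2 (-k, k+s-1, 1-a; s+n, 1-a-n; 1), written
    without division by expressions in a, which may vanish. *)
Definition saalschutz_sum (k n : nat) (a s : C) : C := csum (saalschutz_term k n a s) k.

Lemma csum_by_parts (b c f : nat -> C) (d : nat -> C) K : b O = c O ->
  (forall j, b (S j) = c (S j) - d j * c j) ->
  csum (fun j => b j * f j) (S K) =
  csum (fun j => c j * (f j - d j * f (S j))) K + c (S K) * f (S K).
Proof.
  intros H0 H. induction K as [|K IH].
  - simpl. rewrite H0, H. ring.
  - change (csum (fun j => b j * f j) (S (S K))) with
      (csum (fun j => b j * f j) (S K) + b (S (S K)) * f (S (S K))).
    rewrite IH, (H (S K)). simpl. ring.
Qed.

(** Discrete analogue of integrating Rodrigues' formula by parts once: the weights (-k-1)_j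
    (k+s)_j / j! are of the form c_j - (s+j-1) c_(j-1), where c_j = (-k)_j (k+s+1)_j / j!,
    and the difference f_j - (s+j) f_(j+1) of f_j = (a-j)_n / (s)_(n+j) is again of the same
    shape, with n - 1 and s + 2. *)
Lemma saalschutz_succ k n a s : regular s ->
  saalschutz_sum (S k) n a s =
  match n with
  | O => 0
  | S m => INR n * (a + s + INR m) / (s * (s + 1)) * saalschutz_sum k m a (s + 2)
  end.
Proof.
  intros Hs.
  assert (Hp : forall n, poch s n <> 0) by (intros; apply poch_neq_0; auto).
  set (b := fun j => poch (- INR (S k)) j * poch (INR (S k) + s - 1) j / INR (fact j)).
  set (c := fun j => poch (- INR k) j * poch (INR k + s + 1) j / INR (fact j)).
  set (f := fun j => poch (a - INR j) n / poch s (n + j)).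
  assert (E : saalschutz_sum (S k) n a s = csum (fun j => c j * (f j - (s + INR j) * f (S j))) k).
  { unfold saalschutz_sum. change (saalschutz_term (S k) n a s) with (fun j => b j * f j).
    rewrite (csum_by_parts b c f (fun j => s + INR j)).
    - assert (E0 : c (S k) = 0) by (unfold c; rewrite poch_opp_nat_0 by lia; unfold Cdiv; ring).
      rewrite E0. ring.
    - unfold b, c. simpl. field.
    - intros j. unfold b, c. rewrite (poch_S_l (- INR (S k))), (poch_S_l (INR (S k) + s - 1)).
      change (poch (- INR k) (S j)) with (poch (- INR k) j * (- INR k + INR j)).
      change (poch (INR k + s + 1) (S j)) with (poch (INR k + s + 1) j * (INR k + s + 1 + INR j)).
      rewrite fact_S_C, !INR_S_C.
      replace (- (INR k + 1) + 1) with (- INR k) by ring.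
      replace (INR k + 1 + s - 1 + 1) with (INR k + s + 1) by ring.
      field. split; [apply INR_fact_C|rewrite <- INR_S_C; apply INR_S_neq_0]. }
  rewrite E. destruct n as [|m].
  - rewrite (csum_ext _ (fun _ => 0 * 0)).
    + rewrite <- csum_mult_l. ring.
    + intros j _. unfold f. simpl. field. split; [|apply Hp]. apply Hs.
  - unfold saalschutz_sum. rewrite csum_mult_l. apply csum_ext. intros j _.
    unfold saalschutz_term, c, f.
    replace (INR k + (s + 2) - 1) with (INR k + s + 1) by ring.
    replace (a - INR (S j)) with (a - INR j - 1) by (rewrite INR_S_C; ring).
    rewrite (poch_S_l (a - INR j - 1)). replace (a - INR j - 1 + 1) with (a - INR j) by ring.
    change (poch (a - INR j) (S m)) with (poch (a - INR j) m * (a - INR j + INR m)).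
    replace (S m + S j)%nat with (S (S (m + j))) by lia.
    change (S m + j)%nat with (S (m + j)).
    assert (E1 : poch s (S (S (m + j))) = s * (s + 1) * poch (s + 2) (m + j)).
    { rewrite !poch_S_l. replace (s + 1 + 1) with (s + 2) by ring. ring. }
    assert (E2 : poch s (S (S (m + j))) = poch s (S (m + j)) * (s + INR (S (m + j)))) by
        reflexivity.
    assert (N1 := Hp (S (m + j))). assert (N2 := Hp (S (S (m + j)))).
    assert (N3 : s + INR (S (m + j)) <> 0) by apply Hs.
    assert (N4 : s * (s + 1) * poch (s + 2) (m + j) <> 0) by (rewrite <- E1; auto).
    assert (N5 : s <> 0) by (intros X; apply N4; rewrite X; ring).
    assert (N6 : s + 1 <> 0) by (intros X; apply N4; rewrite X; ring).
    assert (N7 : poch (s + 2) (m + j) <> 0) by (intros X; apply N4; rewrite X; ring).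
    assert (E3 : poch s (S (m + j)) = s * (s + 1) * poch (s + 2) (m + j) / (s + INR (S (m + j))))
      by (rewrite <- E1, E2; field; auto).
    rewrite E1, E3. rewrite !INR_S_C, plus_INR, RtoC_plus in *. field.
    repeat split; auto. apply INR_fact_C.
Qed.

(** Each step lowers both k and n by 1, and n reaches 0 first. *)
Lemma saalschutz_zero k : forall n a s, regular s -> (n < k)%nat -> saalschutz_sum k n a s = 0.
Proof.
  induction k as [|k IH]; intros n a s Hs Hn; [lia|]. rewrite saalschutz_succ by auto.
  destruct n as [|m]; auto. rewrite IH; [ring| |lia].
  apply (regular_shift s 2) in Hs. simpl in Hs. rewrite RtoC_plus in Hs.
  intros i. specialize (Hs i). replace (s + 2) with (s + (1 + 1)) by ring. auto.
Qed.

Lemma saalschutz_value k : forall m a s, regular s ->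
  saalschutz_sum k (k + m) a s = INR (fact (k + m)) / INR (fact m) *
    (poch a m * poch (a + s - 1 + INR k + INR m) k / poch s (2 * k + m)).
Proof.
  induction k as [|k IH]; intros m a s Hs.
  - unfold saalschutz_sum, saalschutz_term. simpl. rewrite Nat.add_0_r.
    replace (a - 0) with a by ring.
    field. split; [apply poch_neq_0; auto|apply INR_fact_C].
  - rewrite saalschutz_succ by auto. cbn [Nat.add].
    assert (Hs2 : regular (s + 2)).
    { apply (regular_shift s 2) in Hs. simpl in Hs. rewrite RtoC_plus in Hs.
      intros i. specialize (Hs i). replace (s + 2) with (s + (1 + 1)) by ring. auto. }
    rewrite IH by auto. rewrite fact_S_C.
    replace (2 * S k + m)%nat with (S (S (2 * k + m))) by lia. rewrite !poch_S_l.
    replace (s + 1 + 1) with (s + 2) by ring.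
    replace (a + s - 1 + INR (S k) + INR m) with (a + s + INR (k + m)) by
        (rewrite INR_S_C, plus_INR, RtoC_plus; ring).
    replace (a + (s + 2) - 1 + INR k + INR m) with (a + s + INR (k + m) + 1) by
        (rewrite plus_INR, RtoC_plus; ring).
    assert (N0 := Hs O). assert (N1 := Hs 1%nat). simpl in N0, N1.
    replace (s + 0) with s in N0 by ring.
    field. repeat split; auto; [apply poch_neq_0; auto|apply INR_fact_C].
Qed.

(** Shifted Beta integrals, by the two contiguous relations; the denominators are multiplied
    out. *)
Lemma beta_integral_shift (g b : R) j n : (-1 < g)%R -> (-1 < b)%R ->
  RtoC (beta_integral (g + INR j) (b + INR n)) * poch (g + b + 2) (n + j) = beta_integral g b *
      poch (g + 1) j * poch (b + 1) n.
Proof.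
  intros Hg Hb. revert n. induction j as [|j IHj].
  - induction n as [|n IHn].
    + simpl. rewrite !Rplus_0_r. ring.
    + rewrite Nat.add_0_r in *. simpl (INR 0) in *. rewrite Rplus_0_r in *.
      rewrite S_INR. replace (b + (INR n + 1))%R with (b + INR n + 1)%R by ring.
      assert (P := pos_INR n). rewrite beta_integral_succ_r by lra.
      change (poch (g + b + 2) (S n)) with (poch (g + b + 2) n * (g + b + 2 + INR n)).
      change (poch (b + 1) (S n)) with (poch (b + 1) n * (b + 1 + INR n)).
      rewrite RtoC_mult, RtoC_div, !RtoC_plus by lra.
      rewrite !Cmult_assoc, <- IHn. field.
      rewrite <- !RtoC_plus. intros X; apply RtoC_inj in X; lra.
  - intros n. rewrite S_INR. replace (g + (INR j + 1))%R with (g + INR j + 1)%R by ring.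
    assert (P := pos_INR n). assert (Q := pos_INR j). rewrite beta_integral_succ_l by lra.
    rewrite Nat.add_succ_r.
    change (poch (g + b + 2) (S (n + j))) with
        (poch (g + b + 2) (n + j) * (g + b + 2 + INR (n + j))).
    change (poch (g + 1) (S j)) with (poch (g + 1) j * (g + 1 + INR j)).
    rewrite RtoC_mult, RtoC_div by lra.
    transitivity (RtoC (beta_integral (g + INR j) (b + INR n)) * poch (g + b + 2) (n + j) *
        (g + 1 + INR j)).
    + rewrite plus_INR, !RtoC_plus. field. rewrite <- !RtoC_plus. intros X; apply RtoC_inj in X;
        lra.
    + rewrite IHj. ring.
Qed.

(** The coefficient of ((1-x)/2)^j in the Jacobi polynomial P_k^(g,b). *)
Definition jacobi_coef (k : nat) (g b : R) (j : nat) : C :=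
  poch (g + 1) k / INR (fact k) *
  (poch (- INR k) j * poch (INR k + g + b + 1) j / (poch (g + 1) j * INR (fact j))).

Lemma jacobi_coef_sum k (g b : R) alpha n : (-1 < g)%R -> (-1 < b)%R ->
  csum (fun j => jacobi_coef k g b j * euler_moment alpha (g + INR j) b n) k =
  beta_integral g b * poch (g + 1) k / INR (fact k) * poch (b + 1) n / INR (fact n) *
      saalschutz_sum k n (alpha - g) (g + b + 2).
Proof.
  intros Hg Hb. unfold saalschutz_sum. rewrite csum_mult_l. apply csum_ext. intros j _.
  assert (Hs : regular (g + b + 2)).
  { rewrite <- !RtoC_plus. apply regular_RtoC. lra. }
  assert (Hr : regular (g + 1)) by (rewrite <- RtoC_plus; apply regular_RtoC; lra).
  assert (N1 : poch (g + b + 2) (n + j) <> 0) by (apply poch_neq_0; auto).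
  assert (N2 : poch (g + 1) j <> 0) by (apply poch_neq_0; auto).
  unfold jacobi_coef, euler_moment, saalschutz_term, binom_coef.
  assert (EJ : RtoC (beta_integral (g + INR j) (b + INR n)) = beta_integral g b * poch (g + 1) j *
      poch (b + 1) n / poch (g + b + 2) (n + j))
    by (rewrite <- beta_integral_shift by auto; field; auto).
  rewrite EJ. rewrite (RtoC_plus g).
  replace (alpha - (g + INR j)) with (alpha - g - INR j) by ring.
  replace (INR k + (g + b + 2) - 1) with (INR k + g + b + 1) by ring.
  field. repeat split; auto using INR_fact_C.
Qed.

(** * Jacobi polynomials of degree k *)

Lemma Series_finite (a : nat -> R) k : (forall n, (k < n)%nat -> a n = 0%R) -> Series a =
  sum_f_R0 a k.
Proof.
  intros H. apply is_series_unique.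
  assert (E : forall n, (k <= n)%nat -> sum_n a n = sum_f_R0 a k).
  { intros n Hn. rewrite sum_n_Reals. induction Hn as [|n Hn IH]; auto.
    rewrite tech5, IH, H by lia. apply Rplus_0_r. }
  apply (filterlim_ext_loc (fun _ => sum_f_R0 a k)); [|apply filterlim_const].
  exists k. intros n Hn. symmetry. apply E. auto.
Qed.

Lemma CSeries_finite (a : nat -> C) k : (forall n, (k < n)%nat -> a n = 0) -> CSeries a = csum a k.
Proof.
  intros H. unfold CSeries. apply C_ext; simpl; rewrite ?csum_re, ?csum_im; apply Series_finite;
    intros n Hn; rewrite H; auto.
Qed.

Lemma CSeries_Cpseries (a : nat -> C) : CSeries a = Cpseries a 1.
Proof. unfold CSeries, Cpseries, PSeries. f_equal; apply Series_ext; intros n; rewrite pow1; ring.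
Qed.

Lemma jacobiP_sum k (g b x : R) : (-1 < g)%R ->
  jacobiP k g b x = csum (fun j => jacobi_coef k g b j * RtoC ((1 - x) / 2)%R ^ j) k.
Proof.
  intros Hg. unfold jacobiP, pFq. rewrite (CSeries_finite _ k).
  - rewrite csum_mult_l. apply csum_ext. intros j _. unfold pFq_term, jacobi_coef, Cprod.
    simpl map. simpl fold_right.
    assert (Hr : regular (g + 1)) by (rewrite <- RtoC_plus; apply regular_RtoC; lra).
    replace (RtoC ((1 - x) / 2)%R) with ((1 - x) / 2) by
        (rewrite RtoC_div, RtoC_minus by lra; auto).
    field. repeat split; auto using INR_fact_C; apply poch_neq_0; auto.
  - intros n Hn. unfold pFq_term, Cprod. simpl map. simpl fold_right.
    rewrite poch_opp_nat_0 by auto.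
    unfold Cdiv. ring.
Qed.

Lemma Cpseries_csum (A : nat -> nat -> C) k : (forall j, (j <= k)%nat -> geo_bounded (A j)) ->
  geo_bounded (fun n => csum (fun j => A j n) k) /\
  csum (fun j => Cpseries (A j) 1) k = Cpseries (fun n => csum (fun j => A j n) k) 1.
Proof.
  induction k as [|k IH]; intros H; simpl.
  - split; [apply (geo_ext (A O)); auto|reflexivity].
  - destruct IH as [G E]; [intros; apply H; lia|]. split; [apply geo_plus; auto|].
    rewrite E, <- Cpseries_plus; auto. rewrite Rabs_R1; lra.
Qed.

Lemma Cpseries_leading_zeros (A : nat -> C) k : geo_bounded A ->
  (forall n, (n < k)%nat -> A n = 0) ->
  Cpseries A 1 = Cpseries (fun n => A (k + n)%nat) 1.
Proof.
  revert A. induction k as [|k IH]; intros A HA H; [apply Cpseries_ext; auto|].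
  rewrite Cpseries_decr by (auto; rewrite Rabs_R1; lra). rewrite H by lia.
  rewrite (IH (fun n => A (S n))); [simpl; ring|apply geo_shift; auto|intros; apply H; lia].
Qed.

Lemma geo_shift_inv A : geo_bounded (fun n => A (S n)) -> geo_bounded A.
Proof.
  intros (K & q & Hq & H). exists (Rabs K / q + Cmod (A O))%R, q. split; auto.
  assert (I : (0 < / q)%R) by (apply Rinv_0_lt_compat; lra).
  assert (P := Rabs_pos K). assert (Q := Cmod_ge_0 (A O)).
  intros [|n].
  - simpl. unfold Rdiv. nra.
  - apply Rle_trans with (1 := H n). simpl. assert (0 < q ^ n)%R by (apply pow_lt; lra).
    replace ((Rabs K / q + Cmod (A O)) * (q * q ^ n))%R with
        ((Rabs K + Cmod (A O) * q) * q ^ n)%R by (field; lra).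
    apply Rmult_le_compat_r; [lra|]. generalize (Rle_abs K). nra.
Qed.

Lemma geo_0 : geo_bounded (fun _ => 0).
Proof. exists 0%R, (/ 2)%R. split; [lra|]. intros n. rewrite Cmod_0. lra. Qed.

Lemma geo_ex_series A : geo_bounded A -> ex_series A.
Proof.
  intros (K & q & Hq & H). apply
      (ex_series_le (V := C_CompleteNormedModule) A (fun n => K * q ^ n)%R).
  - exact H.
  - apply (ex_series_scal (V := R_NormedModule) K). apply ex_series_geom. rewrite Rabs_pos_eq; lra.
Qed.

Definition series_coef (k : nat) (g b : R) (alpha : C) (n : nat) : C :=
  csum (fun j => jacobi_coef k g b j * euler_moment alpha (g + INR j) b n) k.

Definition series_const (k : nat) (g b : R) : C :=
  beta_integral g b * poch (g + 1) k * poch (b + 1) k / (INR (fact k) * poch (g + b + 2) (2 * k)).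

Lemma series_coef_low k (g b : R) alpha n : (-1 < g)%R -> (-1 < b)%R -> (n < k)%nat ->
  series_coef k g b alpha n = 0.
Proof.
  intros Hg Hb Hn. unfold series_coef. rewrite jacobi_coef_sum, saalschutz_zero by (auto;
    rewrite <- !RtoC_plus; apply regular_RtoC; lra). ring.
Qed.

(** The factor (k+m)! / m! of the Saalschutz sum cancels against the 1/n! of the binomial
    series, which leaves the continued term of index m. *)
Lemma series_coef_high k (g b : R) alpha rho m : (-1 < g)%R -> (-1 < b)%R ->
  series_coef k g b alpha (k + m) * rho ^ (k + m) =
  series_const k g b * rho ^ k * continued_term k alpha b g rho m.
Proof.
  intros Hg Hb.
  assert (Hs : regular (g + b + 2)) by (rewrite <- !RtoC_plus; apply regular_RtoC; lra).
  unfold series_coef. rewrite jacobi_coef_sum, saalschutz_value by auto.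
  unfold series_const, continued_term. rewrite !poch_add, Cpow_add_r.
  replace (g + b + 2 + INR (2 * k)) with (g + b + 2 * INR k + 2) by
      (rewrite mult_INR, RtoC_mult; simpl (INR 2); rewrite RtoC_plus; ring).
  replace (b + 1 + INR k) with (b + INR k + 1) by ring.
  replace (alpha - g + (g + b + 2) - 1 + INR k + INR m) with (alpha + b + INR k + INR m + 1) by
      ring.
  assert (N1 : poch (g + b + 2) (2 * k) <> 0) by (apply poch_neq_0; auto).
  assert (N2 : poch (g + b + 2 * INR k + 2) m <> 0).
  { apply poch_neq_0. apply (regular_shift _ (2 * k)) in Hs. intros i. specialize (Hs i).
    rewrite mult_INR, RtoC_mult in Hs. simpl (INR 2) in Hs. rewrite RtoC_plus in Hs.
    replace (g + b + 2 * INR k + 2 + INR i) with (g + b + 2 + (1 + 1) * INR k + INR i) by ring.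
    auto. }
  field. repeat split; auto using INR_fact_C.
Qed.

Lemma series_const_neq_0 k g b : (-1 < g)%R -> (-1 < b)%R -> series_const k g b <> 0.
Proof.
  intros Hg Hb. unfold series_const.
  assert (Hs : regular (g + b + 2)) by (rewrite <- !RtoC_plus; apply regular_RtoC; lra).
  assert (H1 : regular (g + 1)) by (rewrite <- !RtoC_plus; apply regular_RtoC; lra).
  assert (H2 : regular (b + 1)) by (rewrite <- !RtoC_plus; apply regular_RtoC; lra).
  apply Cmult_neq_0.
  - repeat apply Cmult_neq_0; try (apply poch_neq_0; auto).
    intros E; apply RtoC_inj in E. generalize (beta_integral_pos g b Hg Hb). lra.
  - intros E. assert (N : INR (fact k) * poch (g + b + 2) (2 * k) <> 0)
      by (apply Cmult_neq_0; [apply INR_fact_C|apply poch_neq_0; auto]).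
    (* An inverse that vanished would give 1 = 0. *)
    apply C1_nz. transitivity (INR (fact k) * poch (g + b + 2) (2 * k) *
        / (INR (fact k) * poch (g + b + 2) (2 * k))).
    + field. split; [apply poch_neq_0; auto|apply INR_fact_C].
    + rewrite E. ring.
Qed.

Lemma series_coef_sums k (g b : R) alpha rho : (Cmod rho < 1)%R -> (-1 < g)%R -> (-1 < b)%R ->
  geo_bounded (fun n => series_coef k g b alpha n * rho ^ n) /\
  csum (fun j => jacobi_coef k g b j *
      Cpseries (fun n => euler_moment alpha (g + INR j) b n * rho ^ n) 1) k =
  Cpseries (fun n => series_coef k g b alpha n * rho ^ n) 1.
Proof.
  intros Hr Hg Hb.
  assert (Hge : forall j, geo_bounded (fun n => euler_moment alpha (g + INR j) b n * rho ^ n)).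
  { intros j. apply (kernel_integral alpha rho (g + INR j) b Hr); auto. generalize (pos_INR j).
    lra. }
  destruct (Cpseries_csum (fun j n => jacobi_coef k g b j *
      (euler_moment alpha (g + INR j) b n * rho ^ n)) k) as [G E].
  { intros j _. apply (geo_scal (jacobi_coef k g b j)), Hge. }
  assert (X : forall n, csum (fun j => jacobi_coef k g b j *
      (euler_moment alpha (g + INR j) b n * rho ^ n)) k =
    series_coef k g b alpha n * rho ^ n).
  { intros n. unfold series_coef. rewrite Cmult_comm, csum_mult_l. apply csum_ext. intros; ring. }
  split; [apply (geo_ext _ _ X G)|]. rewrite <- (Cpseries_ext _ _ 1 X), <- E.
  apply csum_ext. intros j _. rewrite Cpseries_scal; auto. rewrite Rabs_R1; lra.
Qed.

(** For rho <> 0 the terms are proportional to those of the integrated series, whose decay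
    is known; for rho = 0 only the term of index 0 can be nonzero. *)
Lemma continued_term_geo k (g b : R) alpha rho : (Cmod rho < 1)%R -> (-1 < g)%R -> (-1 < b)%R ->
  geo_bounded (continued_term k alpha b g rho).
Proof.
  intros Hr Hg Hb. destruct (Ceq_dec rho 0) as [->|N].
  - apply geo_shift_inv. apply (geo_ext (fun _ => 0)); [|apply geo_0].
    intros n. unfold continued_term. rewrite Cpow_S. unfold Cdiv. ring.
  - destruct (series_coef_sums k g b alpha rho Hr Hg Hb) as [G _].
    assert (Gs : geo_bounded (fun m => series_coef k g b alpha (k + m) * rho ^ (k + m))).
    { clear -G. set (A := fun n => series_coef k g b alpha n * rho ^ n) in *.
      change (geo_bounded (fun m => A (k + m)%nat)). clearbody A. clear -G. revert A G.
      induction k as [|k IH]; intros A G; auto. apply (IH (fun n => A (S n))). apply geo_shift;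
          auto. }
    assert (N1 := series_const_neq_0 k g b Hg Hb).
    assert (N2 : rho ^ k <> 0) by (apply Cpow_nz; auto).
    apply (geo_ext (fun m => / (series_const k g b * rho ^ k) *
        (series_coef k g b alpha (k + m) * rho ^ (k + m)))).
    + intros m. rewrite series_coef_high by auto. field. auto.
    + apply geo_scal; auto.
Qed.

Lemma series_sum k (g b : R) alpha rho : (Cmod rho < 1)%R -> (-1 < g)%R -> (-1 < b)%R ->
  Cpseries (fun n => series_coef k g b alpha n * rho ^ n) 1 =
  series_const k g b * rho ^ k * CSeries (continued_term k alpha b g rho).
Proof.
  intros Hr Hg Hb. destruct (series_coef_sums k g b alpha rho Hr Hg Hb) as [G _].
  rewrite (Cpseries_leading_zeros _ k G).
  - rewrite (Cpseries_ext _ (fun m => series_const k g b * rho ^ k *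
      continued_term k alpha b g rho m))
      by (intros; apply series_coef_high; auto).
    rewrite Cpseries_scal, CSeries_Cpseries; auto;
        [apply continued_term_geo; auto|rewrite Rabs_R1; lra].
  - intros n Hn. rewrite series_coef_low by auto. ring.
Qed.

Lemma Gamma_shift s k : (0 < s)%R -> RtoC (Gamma (s + INR k)) = Gamma s * poch s k.
Proof.
  intros Hs. induction k as [|k IH]; [simpl; rewrite Rplus_0_r; ring|].
  rewrite S_INR, <- Rplus_assoc, Gamma_succ by (generalize (pos_INR k); lra).
  rewrite RtoC_mult, IH, RtoC_plus. simpl. ring.
Qed.

(** The formula in its continued form, which needs no case distinction on alpha. The
    constant T = 2^(g+b) relates the weight (1-x)^g (1+x)^b to [jacobi_weight]. *)
Lemma weighted_integral k (alpha : C) (b g : R) (rho : C) : (Cmod rho < 1)%R -> (-1 < g)%R ->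
  (-1 < b)%R ->
  is_Cint (fun x => Rpower (1 - x) g * Rpower (1 + x) b / kernel alpha b rho x * jacobiP k g b x)
    (Cpower 2 (1 + g - alpha) * Gamma (g + INR k + 1) * Gamma (b + INR k + 1)
      / (Gamma (g + b + 2) * poch ((g + b + 2) / 2) k * poch ((g + b + 3) / 2) k * INR (fact k))
      * (/ 4 ^ k * CSeries (continued_term k alpha b g rho)) * rho ^ k).
Proof.
  intros Hr Hg Hb.
  set (E := Cexp (- ((alpha + b) * Clog 2))). set (T := Cexp ((g + b) * Clog 2)).
  assert (Hj : forall j, is_Cint (fun x => jacobi_weight (g + INR j) b x / kernel alpha b rho x)
    (E * Cpseries (fun n => euler_moment alpha (g + INR j) b n * rho ^ n) 1)).
  { intros j. apply kernel_integral; auto. generalize (pos_INR j). lra. }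
  assert (H := is_Cint_scal T _ _
      (is_Cint_csum (fun j x => jacobi_coef k g b j *
          (jacobi_weight (g + INR j) b x / kernel alpha b rho x))
    (fun j => jacobi_coef k g b j *
        (E * Cpseries (fun n => euler_moment alpha (g + INR j) b n * rho ^ n) 1)) k
    (fun j _ => is_Cint_scal (jacobi_coef k g b j) _ _ (Hj j)))).
  rewrite (csum_ext _ (fun j => E *
      (jacobi_coef k g b j * Cpseries (fun n => euler_moment alpha (g + INR j) b n * rho ^ n)
          1))) in H
    by (intros; ring).
  rewrite <- csum_mult_l in H.
  rewrite (proj2 (series_coef_sums k g b alpha rho Hr Hg Hb)), series_sum in H by auto.
  match type of H with is_Cint _ ?v => match goal with |- is_Cint _ ?w => replace w with v end end.
  - revert H. apply is_Cint_ext. intros x Hx. rewrite jacobiP_sum by auto.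
    rewrite csum_mult_l. rewrite (csum_mult_l (_ / _)). apply csum_ext. intros j _.
    assert (ET : T = RtoC (Rpower 2 g) * RtoC (Rpower 2 b)).
    { unfold T. rewrite Clog_RtoC, !Rpower_RtoC, <- Cexp_plus by lra. f_equal. ring. }
    rewrite ET. unfold jacobi_weight. rewrite Rpower_add_nat by lra.
    assert (E1 : Rpower (1 - x) g = (Rpower 2 g * Rpower ((1 - x) / 2) g)%R)
      by (rewrite Rpower_mult_distr by lra; f_equal; field).
    assert (E2 : Rpower (1 + x) b = (Rpower 2 b * Rpower ((1 + x) / 2) b)%R)
      by (rewrite Rpower_mult_distr by lra; f_equal; field).
    rewrite E1, E2, !RtoC_mult, RtoC_pow.
    unfold Cdiv. ring.
  - unfold series_const. rewrite beta_integral_Gamma by auto.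
    assert (G1 := Gamma_pos (g + b + 2) ltac:(lra)).
    replace (g + INR k + 1)%R with (g + 1 + INR k)%R by ring.
    replace (b + INR k + 1)%R with (b + 1 + INR k)%R by ring.
    rewrite !Gamma_shift by lra. rewrite RtoC_div by lra. rewrite !RtoC_mult, !(RtoC_plus g),
        !(RtoC_plus b).
    assert (EE : Cpower 2 (1 + g - alpha) = 2 * (T * E)).
    { unfold Cpower, T, E. rewrite <- Cexp_plus.
      assert (E2 : RtoC 2 = Cexp (Clog 2)) by (rewrite Clog_RtoC, Cexp_RtoC, exp_ln by lra; auto).
      rewrite E2 at 2. rewrite <- Cexp_plus. f_equal. ring. }
    rewrite EE, poch_double.
    replace (g + b + 2 + 1) with (g + b + 3) by ring.
    assert (Hs : regular ((g + b + 2) / 2)).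
    { rewrite <- !RtoC_plus, <- RtoC_div by lra. apply regular_RtoC. lra. }
    assert (Hs' : regular ((g + b + 3) / 2)).
    { rewrite <- !RtoC_plus, <- RtoC_div by lra. apply regular_RtoC. lra. }
    assert (N4 : 4 ^ k <> 0) by (apply Cpow_nz; intros X; apply RtoC_inj in X; lra).
    field. repeat split; auto using INR_fact_C; try (apply poch_neq_0; auto).
    intros X; apply RtoC_inj in X; lra.
Qed.

(** (c)_k (c+k)_n = (c)_n (c+n)_k, both being (c)_(n+k); here c = alpha+beta+k+1. *)
Lemma pFq_term_continued k (alpha : C) (b g : R) (rho : C) n : (-1 < g)%R -> (-1 < b)%R ->
  regular (alpha + b + 1) ->
  pFq_term [b + INR k + 1; alpha + b + 2 * INR k + 1; alpha - g]
    [alpha + b + INR k + 1; g + b + 2 * INR k + 2] rho n =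
  / poch (alpha + b + INR k + 1) k * continued_term k alpha b g rho n.
Proof.
  intros Hg Hb Hc.
  assert (Hs : regular (g + b + 2 * INR k + 2)).
  { replace (g + b + 2 * INR k + 2) with (RtoC (g + b + 2 * INR k + 2)%R)
      by (rewrite !RtoC_plus, RtoC_mult; auto).
    apply regular_RtoC. generalize (pos_INR k). lra. }
  assert (Hc' : regular (alpha + b + INR k + 1)).
  { replace (alpha + b + INR k + 1) with (alpha + b + 1 + INR k) by ring.
    apply regular_shift; auto. }
  assert (EP : poch (alpha + b + INR k + 1) k * poch (alpha + b + 2 * INR k + 1) n =
    poch (alpha + b + INR k + 1) n * poch (alpha + b + INR k + INR n + 1) k).
  { replace (alpha + b + 2 * INR k + 1) with (alpha + b + INR k + 1 + INR k) by ring.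
    replace (alpha + b + INR k + INR n + 1) with (alpha + b + INR k + 1 + INR n) by ring.
    rewrite <- !poch_add. f_equal. lia. }
  assert (N1 : poch (alpha + b + INR k + 1) k <> 0) by (apply poch_neq_0; auto).
  assert (N2 : poch (alpha + b + INR k + 1) n <> 0) by (apply poch_neq_0; auto).
  assert (N3 : poch (g + b + 2 * INR k + 2) n <> 0) by (apply poch_neq_0; auto).
  assert (E2 : poch (alpha + b + 2 * INR k + 1) n =
    poch (alpha + b + INR k + 1) n *
        poch (alpha + b + INR k + INR n + 1) k / poch (alpha + b + INR k + 1) k)
    by (rewrite <- EP; field; auto).
  unfold pFq_term, continued_term, Cprod. simpl map. simpl fold_right. rewrite E2.
  field. repeat split; auto using INR_fact_C.
Qed.

Theorem corollary13 (k : nat) (alpha : C) (beta gamma : R) (rho : C)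
  (Hbeta : (-1 < beta)%R) (Hgamma : (-1 < gamma)%R)
  (Hbg : (-1 < beta < 0)%R -> (-1 < gamma < 0)%R -> (beta + gamma + 1)%R <> 0%R)
  (Hrho : (Cmod rho < 1)%R) :
  let Rt (x : R) : C := Csqrt (1 + rho ^ 2 - 2 * rho * x) in
  let integrand (x : R) : C :=
    Rpower (1 - x) gamma * Rpower (1 + x) beta
      / (Rt x * Cpower (1 + Rt x - rho) alpha * Cpower (1 + Rt x + rho) beta)
      * jacobiP k gamma beta x in
  let integral_is (v : C) : Prop :=
    is_RInt_gen (V := C_R_NormedModule) integrand (at_right (-1)) (at_left 1) v in
  let a3 : list C :=
    [beta + INR k + 1; alpha + beta + 2 * INR k + 1; alpha - gamma] in
  let b2 : list C :=
    [alpha + beta + INR k + 1; gamma + beta + 2 * INR k + 2] in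
  (~ nonpos_int (alpha + beta + 1) ->
    ex_series (pFq_term a3 b2 rho) /\
    integral_is
      (Cpower 2 (1 + gamma - alpha)
         * Gamma (gamma + INR k + 1) * Gamma (beta + INR k + 1)
         * poch ((alpha + beta + 1) / 2) k * poch ((alpha + beta + 2) / 2) k
       / (Gamma (gamma + beta + 2) * poch (alpha + beta + 1) k
          * poch ((gamma + beta + 2) / 2) k * poch ((gamma + beta + 3) / 2) k
          * INR (fact k))
       * pFq a3 b2 rho * rho ^ k))
  /\
  (nonpos_int (alpha + beta + 1) ->
    ex_series (continued_term k alpha beta gamma rho) /\
    integral_is
      (Cpower 2 (1 + gamma - alpha)
         * Gamma (gamma + INR k + 1) * Gamma (beta + INR k + 1)
       / (Gamma (gamma + beta + 2)
          * poch ((gamma + beta + 2) / 2) k * poch ((gamma + beta + 3) / 2) k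
          * INR (fact k))
       * (/ 4 ^ k * CSeries (continued_term k alpha beta gamma rho)) * rho ^ k)).
Proof.
  intros Rt integrand integral_is a3 b2.
  assert (H := is_Cint_is_RInt_gen _ _
      (weighted_integral k alpha beta gamma rho Hrho Hgamma Hbeta)).
  assert (G := continued_term_geo k gamma beta alpha rho Hrho Hgamma Hbeta).
  split; intros Hnp.
  - assert (Hc : regular (alpha + beta + 1)).
    { intros m E. apply Hnp. exists m. apply (Ceq_of_diff _ _ _ _ E). ring. }
    assert (Hterm : forall n, / poch (alpha + beta + INR k + 1) k *
        continued_term k alpha beta gamma rho n =
      pFq_term a3 b2 rho n) by (intros; symmetry; apply pFq_term_continued; auto).
    assert (G' : geo_bounded (pFq_term a3 b2 rho)) by (apply (geo_ext _ _ Hterm), geo_scal, G).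
    split; [apply geo_ex_series; auto|].
    assert (EF : pFq a3 b2 rho = / poch (alpha + beta + INR k + 1) k *
        CSeries (continued_term k alpha beta gamma rho)).
    { unfold pFq. rewrite !CSeries_Cpseries, <- (Cpseries_ext _ _ 1 Hterm), Cpseries_scal; auto.
      rewrite Rabs_R1; lra. }
    unfold integral_is.
    match type of H with is_RInt_gen _ _ _ ?v => match goal with |- is_RInt_gen _ _ _ ?w =>
        replace w with v end end.
    + exact H.
    + rewrite EF.
      assert (ED := poch_double (alpha + beta + 1) k).
      replace (alpha + beta + 1 + 1) with (alpha + beta + 2) in ED by ring.
      replace (2 * k)%nat with (k + k)%nat in ED by lia. rewrite poch_add in ED.
      replace (alpha + beta + 1 + INR k) with (alpha + beta + INR k + 1) in ED by ring.
      assert (N1 : poch (alpha + beta + 1) k <> 0) by (apply poch_neq_0; auto).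
      assert (N2 : poch (alpha + beta + INR k + 1) k <> 0).
      { replace (alpha + beta + INR k + 1) with (alpha + beta + 1 + INR k) by ring.
        apply poch_neq_0, regular_shift; auto. }
      assert (Hs : regular ((gamma + beta + 2) / 2)).
      { rewrite <- !RtoC_plus, <- RtoC_div by lra. apply regular_RtoC. lra. }
      assert (Hs' : regular ((gamma + beta + 3) / 2)).
      { rewrite <- !RtoC_plus, <- RtoC_div by lra. apply regular_RtoC. lra. }
      assert (N4 : 4 ^ k <> 0) by (apply Cpow_nz; intros X; apply RtoC_inj in X; lra).
      assert (G1 := Gamma_pos (gamma + beta + 2) ltac:(lra)).
      set (P1 := poch ((alpha + beta + 1) / 2) k) in *.
      set (P2 := poch ((alpha + beta + 2) / 2) k) in *.
      assert (EP : / 4 ^ k = P1 * P2 /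
          (poch (alpha + beta + 1) k * poch (alpha + beta + INR k + 1) k)).
      { transitivity (4 ^ k * (P1 * P2) /
          (4 ^ k * (poch (alpha + beta + 1) k * poch (alpha + beta + INR k + 1) k)));
          [|field; auto]. rewrite <- ED. field. auto. }
      rewrite EP. field.
      repeat split; auto using INR_fact_C; try (apply poch_neq_0; auto).
      intros X; apply RtoC_inj in X; lra.
  - split; [apply geo_ex_series; auto|]. exact H.
Qed.
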